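(* Consider the rotator-pendulum Hamiltonian $H_0(p,q,I,\theta)=h_0(I)+\sum_{i=1}^n\pm\left(\tfrac12p_i^2+V_i(q_i)\right)$, its general time-dependent (not necessarily Hamiltonian) perturbation $\dot z=\mathcal X^0(z)+\varepsilon\mathcal X^1(z,t;\varepsilon)$ with $\mathcal X^0=J\nabla H_0$, and the associated extended flow $\tilde\Phi^s_\varepsilon$, normally hyperbolic manifolds $\tilde\Lambda_\varepsilon$ and foot-point projections $\Omega^\pm$, as set up in the context. Assume that $W^{\rm s}(\tilde\Lambda_\varepsilon)$ and $W^{\rm u}(\tilde\Lambda_\varepsilon)$ intersect transversally for $0<|\varepsilon|<\varepsilon_0$ along homoclinic channels depending smoothly on $\varepsilon$, and let $\tilde z_\varepsilon\in W^{\rm s}(\tilde\Lambda_\varepsilon)\cap W^{\rm u}(\tilde\Lambda_\varepsilon)$ be homoclinic points in these channels, with $\tilde z_\varepsilon^\pm=\Omega^\pm(\tilde z_\varepsilon)\in\tilde\Lambda_\varepsilon$, so that the scattering map satisfies $\tilde\sigma_\varepsilon(\tilde z_\varepsilon^-)=\tilde z_\varepsilon^+$. Let $\tilde z_0\in W^{\rm s}(\tilde\Lambda_0)\cap W^{\rm u}(\tilde\Lambda_0)$ be the homoclinic point of the unperturbed system corresponding to $\tilde z_\varepsilon$, i.e. $\tilde z_\varepsilon=\tilde z_0+O(\varepsilon)$, and let $\tilde z_0^\pm=\Omega^\pm(\tilde z_0)\in\tilde\Lambda_0$; here $\tilde z_0^+=\tilde z_0^-$, this common point is denoted $\tilde z_0^\pm$,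 and $I_0=I(\tilde z_0^\pm)$. Then there is $0<\varrho<1$ such that the change in angle $\theta$ by the scattering map $\tilde\sigma_\varepsilon$ is given by $$\begin{aligned}\theta(\tilde z_\varepsilon^+)-\theta(\tilde z_\varepsilon^-)=&-\varepsilon\int_{-\infty}^{+\infty}\left(\mathcal X^1\theta(\tilde\Phi_0^s(\tilde z_0^\pm))-\mathcal X^1\theta(\tilde\Phi_0^s(\tilde z_0))\right)ds\\&+\varepsilon\left(\int_{-\infty}^{+\infty}\left(\mathcal X^1I(\tilde\Phi_0^s(\tilde z_0^\pm))-\mathcal X^1I(\tilde\Phi_0^s(\tilde z_0))\right)s\,ds\right)\cdot\frac{\partial^2h_0}{\partial I^2}(I_0)+O(\varepsilon^{1+\varrho}).\end{aligned}$$ In the case when the perturbation is Hamiltonian, $\mathcal X^1=J\nabla_zH_1$ with $H_1=H_1(z,t;\varepsilon)$, this reads $$\begin{aligned}\theta(\tilde z_\varepsilon^+)-\theta(\tilde z_\varepsilon^-)=&-\varepsilon\int_{-\infty}^{+\infty}\left([\theta,H_1](\tilde\Phi_0^s(\tilde z_0^\pm))-[\theta,H_1](\tilde\Phi_0^s(\tilde z_0))\right)ds\\&+\varepsilon\left(\int_{-\infty}^{+\infty}\left([I,H_1](\tilde\Phi_0^s(\tilde z_0^\pm))-[I,H_1](\tilde\Phi_0^s(\tilde z_0))\right)s\,ds\right)\cdot\frac{\partial^2h_0}{\partial I^2}(I_0)+O(\varepsilon^{1+\varrho}).\end{aligned}$$ In the second term of each formula the integral is a $1\times d$ vector and $\frac{\partial^2h_0}{\partial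 I^2}(I_0)$ is a $d\times d$ matrix; $[\theta,H_1]$ and $[I,H_1]$ are $1\times d$ vectors. The integrals on the right-hand sides are evaluated with $\mathcal X^1=\mathcal X^1(\cdot;0)$ and $H_1=H_1(\cdot;0)$, respectively.
   Context: **Unperturbed system.** $z=(p,q,I,\theta)$ with $p\in\mathbb R^n$, $q\in\mathbb T^n$, $I\in\mathbb R^d$, $\theta\in\mathbb T^d$ ($\mathbb T=\mathbb R/\mathbb Z$), symplectic form $\sum_i dp_i\wedge dq_i+\sum_j dI_j\wedge d\theta_j$, phase space $M$. $H_0(p,q,I,\theta)=h_0(I)+\sum_{i=1}^n\pm(\frac12p_i^2+V_i(q_i))$ is $C^{r+1}$ with $r$ sufficiently large, where for each $i$ a sign $\pm$ is fixed. Each $V_i$ is $1$-periodic, $V_i'(0)=0$, $V_i''(0)<0$ (a local maximum), and $V_i'(q_* )=0$, $V_i(q_* )=V_i(0)$ imply $q_*=0$. Sign conventions: the Hamiltonian vector field $J\nabla H$ is $\dot p=-\partial_qH$, $\dot q=\partial_pH$, $\dot I=-\partial_\theta H$, $\dot\theta=\partial_IH$; thus $[I,H]=-\partial H/\partial\theta$ and $[\theta,H]=\partial H/\partial I$. Write $\omega(I)=\partial h_0/\partial I$. **Perturbation.** $\mathcal X^1(z,t;\varepsilon)$ is a time- and parameter-dependent $C^r$ vector field on $M$, uniformly differentiable in all variables (bounded with bounded derivatives), with arbitrary dependence on $t\in\mathbb R$; in the Hamiltonian case $H_1$ is $C^{r+1}$. A vector field acts on functions as a differential operator, $\mathcal X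 f=\sum_j\mathcal X_j\,\partial_{z_j}f$, componentwise on vector-valued $f$; so $\mathcal X^1I$ and $\mathcal X^1\theta$ are the $I$- and $\theta$-components of $\mathcal X^1$. **Extended flow.** $\tilde\Phi^s_\varepsilon$ is the flow on $\tilde M=M\times\mathbb R$ of $\dot z=\mathcal X^0(z)+\varepsilon\mathcal X^1(z,t;\varepsilon)$, $\dot t=1$ (derivatives in $s$); $\tilde z=(z,t)$; functions of $z$ are viewed as functions on $\tilde M$. **NHIMs.** Let $D\subset\mathbb R^d$ be a closed ball, $\Lambda_0=\{p=q=0,\ I\in D\}$ and $\tilde\Lambda_0=\Lambda_0\times\mathbb R$, a normally hyperbolic invariant manifold (NHIM) with boundary of $\tilde\Phi^s_0$. For it $W^{\rm s}(\tilde\Lambda_0)=W^{\rm u}(\tilde\Lambda_0)$, and $W^{\rm s}(\tilde z)=W^{\rm u}(\tilde z)$ for each $\tilde z\in\tilde\Lambda_0$. For $|\varepsilon|<\varepsilon_0$ it persists as a (locally invariant; invariant for a suitably extended system) NHIM $\tilde\Lambda_\varepsilon$ of $\tilde\Phi_\varepsilon^s$; $\tilde\Lambda_\varepsilon$, its stable and unstable manifolds $W^{\rm s}(\tilde\Lambda_\varepsilon)$, $W^{\rm u}(\tilde\Lambda_\varepsilon)$, and their fibers $W^{\rm s}(\tilde z),W^{\rm u}(\tilde z)$, $\tilde z\in\tilde\Lambda_\varepsilon$, depend smoothly on $\varepsilon$ (and are $O(\varepsilon)$-close to the unperturbed ones). **Foot points.** $\Omega^+:W^{\rm s}(\tilde\Lambda_\varepsilon)\to\tilde\Lambda_\varepsilon$,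 $\Omega^-:W^{\rm u}(\tilde\Lambda_\varepsilon)\to\tilde\Lambda_\varepsilon$ are the projections along fibers: $\tilde z\in W^{\rm s}(\Omega^+(\tilde z))$, $\tilde z\in W^{\rm u}(\Omega^-(\tilde z))$. They are characterized by $d(\tilde\Phi^s_\varepsilon(\tilde z),\tilde\Phi^s_\varepsilon(\Omega^+\tilde z))\le Ce^{s\lambda_+}$ for $s\ge0$ and $d(\tilde\Phi^s_\varepsilon(\tilde z),\tilde\Phi^s_\varepsilon(\Omega^-\tilde z))\le Ce^{s\mu_-}$ for $s\le0$, with $\lambda_+<0<\mu_-$ and $C$ independent of $\varepsilon$. **Scattering map.** A homoclinic channel is a manifold $\tilde\Gamma_\varepsilon\subset W^{\rm s}(\tilde\Lambda_\varepsilon)\cap W^{\rm u}(\tilde\Lambda_\varepsilon)$ along which the intersection is transverse, with $T\tilde M=T\tilde\Gamma_\varepsilon\oplus TW^{\rm u}(\tilde z^-)\oplus TW^{\rm s}(\tilde z^+)$ at every $\tilde z\in\tilde\Gamma_\varepsilon$ ($\tilde z^\pm=\Omega^\pm(\tilde z)$), such that $\Omega^\pm|_{\tilde\Gamma_\varepsilon}$ are diffeomorphisms onto open subsets of $\tilde\Lambda_\varepsilon$. The scattering map is $\tilde\sigma_\varepsilon=\Omega^+\circ(\Omega^-|_{\tilde\Gamma_\varepsilon})^{-1}$. For $\varepsilon=0$ the scattering map is the identity, $\tilde z_0^-=\tilde z_0^+$. The difference $\theta(\tilde z_\varepsilon^+)-\theta(\tilde z_\varepsilon^-)$ of points of $\mathbb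 T^d$ is understood through its representative in $\mathbb R^d$ close to $0$. $O(\varepsilon^{a})$ denotes a quantity bounded by a constant times $|\varepsilon|^{a}$ as $\varepsilon\to0$. *)

(* Defs.v *)
From mathcomp Require Export all_boot all_order all_algebra.
From mathcomp Require Export all_classical all_reals all_analysis.

Set Implicit Arguments.
Unset Strict Implicit.
Unset Printing Implicit Defensive.

Export Order.TTheory GRing.Theory Num.Theory numFieldNormedType.Exports.

#[global] Open Scope classical_set_scope.
#[global] Open Scope ring_scope.

(* ---------- Differentiability classes ---------- *)

(* In finite dimension, f is C^k.+1 on the open set U iff it is differentiable
   on U and all its directional derivatives are C^k on U. *)
Fixpoint Ck {R : realType} {V W : normedModType R} (k : nat) (U : set V)
    (f : V -> W) : Prop :=
  match k with
  | 0 => forall x, U x -> {for x, continuous f}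
  | k'.+1 => (forall x, U x -> differentiable f x) /\
             (forall v, Ck k' U (fun x => 'D_v f x))
  end.

(* C^k with all derivatives of order <= k bounded on U. *)
Fixpoint Ck_bounded {R : realType} {V W : normedModType R} (k : nat)
    (U : set V) (f : V -> W) : Prop :=
  (exists B : R, forall x, U x -> `|f x| <= B) /\
  match k with
  | 0 => forall x, U x -> {for x, continuous f}
  | k'.+1 => (forall x, U x -> differentiable f x) /\
             (forall v, Ck_bounded k' U (fun x => 'D_v f x))
  end.

(* On a set S that need not be open (a closed ball of actions). *)
Definition Ck_near {R : realType} {V W : normedModType R} (k : nat)
    (S : set V) (f : V -> W) : Prop :=
  exists O : set V, [/\ open O, S `<=` O & Ck k O f].

(* Image of the derivative of f at a. *)
Definition tangent {R : realType} {V W : normedModType R} (f : V -> W)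
    (a : V) : set W := [set 'D_v f a | v in setT].

Definition is_subspace {R : realType} {V : normedModType R} (E : set V) : Prop :=
  E 0 /\ forall (a : R) u v, E u -> E v -> E (a *: u + v).

Definition spans2 {R : realType} {V : normedModType R} (E F : set V) : Prop :=
  forall v, exists a b, [/\ E a, F b & v = a + b].

Definition direct_sum3 {R : realType} {V : normedModType R}
    (E F G : set V) : Prop :=
  (forall v, exists a b c, [/\ E a, F b, G c & v = a + b + c]) /\
  (forall a b c, E a -> F b -> G c -> a + b + c = 0 ->
     [/\ a = 0, b = 0 & c = 0]).

(* ---------- Phase space ---------- *)

(* Points of T^m, T = R/Z, are given by lifts in R^m: a subset, function or
   vector field on M is one on the covering space R^n x R^n x R^d x R^d that is
   compatible with [meq] (resp. [teq]), equality in M (resp. in M x R). *)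
Definition phase (R : realType) (n d : nat) : normedModType R :=
  ('rV[R]_n * 'rV[R]_n * 'rV[R]_d * 'rV[R]_d)%type.

Definition ephase (R : realType) (n d : nat) : normedModType R :=
  (phase R n d * R)%type.

(* The coordinates (I, theta, t) of R^d x R^d x R, the cover of R^d x T^d x R. *)
Definition base (R : realType) (d : nat) : normedModType R :=
  ('rV[R]_d * 'rV[R]_d * R)%type.

Definition mom {R : realType} {n d} (z : phase R n d) : 'rV[R]_n := z.1.1.1.
Definition pos {R : realType} {n d} (z : phase R n d) : 'rV[R]_n := z.1.1.2.
Definition act {R : realType} {n d} (z : phase R n d) : 'rV[R]_d := z.1.2.
Definition ang {R : realType} {n d} (z : phase R n d) : 'rV[R]_d := z.2.

Definition lattice {R : realType} {m : nat} (v : 'rV[R]_m) : Prop :=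
  forall j, v 0 j \is a Num.int.

Definition meq {R : realType} {n d} (z w : phase R n d) : Prop :=
  [/\ mom z = mom w, lattice (pos z - pos w), act z = act w
    & lattice (ang z - ang w)].

Definition teq {R : realType} {n d} (z w : ephase R n d) : Prop :=
  meq z.1 w.1 /\ z.2 = w.2.

Definition beq {R : realType} {d} (x y : base R d) : Prop :=
  [/\ x.1.1 = y.1.1, lattice (x.1.2 - y.1.2) & x.2 = y.2].

(* The representative of x mod 1 in [-1/2, 1/2). *)
Definition centered {R : realType} (x : R) : R :=
  x - (Num.floor (x + 2^-1))%:~R.

(* The difference of two points of T^m, as its representative close to 0. *)
Definition tdiff {R : realType} {m} (x y : 'rV[R]_m) : 'rV[R]_m :=
  \row_j centered (x 0 j - y 0 j).

(* The (sup) distance of M x R = R^n x T^n x R^d x T^d x R. *)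
Definition tdist {R : realType} {n d} (z w : ephase R n d) : R :=
  `| ((mom z.1 - mom w.1, tdiff (pos z.1) (pos w.1), act z.1 - act w.1,
       tdiff (ang z.1) (ang w.1), z.2 - w.2) : ephase R n d) |.

(* ---------- Vector fields and brackets ---------- *)

Definition e_mom {R : realType} {n d} (i : 'I_n) : phase R n d :=
  (delta_mx 0 i, 0, 0, 0).
Definition e_pos {R : realType} {n d} (i : 'I_n) : phase R n d :=
  (0, delta_mx 0 i, 0, 0).
Definition e_act {R : realType} {n d} (j : 'I_d) : phase R n d :=
  (0, 0, delta_mx 0 j, 0).
Definition e_ang {R : realType} {n d} (j : 'I_d) : phase R n d :=
  (0, 0, 0, delta_mx 0 j).

(* J grad H *)
Definition ham_field {R : realType} {n d} (H : phase R n d -> R)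
    (z : phase R n d) : phase R n d :=
  (\row_i (- 'D_(e_pos i) H z), \row_i 'D_(e_mom i) H z,
   \row_j (- 'D_(e_ang j) H z), \row_j 'D_(e_act j) H z).

(* X f = sum_j X_j d_{z_j} f, for vector-valued f *)
Definition vf_act {R : realType} {n d} {W : normedModType R}
    (X : phase R n d -> phase R n d) (f : phase R n d -> W)
    (z : phase R n d) : W :=
  \sum_(i < n) (mom (X z) 0 i *: 'D_(e_mom i) f z +
                pos (X z) 0 i *: 'D_(e_pos i) f z) +
  \sum_(j < d) (act (X z) 0 j *: 'D_(e_act j) f z +
                ang (X z) 0 j *: 'D_(e_ang j) f z).

(* [f, g], componentwise in f, with the sign for which [theta, H] = dH/dI and
   [I, H] = - dH/dtheta *)
Definition pbracket {R : realType} {n d} {W : normedModType R}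
    (f : phase R n d -> W) (g : phase R n d -> R) (z : phase R n d) : W :=
  \sum_(i < n) ('D_(e_mom i) g z *: 'D_(e_pos i) f z -
                'D_(e_pos i) g z *: 'D_(e_mom i) f z) +
  \sum_(j < d) ('D_(e_act j) g z *: 'D_(e_ang j) f z -
                'D_(e_ang j) g z *: 'D_(e_act j) f z).

Definition hessian {R : realType} {d} (h : 'rV[R]_d -> R) (I : 'rV[R]_d) :
    'M[R]_d :=
  \matrix_(i < d, j < d) 'D_(delta_mx 0 i) (fun J => 'D_(delta_mx 0 j) h J) I.

(* ---------- The system ---------- *)

Definition pendulum_potential {R : realType} (V : R -> R) : Prop :=
  [/\ forall x, V (x + 1) = V x, derive1 V 0 = 0, derive1n 2 V 0 < 0
    & forall x, derive1 V x = 0 -> V x = V 0 -> x \is a Num.int].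

(* The sign of the i-th pendulum is - iff sg i. *)
Definition rotator_pendulum {R : realType} {n d} (h0 : 'rV[R]_d -> R)
    (sg : 'I_n -> bool) (V : 'I_n -> R -> R) (z : phase R n d) : R :=
  h0 (act z) +
  \sum_(i < n) (-1) ^+ sg i * (2^-1 * mom z 0 i ^+ 2 + V i (pos z 0 i)).

Definition slab {R : realType} (V : normedModType R) (eps0 : R) :
    set (V * R)%type :=
  [set x | `|x.2| < eps0].

Definition perturbation {R : realType} {n d} (r : nat) (eps0 : R)
    (X1 : phase R n d -> R -> R -> phase R n d) : Prop :=
  (forall z w t eps, meq z w -> X1 z t eps = X1 w t eps) /\
  Ck_bounded r (@slab R (ephase R n d) eps0)
    (fun x : (ephase R n d * R)%type => X1 x.1.1 x.1.2 x.2).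

Definition ham_perturbation {R : realType} {n d} (r : nat) (eps0 : R)
    (X1 : phase R n d -> R -> R -> phase R n d)
    (H1 : phase R n d -> R -> R -> R) : Prop :=
  [/\ forall z w t eps, meq z w -> H1 z t eps = H1 w t eps,
      Ck r.+1 (@slab R (ephase R n d) eps0)
        (fun x : (ephase R n d * R)%type => H1 x.1.1 x.1.2 x.2)
    & forall z t eps, `|eps| < eps0 ->
        X1 z t eps = ham_field (fun w => H1 w t eps) z].

(* zdot = X0 z + eps X1 (z, t; eps), tdot = 1 *)
Definition ext_field {R : realType} {n d} (X0 : phase R n d -> phase R n d)
    (X1 : phase R n d -> R -> R -> phase R n d) (eps : R)
    (w : ephase R n d) : ephase R n d :=
  (X0 w.1 + eps *: X1 w.1 w.2 eps, 1).

Definition is_flow {R : realType} {V : normedModType R} (X : V -> V)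
    (Phi : R -> V -> V) : Prop :=
  forall w, Phi 0 w = w /\
    forall s, is_derive s (1 : R) (fun s' => Phi s' w) (X (Phi s w)).

(* The closed Euclidean ball (the library norm on row vectors is the sup norm). *)
Definition eball {R : realType} {d} (c : 'rV[R]_d) (rad : R) : set 'rV[R]_d :=
  [set I | \sum_(j < d) (I 0 j - c 0 j) ^+ 2 <= rad ^+ 2].

(* The "suitably extended system": Y is a vector field on M x R which coincides
   with the given one, F, over a neighbourhood of the ball D of actions. It may
   differ from F for I far from D, so that orbits leaving the part of the
   normally hyperbolic manifold over D stay under control for all times.
   Y = F is allowed. *)
Definition extended_system {R : realType} {n d} (eps0 : R) (D : set 'rV[R]_d)
    (F Y : R -> ephase R n d -> ephase R n d) : Prop :=
  [/\ forall eps w w', teq w w' -> Y eps w = Y eps w',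
      forall eps w, (Y eps w).2 = 1,
      Ck 1 (@slab R (ephase R n d) eps0)
        (fun x : (ephase R n d * R)%type => Y x.2 x.1)
    & exists O : set 'rV[R]_d, [/\ open O, D `<=` O
        & forall eps w, `|eps| < eps0 -> O (act w.1) -> Y eps w = F eps w]].

(* ---------- Normally hyperbolic invariant manifolds ---------- *)

Definition over {R : realType} {d} (B : set 'rV[R]_d) : set (base R d) :=
  [set x | B x.1.1].

(* The subset of M x R parametrized by k over B. *)
Definition manifold {R : realType} {n d} (k : base R d -> ephase R n d)
    (B : set 'rV[R]_d) : set (ephase R n d) :=
  [set w | exists2 x, over B x & teq w (k x)].

(* The image of k over B is invariant under Psi and normally hyperbolic:
   an invariant splitting T(M x R) = TLambda + E^s + E^u with rates
   lam < 0 < mu and lamc < min (- lam) mu. *)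
Definition is_nhim {R : realType} {n d} (B : set 'rV[R]_d)
    (lam mu lamc C : R) (Psi : R -> ephase R n d -> ephase R n d)
    (k : base R d -> ephase R n d) : Prop :=
  (forall s w, manifold k B w -> manifold k B (Psi s w)) /\
  exists Es Eu : base R d -> set (ephase R n d),
  [/\ forall x, over B x -> is_subspace (Es x) /\ is_subspace (Eu x),
      forall x, over B x -> direct_sum3 (tangent k x) (Es x) (Eu x)
    & forall s x y, over B x -> over B y -> teq (Psi s (k x)) (k y) ->
      let DPsi v := 'D_v (Psi s) (k x) in
      [/\ forall v, Es x v -> Es y (DPsi v),
          forall v, Eu x v -> Eu y (DPsi v),
          forall v, Es x v -> 0 <= s ->
            `|DPsi v| <= C * expR (s * lam) * `|v|,
          forall v, Eu x v -> s <= 0 ->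
            `|DPsi v| <= C * expR (s * mu) * `|v|
        & forall v, tangent k x v ->
            tangent k y (DPsi v) /\
            `|DPsi v| <= C * expR (`|s| * lamc) * `|v| ]].

(* Smooth family k eps of embeddings of (part of) R^d x T^d x R into M x R, for
   |eps| < eps0, whose images over B are normally hyperbolic invariant manifolds
   of the extended system; over D, k 0 parametrizes
   {p = q = 0, I in D} x R, and k eps is O(eps)-close to it.
   The manifold of interest is [manifold (k eps) D]. *)
Definition nhim_family {R : realType} {n d} (eps0 : R) (D B : set 'rV[R]_d)
    (lam mu : R) (Psi : R -> R -> ephase R n d -> ephase R n d)
    (k : R -> base R d -> ephase R n d) : Prop :=
  [/\ open B /\ D `<=` B,
      Ck 1 [set e : (R * base R d)%type | `|e.1| < eps0 /\ over B e.2]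
        (fun e : (R * base R d)%type => k e.1 e.2),
      (forall eps x y, `|eps| < eps0 -> over B x -> over B y ->
         (teq (k eps x) (k eps y) <-> beq x y)) /\
      (forall eps x v, `|eps| < eps0 -> over B x ->
         'D_v (k eps) x = 0 -> v = 0),
      (forall x, over D x -> k 0 x = (0, 0, x.1.1, x.1.2, x.2)) /\
      (exists C : R, forall eps x, `|eps| < eps0 -> over D x ->
         `|k eps x - k 0 x| <= C * `|eps|)
    & exists lamc C : R, [/\ 0 <= lamc, lamc < - lam, lamc < mu
      & forall eps, `|eps| < eps0 -> is_nhim B lam mu lamc C (Psi eps) (k eps)]].

(* W^s(z) and W^u(z) *)
Definition stable_fiber {R : realType} {n d} (lam : R)
    (Psi : R -> ephase R n d -> ephase R n d) (z : ephase R n d) :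
    set (ephase R n d) :=
  [set w | exists C : R, forall s, 0 <= s ->
     tdist (Psi s w) (Psi s z) <= C * expR (s * lam)].

Definition unstable_fiber {R : realType} {n d} (mu : R)
    (Psi : R -> ephase R n d -> ephase R n d) (z : ephase R n d) :
    set (ephase R n d) :=
  [set w | exists C : R, forall s, s <= 0 ->
     tdist (Psi s w) (Psi s z) <= C * expR (s * mu)].

(* W(Lambda), the union of the fibers W(z), z in Lambda *)
Definition fibered {R : realType} {n d} (Lam : set (ephase R n d))
    (W : ephase R n d -> set (ephase R n d)) : set (ephase R n d) :=
  [set w | exists2 z, Lam z & W z w].

(* The fibers W eps (k eps x), |eps| < eps0 and x over D, are injectively
   immersed copies of R^n depending smoothly on (eps, x), and their union over x
   is injectively immersed. *)
Definition fibers_smooth {R : realType} {n d} (eps0 : R) (D : set 'rV[R]_d)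
    (k : R -> base R d -> ephase R n d)
    (W : R -> ephase R n d -> set (ephase R n d))
    (K : R -> base R d -> 'rV[R]_n -> ephase R n d) : Prop :=
  [/\ Ck_near 1
        [set e : (R * base R d * 'rV[R]_n)%type |
           `|e.1.1| < eps0 /\ over D e.1.2]
        (fun e : (R * base R d * 'rV[R]_n)%type => K e.1.1 e.1.2 e.2),
      forall eps x w, `|eps| < eps0 -> over D x ->
        (W eps (k eps x) w <-> exists xi, teq w (K eps x xi)),
      forall eps x xi xi', `|eps| < eps0 -> over D x ->
        teq (K eps x xi) (K eps x xi') -> xi = xi'
    & forall eps x xi v, `|eps| < eps0 -> over D x ->
        'D_v (fun e : (base R d * 'rV[R]_n)%type => K eps e.1 e.2) (x, xi) = 0 ->
        v = 0].

(* Omega : W(Lambda) -> Lambda, the projection along the fibers W. *)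
Definition footpoint_map {R : realType} {n d} (Lam : set (ephase R n d))
    (W : ephase R n d -> set (ephase R n d))
    (Om : ephase R n d -> ephase R n d) : Prop :=
  forall w, fibered Lam W w ->
    [/\ Lam (Om w), W (Om w) w & forall z, Lam z -> W z w -> teq z (Om w)].

(* ---------- Homoclinic channels and the scattering map ---------- *)

Definition channel_set {R : realType} {n d} (U : set (base R d))
    (G : base R d -> ephase R n d) : set (ephase R n d) :=
  [set w | exists2 y, U y & teq w (G y)].

(* Om restricted to the manifold G(U) is a diffeomorphism onto an open subset of
   the manifold k(over D); psi is the expression of Om in the parameters. *)
Definition channel_diffeo {R : realType} {n d} (D : set 'rV[R]_d)
    (k : base R d -> ephase R n d) (U : set (base R d))
    (G : base R d -> ephase R n d) (Om : ephase R n d -> ephase R n d) : Prop :=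
  (forall y y', U y -> U y' -> teq (Om (G y)) (Om (G y')) ->
     teq (G y) (G y')) /\
  exists psi : base R d -> base R d,
  [/\ Ck 1 U psi,
      forall y, U y -> over D (psi y) /\ teq (Om (G y)) (k (psi y)),
      open (psi @` U)
    & forall y v, U y -> 'D_v psi y = 0 -> v = 0].

(* G, defined on the open set U of R^d x R^d x R, parametrizes a homoclinic
   channel for one value of eps; Ks and Ku parametrize the fibers of the stable
   and unstable manifolds Ws, Wu. *)
Definition homoclinic_channel {R : realType} {n d} (D : set 'rV[R]_d)
    (k : base R d -> ephase R n d) (Ws Wu : set (ephase R n d))
    (Ks Ku : base R d -> 'rV[R]_n -> ephase R n d)
    (Op Om : ephase R n d -> ephase R n d)
    (U : set (base R d)) (G : base R d -> ephase R n d) : Prop :=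
  [/\ channel_set U G `<=` Ws `&` Wu,
      forall y xs xis xu xiu, U y -> over D xs -> over D xu ->
        teq (Ks xs xis) (G y) -> teq (Ku xu xiu) (G y) ->
        spans2
          (tangent (fun e : (base R d * 'rV[R]_n)%type => Ks e.1 e.2) (xs, xis))
          (tangent (fun e : (base R d * 'rV[R]_n)%type => Ku e.1 e.2) (xu, xiu))
        /\ direct_sum3 (tangent G y) (tangent (Ku xu) xiu) (tangent (Ks xs) xis),
      channel_diffeo D k U G Op
    & channel_diffeo D k U G Om].

(* Omega^+ o (Omega^- restricted to Gamma)^-1 *)
Definition scattering_map {R : realType} {n d} (Gam : set (ephase R n d))
    (Op Om : ephase R n d -> ephase R n d) (w : ephase R n d) : ephase R n d :=
  Op (xget w [set z | Gam z /\ teq (Om z) w]).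

(* ---------- The formula ---------- *)

Definition vintegrable {R : realType} {d} (f : R -> 'rV[R]_d) : Prop :=
  forall j, (@lebesgue_measure R).-integrable setT (fun s => (f s 0 j)%:E).

Definition vintegral {R : realType} {d} (f : R -> 'rV[R]_d) : 'rV[R]_d :=
  \row_j Rintegral (@lebesgue_measure R) setT (fun s => f s 0 j).

(* theta(zp eps) - theta(zm eps) =
     - eps int (A(Phi0 s zpm) - A(Phi0 s z0)) ds
     + eps (int (B(Phi0 s zpm) - B(Phi0 s z0)) s ds) . hess + O(eps^(1 + rho)),
   the integrals being absolutely convergent. *)
Definition angle_formula {R : realType} {n d} (rho : R)
    (Phi0 : R -> ephase R n d -> ephase R n d)
    (A B : ephase R n d -> 'rV[R]_d) (hess : 'M[R]_d)
    (zp zm : R -> ephase R n d) (zpm z0 : ephase R n d) : Prop :=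
  let a s := A (Phi0 s zpm) - A (Phi0 s z0) in
  let b s := s *: (B (Phi0 s zpm) - B (Phi0 s z0)) in
  [/\ vintegrable a, vintegrable b
    & exists C delta : R, 0 < delta /\
      forall eps, 0 < `|eps| < delta ->
        `| tdiff (ang (zp eps).1) (ang (zm eps).1)
           - (- eps *: vintegral a + eps *: (vintegral b *m hess)) |
        <= C * `|eps| `^ (1 + rho)].

(* Main.v *)
From mathcomp Require Import ring lra measurable_realfun.
Require Import Defs.

Set Implicit Arguments.
Unset Strict Implicit.
Unset Printing Implicit Defensive.

(** Fix one time direction and compare the orbits of the homoclinic point [z] and
   of its foot point [z'].  Their distance is [O(exp (-nu s))], so for the horizon
   [T] of order [log (1/eps)] it is [O(eps^2)] at [T].  The function
   [theta(z') - theta(z) - s (I(z') - I(z)) . h0''(I0)] has derivative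
   [eps (X1 theta - s (X1 I) . h0'')], differenced between the two orbits, up to
   [O(eps^2 T^2)] from the expansion of the frequency at [I0]; integrating it over
   [0, T] thus yields one half of the formula at once, with no double integral.
   Replacing the perturbed orbits by the unperturbed ones costs
   [eps exp (L s)] by Gronwall, while every difference is also
   [O(exp (-nu s))]: interpolating the two bounds gives [O(eps^rho)] uniformly in
   [s].  Closeness of the foot points to the unperturbed one is not assumed; it
   follows from the same exponential estimate, run backwards from time [T]. *)

(** * Calculus on curves *)

(** The obstacle is that each end of [0, T] carries only half of the data. At time T the orbits of
    [z] and [z'] agree up to O(eps^2), while at time 0 only [z] is known to be close to its
    unperturbed position. Actions and angles of [z'] move slowly relative to those of [z], so they
    can be carried back from T to 0 at the cost of powers of T. The hyperbolic variables p, q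
    cannot; at time 0 they are controlled instead by the O(eps)-closeness of the invariant manifold
    to p = q = 0. The weight s in the action term is the length of time during which an action
    difference removed at time s has acted on the angle. The backward half-line is the same argument
    with a sign [sigma = -1]. The angle of [z] enters both halves and cancels in their difference.
    With decay rate nu and Gronwall rate L, interpolation yields the exponent th = nu / (L + nu);
    the powers of T consume half of it, so rho = th / 2. Torus coordinates are lifts, so each
    comparison carries a lattice vector. It is discarded only at the very end, when the angle
    difference is below 1/2. *)

Lemma real_induction (R : realType) (P : R -> Prop) (S : R) :
  P 0 ->
  (forall s, 0 <= s < S -> P s ->
     exists2 e, 0 < e & forall u, s < u < s + e -> P u) ->
  (forall s, 0 < s <= S -> (forall u, 0 <= u < s -> P u) -> P s) ->
  forall s, 0 <= s <= S -> P s.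
Proof.
move=> P0 Pstep Plim s /andP[s0 sS].
(* Membership requires P on the whole segment [0, a], so P holds at every point below the supremum
   of [A]. *)
pose A := [set a : R | 0 <= a <= S /\ forall u, 0 <= u <= a -> P u].
have A0 : A 0.
  split; first by rewrite lexx (le_trans s0).
  by move=> u u0; have -> : u = 0 by apply/eqP; rewrite eq_le andbC.
have hA : has_sup A.
  by split; [exists 0 | exists S => a [/andP[]]].
pose m := sup A.
have m0 : 0 <= m by exact: (sup_upper_bound hA).
have mS : m <= S by apply: ge_sup; [exists 0 | move=> a [/andP[]]].
have Plt u : 0 <= u < m -> P u.
  move=> /andP[u0 um].
  have [a [_ Pa] ua] := sup_adherent (eps := m - u) (ltac:(lra)) hA.
  by apply: Pa; rewrite u0 /=; move: ua; rewrite -/m; lra.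
have Pm : P m.
  move: m0; rewrite le_eqVlt => /orP[/eqP<- //|m0].
  by apply: Plim => //; rewrite m0.
have Ple u : 0 <= u <= m -> P u.
  move=> /andP[u0]; rewrite le_eqVlt => /orP[/eqP-> //|um].
  by apply: Plt; rewrite u0.
have [Sm|mS'] := leP S m; first by apply: Ple; rewrite s0 (le_trans sS).
have [e e0 Pe] := Pstep m (ltac:(by rewrite m0)) Pm.
pose a := Num.min S (m + e / 2).
have ma : m < a by rewrite lt_min mS'; lra.
have aA : A a.
  split; first by rewrite (le_trans m0 (ltW ma)) ge_min lexx.
  move=> u /andP[u0 ua]; have [um|mu] := leP u m; first by apply: Ple; rewrite u0.
  apply: Pe; rewrite mu /=; move: ua; rewrite le_min => /andP[_]; lra.
by have := sup_upper_bound hA aA; rewrite -/m leNgt ma.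
Qed.


(** A filter-free form of differentiability that includes h = 0. With its converse
    [approx_is_derive] it reduces derivative rules on curves to plain estimates. *)
Lemma is_derive_approx (R : realType) (W : normedModType R) (f : R -> W) s df :
  is_derive s (1 : R) f df ->
  forall eta, 0 < eta -> exists2 e, 0 < e &
    forall h, `|h| < e -> `|f (s + h) - f s - h *: df| <= eta * `|h|.
Proof.
move=> [Hd Hv] eta eta0.
have : h^-1 *: ((f \o shift s) (h *: (1 : R)) - f s) @[h --> 0^'] --> df.
  by rewrite -Hv; exact: Hd.
move=> /cvgrPdist_le /(_ eta eta0).
rewrite near_withinE => -[e /= e0 He].
exists e => // h he; have [->|h0] := eqVneq h 0.
  by rewrite addr0 subrr scale0r subr0 !normr0 mulr0.
have := He h (ltac:(by rewrite /ball /= sub0r normrN)) h0.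
rewrite /= -[h *: 1]/(h * 1) mulr1 (addrC h) => K.
have -> : f (s + h) - f s - h *: df = - (h *: (df - h^-1 *: (f (s + h) - f s))).
  by rewrite scalerBr scalerA divff// scale1r opprB.
by rewrite normrN normrZ mulrC ler_wpM2r.
Qed.

Lemma is_derive_continuous (R : realType) (W : normedModType R) (f : R -> W) s df :
  is_derive s (1 : R) f df ->
  forall eta, 0 < eta -> exists2 e, 0 < e &
    forall h, `|h| < e -> `|f (s + h) - f s| <= eta.
Proof.
move=> /is_derive_approx /(_ 1 ltr01)[e e0 He] eta eta0.
have d0 : 0 < 1 + `|df| by rewrite ltr_pwDl.
exists (Num.min e (eta / (1 + `|df|))); first by rewrite lt_min e0 divr_gt0.
move=> h; rewrite lt_min => /andP[/He {}He]; rewrite ltr_pdivlMr// => hl.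
rewrite -(subrK (h *: df) (_ - _)); apply: le_trans (ler_normD _ _) _.
rewrite normrZ; apply: le_trans (ltW hl); rewrite mulrDr mulr1 lerD2r.
by rewrite mul1r in He.
Qed.

(* Real induction: at the first time when [`|f| <= u] could fail, the derivative
   of [u] strictly dominates that of [f]. *)
Lemma barrier (R : realType) (W : normedModType R) (S : R) (f df : R -> W)
    (u du : R -> R) :
  (forall s, 0 <= s <= S -> is_derive s (1 : R) f (df s)) ->
  (forall s, 0 <= s <= S -> is_derive s (1 : R) u (du s)) ->
  `|f 0| <= u 0 ->
  (forall s, 0 <= s < S -> `|f s| <= u s -> `|df s| < du s) ->
  forall s, 0 <= s <= S -> `|f s| <= u s.
Proof.
move=> Hf Hu f0 Hlt; apply: real_induction => // s.
  move=> /andP[s0 sS] fs.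
  have sI : 0 <= s <= S by rewrite s0 ltW.
  have lt1 : `|df s| < du s by apply: Hlt; rewrite ?s0.
  (* Half of the gap between the two slopes is granted to the linearization error of [f], the other
     half to that of [u]. *)
  pose eta := (du s - `|df s|) / 2.
  have eta0 : 0 < eta by rewrite /eta; lra.
  have [e1 e10 H1] := is_derive_approx (Hf s sI) eta0.
  have [e2 e20 H2] := is_derive_approx (Hu s sI) eta0.
  exists (Num.min e1 e2); first by rewrite lt_min e10.
  move=> v /andP[sv]; rewrite -ltrBlDl lt_min => /andP[v1 v2].
  have vs : `|v - s| = v - s by rewrite gtr0_norm ?subr_gt0.
  move: (H1 (v - s)) (H2 (v - s)); rewrite vs => /(_ v1) {}H1 /(_ v2).
  rewrite subrKC in H1 *; rewrite ler_norml -[_ *: du s]/(_ * _) => /andP[{}H2 _].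
  have : `|f v| <= `|f v - f s - (v - s) *: df s| + `|f s| + (v - s) * `|df s|.
    have -> : (v - s) * `|df s| = `|(v - s) *: df s| by rewrite normrZ vs.
    rewrite -addrA; apply: le_trans (lerD (lexx _) (ler_normD _ _)).
    by apply: le_trans (ler_normD _ _); rewrite -(addrA (f v)) -opprD subrK.
  move: H1 H2; rewrite /eta; set a := `|f v|; set b := `|_|; nra.
move=> /andP[s0 sS] Hs; rewrite leNgt; apply/negP => us.
have sI : 0 <= s <= S by rewrite ltW.
(* Stepping back by h changes [f] and [u] by at most one third of the excess each; the remaining
   third contradicts the bound at [s - h]. *)
pose eta := (`|f s| - u s) / 3.
have eta0 : 0 < eta by rewrite /eta; lra.
have [e1 e10 H1] := is_derive_continuous (Hf s sI) eta0.
have [e2 e20 H2] := is_derive_continuous (Hu s sI) eta0.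
pose h := Num.min s (Num.min e1 e2) / 2.
have m0 : 0 < Num.min s (Num.min e1 e2) by rewrite !lt_min s0 e10 e20.
have [h0 hs h1 h2] : [/\ 0 < h, h <= s, h < e1 & h < e2].
  have : h < Num.min s (Num.min e1 e2) by rewrite /h; lra.
  by rewrite !lt_min => /and3P[/ltW ? ? ?]; split => //; rewrite /h; lra.
have hN : `|- h| = h by rewrite normrN gtr0_norm.
move: (H1 (- h)) (H2 (- h)) (Hs (s - h)); rewrite hN => /(_ h1) {}H1 /(_ h2).
rewrite ler_norml => /andP[_ {}H2] /(_ (ltac:(lra))) H3.
have : `|f s| <= `|f (s - h)| + `|f (s - h) - f s|.
  by rewrite -(normrN (_ - _)) opprB -{1}(subrK (f (s - h)) (f s)) addrC ler_normD.
move: H1 H2 H3; rewrite /eta; lra.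
Qed.

Lemma mean_value_norm (R : realType) (W : normedModType R) (S M : R)
    (f df : R -> W) : 0 <= S ->
  (forall s, 0 <= s <= S -> is_derive s (1 : R) f (df s)) ->
  (forall s, 0 <= s <= S -> `|df s| <= M) ->
  `|f S - f 0| <= M * S.
Proof.
move=> S0 Hf HM; apply/ler_addgt0Pr => eta eta0.
(* [barrier] needs strict domination, so the slope is raised slightly; over [0, S] this costs at
   most [eta], also when S = 0. *)
pose m := M + eta / (S + 1).
have mM : M < m by rewrite /m ltrDl divr_gt0// ltr_wpDl.
apply: (@le_trans _ _ (m * S)); last first.
  rewrite /m mulrDl lerD2l mulrAC ler_pdivrMr ?ltr_wpDl// ler_wpM2l ?(ltW eta0)//.
  by rewrite lerDl.
apply: (@barrier _ _ S (fun s => f s - f 0) df (fun s => m * s) (fun=> m)).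
- move=> s sS; have Hs := Hf s sS.
  rewrite -[X in is_derive _ _ X _]/(f - cst (f 0)) -[df s]subr0.
  by apply: is_deriveB; exact: is_derive_cst.
- move=> s sS; rewrite -[X in is_derive _ _ _ X]mulr1.
  exact: (@is_deriveZ _ _ _ id).
- by rewrite subrr normr0 mulr0.
- move=> s /andP[s0 sS] _; apply: le_lt_trans mM; apply: HM.
  by rewrite s0 ltW.
- by rewrite S0 lexx.
Qed.

Lemma is_derive_expMl (R : realType) (A L s : R) :
  is_derive s (1 : R) (fun x => A * expR (x * L)) (L * (A * expR (s * L))).
Proof.
have H : is_derive s (1 : R) (fun x : R => x * L) L.
  rewrite -[X in is_derive _ _ _ X]mulr1.
  have -> : (fun x : R => x * L) = L \*: id by apply/funext => x /=; rewrite mulrC.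
  exact: (@is_deriveZ _ _ _ id).
have -> : L * (A * expR (s * L)) = A *: (L * expR (s * L)) by rewrite mulrCA.
apply: (@is_deriveZ _ _ _ (expR \o (fun x : R => x * L))).
by rewrite mulrC; apply: is_derive1_comp.
Qed.

(** The rate is [L + 1] rather than [L]: since [eta < A], the additional unit absorbs the forcing
    term and makes the domination strict, as [barrier] requires. *)
Lemma gronwall (R : realType) (W : normedModType R) (S A L eta : R)
    (f df : R -> W) :
  0 <= L -> 0 <= eta < A ->
  (forall s, 0 <= s <= S -> is_derive s (1 : R) f (df s)) ->
  `|f 0| <= A ->
  (forall s, 0 <= s < S -> `|f s| <= A * expR (s * (L + 1)) ->
     `|df s| <= L * `|f s| + eta) ->
  forall s, 0 <= s <= S -> `|f s| <= A * expR (s * (L + 1)).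
Proof.
move=> L0 /andP[eta0 etaA] Hf f0 Hdf.
apply: (@barrier _ _ S f df (fun s => A * expR (s * (L + 1)))
  (fun s => (L + 1) * (A * expR (s * (L + 1)))) Hf).
- move=> s _; exact: is_derive_expMl.
- by rewrite mul0r expR0 mulr1.
- move=> s sS fs; apply: le_lt_trans (Hdf s sS fs) _.
  have e1 : 1 <= expR (s * (L + 1)).
    rewrite -[X in X <= _]expR0 ler_expR mulr_ge0//; last by rewrite addr_ge0.
    by case/andP: sS.
  have : L * `|f s| <= L * (A * expR (s * (L + 1))) by rewrite ler_wpM2l.
  have : A <= A * expR (s * (L + 1)) by rewrite ler_peMr// ltW// (le_lt_trans eta0).
  lra.
Qed.

(* [l] is only needed to be linear and bounded; no structure is inferred for it. *)
Lemma is_derive_linear (R : realType) (V W : normedModType R) (l : V -> W)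
    (C : R) (f : R -> V) df s :
  (forall (a : R) u v, l (a *: u + v) = a *: l u + l v) ->
  (forall v, `|l v| <= C * `|v|) ->
  is_derive s (1 : R) f df -> is_derive s (1 : R) (fun x => l (f x)) (l df).
Proof.
move=> lin bnd Hf.
have l0 : l 0 = 0 by have := lin (-1) 0 0; rewrite scaler0 addr0 scaleN1r addNr.
have lZ (a : R) u : l (a *: u) = a *: l u by rewrite -[X in l X]addr0 lin l0 addr0.
have lB u v : l (u - v) = l u - l v by rewrite addrC -scaleN1r lin scaleN1r addrC.
have H : h^-1 *: (((fun x => l (f x)) \o shift s) (h *: (1 : R)) - l (f s))
    @[h --> 0^'] --> l df.
  apply/cvgrPdist_le => eta eta0.
  case: Hf => Hd Hv.
  have : h^-1 *: ((f \o shift s) (h *: (1 : R)) - f s) @[h --> 0^'] --> df.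
    by rewrite -Hv; exact: Hd.
  have C0 : 0 < `|C| + 1 by rewrite ltr_wpDl.
  move=> /cvgrPdist_le /(_ (eta / (`|C| + 1)) (divr_gt0 eta0 C0)).
  apply: filterS => h /=; rewrite ler_pdivlMr// => Hh.
  rewrite -lB -lZ -lB; apply: le_trans (bnd _) _; apply: le_trans Hh.
  by rewrite mulrC ler_wpM2l// (le_trans (ler_norm _))// lerDl.
split; first by apply/cvg_ex; exists (l df).
exact/cvg_lim.
Qed.

(** * Lipschitz estimates *)

Lemma row_norm_le (R : realType) n (v : 'rV[R]_n) M :
  0 <= M -> (forall j, `|v 0 j| <= M) -> `|v| <= M.
Proof.
move=> M0 H; rewrite [leLHS]mx_normrE; apply: bigmax_le => //= -[i j] _ /=.
by rewrite ord1.
Qed.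

Lemma row_norm_ge (R : realType) n (v : 'rV[R]_n) j : `|v 0 j| <= `|v|.
Proof.
rewrite [leRHS]mx_normrE.
exact: (le_bigmax _ (fun ij : 'I_1 * 'I_n => `|v ij.1 ij.2|) (0, j)).
Qed.

Lemma pair_norm (R : realType) (V W : normedModType R) (a : V) (b : W) :
  `|((a, b) : V * W)| = Num.max `|a| `|b|.
Proof. by []. Qed.

Lemma pair_norm_le (R : realType) (V W : normedModType R) (x : V * W) M :
  `|x.1| <= M -> `|x.2| <= M -> `|x| <= M.
Proof. by case: x => a b /= Ha Hb; rewrite pair_norm ge_max Ha. Qed.

Lemma fst_norm (R : realType) (V W : normedModType R) (x : V * W) : `|x.1| <= `|x|.
Proof. by case: x => a b; rewrite pair_norm le_max lexx. Qed.

Lemma snd_norm (R : realType) (V W : normedModType R) (x : V * W) : `|x.2| <= `|x|.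
Proof. by case: x => a b; rewrite pair_norm le_max lexx orbT. Qed.

(** [Ck] and [Ck_bounded] control derivatives one direction at a time. A finite family of
    directions, with coordinates bounded by the norm, turns such bounds into one Lipschitz
    constant. *)
Definition coordinates (R : realType) (V : normedModType R) (J : finType)
    (e : J -> V) (c : J -> V -> R) : Prop :=
  forall v, v = \sum_j c j v *: e j /\ forall j, `|c j v| <= `|v|.

Definition coordinatized (R : realType) (V : normedModType R) : Prop :=
  exists (J : finType) (e : J -> V) (c : J -> V -> R), coordinates e c.

Lemma coordinatized_scalar (R : realType) : coordinatized (R : normedModType R).
Proof.
exists unit, (fun=> 1), (fun=> id) => v; split => // .
rewrite (big_pred1 tt) => [|[]//].
by rewrite -[v *: _]/(v * _) mulr1.
Qed.

Lemma coordinatized_row (R : realType) n : coordinatized ('rV[R]_n : normedModType R).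
Proof.
exists 'I_n, (fun j => delta_mx 0 j), (fun j (v : 'rV[R]_n) => v 0 j) => v; split.
  exact: row_sum_delta.
by move=> j; exact: row_norm_ge.
Qed.

Lemma coordinatized_pair (R : realType) (V W : normedModType R) :
  coordinatized V -> coordinatized W -> coordinatized (V * W)%type.
Proof.
move=> [J [e [c H]]] [J' [e' [c' H']]].
exists (J + J')%type, (fun j => match j with inl i => (e i, 0) | inr i => (0, e' i) end).
exists (fun j v => match j with inl i => c i v.1 | inr i => c' i v.2 end) => -[v w].
have [Ev bv] := H v; have [Ew bw] := H' w; split.
  rewrite big_sumType /=.
  have S1 (F : J -> R) : \sum_j F j *: (e j, 0) = (\sum_j F j *: e j, 0) :> V * W.
    elim/big_rec2: _ => // j x y _ ->; congr pair.
    by rewrite /= scaler0 addr0.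
  have S2 (F : J' -> R) : \sum_j F j *: (0, e' j) = (0, \sum_j F j *: e' j) :> V * W.
    elim/big_rec2: _ => // j x y _ ->; congr pair.
    by rewrite /= scaler0 addr0.
  by rewrite S1 S2 -Ev -Ew; congr pair; rewrite /= ?addr0 ?add0r.
move=> [j|j] /=.
  exact: le_trans (bv j) (fst_norm (v, w)).
exact: le_trans (bw j) (snd_norm (v, w)).
Qed.

Lemma coordinatized_ephase (R : realType) n d : coordinatized (ephase R n d).
Proof.
do ?[apply: coordinatized_pair]; first [exact: coordinatized_row | exact: coordinatized_scalar].
Qed.

Lemma is_derive_line (R : realType) (V W : normedModType R) (f : V -> W)
    (a v : V) s df :
  is_derive (a + s *: v) v f df -> is_derive s (1 : R) (fun x => f (a + x *: v)) df.
Proof.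
have E : (fun h : R => h^-1 *: (((fun x => f (a + x *: v)) \o shift s) (h *: (1 : R)) -
    f (a + s *: v))) =
    (fun h : R => h^-1 *: ((f \o shift (a + s *: v)) (h *: v) - f (a + s *: v))).
  apply/funext => h /=; congr (_ *: (f _ - _)).
  by rewrite -[h *: 1]/(h * 1) mulr1 scalerDl addrCA.
by move=> [Hd Hv]; split; rewrite /derivable /derive E.
Qed.

Definition convex_region (R : realType) (V : normedModType R) (S : set V) : Prop :=
  forall x y (s : R), S x -> S y -> 0 <= s <= 1 -> S (x + s *: (y - x)).

Lemma derive_coordinates (R : realType) (V W : normedModType R) (J : finType)
    (e : J -> V) (c : J -> V -> R) (f : V -> W) (p v : V) :
  coordinates e c -> differentiable f p ->
  'D_v f p = \sum_j c j v *: 'D_(e j) f p.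
Proof.
move=> Hc Hd; rewrite deriveE//.
have [Ev _] := Hc v.
transitivity ('d f p (\sum_j c j v *: e j)); first by congr ('d f p _).
by rewrite linear_sum; apply: eq_bigr => j _; rewrite linearZ deriveE.
Qed.

(** Mean value inequality on the segment from x to y: the derivative along [y - x] is a sum of #|J|
    coordinate derivatives, each with a coefficient at most the norm of [y - x]. *)
Lemma lipschitz_convex (R : realType) (V W : normedModType R) (J : finType)
    (e : J -> V) (c : J -> V -> R) (S : set V) (f : V -> W) (M : R) :
  coordinates e c -> convex_region S ->
  (forall x, S x -> differentiable f x) ->
  (forall j x, S x -> `|'D_(e j) f x| <= M) ->
  forall x y, S x -> S y -> `|f y - f x| <= #|J|%:R * M * `|y - x|.
Proof.
move=> Hc conv Hd HM x y Sx Sy.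
pose v := y - x.
have -> : f y - f x = f (x + 1 *: v) - f (x + 0 *: v).
  by rewrite scale1r scale0r addr0 /v subrKC.
rewrite -[leRHS]mulr1.
apply: (@mean_value_norm _ _ 1 _ (fun s => f (x + s *: v))
  (fun s => 'D_v f (x + s *: v))) => // s s01.
  apply: is_derive_line; apply: derivableP.
  by apply/diff_derivable/Hd/conv.
have Sp : S (x + s *: v) by exact: conv.
have [_ bv] := Hc v.
rewrite (derive_coordinates v Hc (Hd _ Sp)).
apply: le_trans (ler_norm_sum _ _ _) _.
rewrite -mulrA mulr_natl -sumr_const.
apply: ler_sum => j _; rewrite normrZ mulrC.
by apply: ler_pM => //; exact: HM.
Qed.

Lemma convex_slab (R : realType) (V : normedModType R) (eps0 : R) :
  convex_region (@slab R V eps0).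
Proof.
move=> [x a] [y b] s; rewrite /slab /= => ha hb s01.
have -> : a + s *: (b - a) = (1 - s) * a + s * b by rewrite -[_ *: _]/(_ * _); ring.
apply: le_lt_trans (ler_normD _ _) _; rewrite !normrM.
case/andP: s01 => s0 s1.
have s1' : 0 <= 1 - s by rewrite subr_ge0.
rewrite (ger0_norm s0) (ger0_norm s1').
(* Strictness is carried by the term with factor s, so s = 0 is treated apart. *)
have [->|sn] := eqVneq s 0; first by rewrite subr0 mul1r mul0r addr0.
have : s * `|b| < s * eps0 by rewrite ltr_pM2l// lt_neqAle eq_sym sn.
have : (1 - s) * `|a| <= (1 - s) * eps0 by rewrite ler_wpM2l ?subr_ge0// ltW.
lra.
Qed.

Lemma convex_ball (R : realType) (V : normedModType R) (x0 : V) (r : R) :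
  convex_region [set x | `|x - x0| < r].
Proof.
move=> x y s /= hx hy /andP[s0 s1].
have -> : x + s *: (y - x) - x0 = (1 - s) *: (x - x0) + s *: (y - x0).
  have -> : y - x = (y - x0) - (x - x0) by rewrite opprB addrA subrK.
  by rewrite addrAC scalerBr scalerBl scale1r -[RHS]addrA [- _ + _]addrC.
apply: le_lt_trans (ler_normD _ _) _; rewrite !normrZ.
have s1' : 0 <= 1 - s by rewrite subr_ge0.
rewrite (ger0_norm s0) (ger0_norm s1').
have [->|sn] := eqVneq s 0; first by rewrite subr0 mul1r mul0r addr0.
have : s * `|y - x0| < s * r by rewrite ltr_pM2l// lt_neqAle eq_sym sn.
have : (1 - s) * `|x - x0| <= (1 - s) * r by rewrite ler_wpM2l ?subr_ge0// ltW.
lra.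
Qed.

(** By continuity, on some ball around x each of the finitely many coordinate derivatives exceeds
    its size at x by at most 1. *)
Lemma Ck_locally_lipschitz (R : realType) (V W : normedModType R) (U : set V)
    (f : V -> W) x : coordinatized V -> open U -> Ck 1 U f -> U x ->
  exists L delta : R, [/\ 0 <= L, 0 < delta & forall y y',
    `|y - x| < delta -> `|y' - x| < delta -> `|f y' - f y| <= L * `|y' - y|].
Proof.
move=> [J [e [c Hc]]] oU [Hd HD] Ux.
have : \forall y \near x, U y /\ forall j, `|'D_(e j) f y| <= `|'D_(e j) f x| + 1.
  apply: filterI; first exact: open_nbhs_nbhs.
  apply: filter_forall => j.
  have /cvgrPdist_le /(_ 1 ltr01) := HD (e j) x Ux.
  apply: filterS => y Hy; rewrite addrC -lerBlDr.
  by apply: le_trans Hy; rewrite distrC lerB_dist.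
move=> /nbhs_ballP[delta /= delta0 Hball].
pose M := \sum_j (`|'D_(e j) f x| + 1).
have M0 : 0 <= M by apply: sumr_ge0 => j _; rewrite addr_ge0.
exists (#|J|%:R * M), delta; split => //; first by rewrite mulr_ge0.
have HS y : `|y - x| < delta -> U y /\ forall j, `|'D_(e j) f y| <= `|'D_(e j) f x| + 1.
  by move=> yx; apply: Hball; rewrite -ball_normE /= distrC.
move=> y y' yx yx'.
apply: (lipschitz_convex Hc (@convex_ball _ _ x delta)) => //.
  by move=> p /HS[? _]; exact: Hd.
move=> j p /HS[_ /(_ j)] /le_trans; apply.
by rewrite /M (bigD1 j)//= lerDl sumr_ge0// => i _; rewrite addr_ge0.
Qed.

Lemma Ck_bounded_lipschitz (R : realType) (V W : normedModType R) (S : set V)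
    (f : V -> W) : coordinatized V -> convex_region S -> Ck_bounded 1 S f ->
  exists M : R, [/\ 0 <= M, forall x, S x -> `|f x| <= M &
    forall x y, S x -> S y -> `|f y - f x| <= M * `|y - x|].
Proof.
move=> [J [e [c Hc]]] conv [[B HB] [Hd HD]].
have [b Hb] : exists b : J -> R, forall j x, S x -> `|'D_(e j) f x| <= b j.
  have /choice[b Hb] : forall j, exists b, forall x, S x -> `|'D_(e j) f x| <= b.
    by move=> j; have [[b Hb] _] := HD (e j); exists b.
  by exists b.
pose M := \sum_j `|b j|.
have M0 : 0 <= M by apply: sumr_ge0.
exists (`|B| + #|J|%:R * M); split.
- by rewrite addr_ge0 ?mulr_ge0.
- move=> x Sx; apply: le_trans (HB x Sx) _; apply: le_trans (ler_norm _) _.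
  by rewrite lerDl mulr_ge0.
move=> x y Sx Sy; rewrite mulrDl; apply: ler_wpDl; first exact: mulr_ge0.
apply: (lipschitz_convex Hc conv) => // j p Sp.
apply: le_trans (Hb j p Sp) _; apply: le_trans (ler_norm _) _.
by rewrite /M (bigD1 j)//= lerDl sumr_ge0.
Qed.

(** * Torus lattice and uniqueness of orbits *)

Lemma approx_is_derive (R : realType) (W : normedModType R) (f : R -> W) s df :
  (forall eta, 0 < eta -> exists2 e, 0 < e &
    forall h, `|h| < e -> `|f (s + h) - f s - h *: df| <= eta * `|h|) ->
  is_derive s (1 : R) f df.
Proof.
move=> H.
have L : h^-1 *: ((f \o shift s) (h *: (1 : R)) - f s) @[h --> 0^'] --> df.
  apply/cvgrPdist_le => eta eta0; have [e e0 He] := H eta eta0.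
  rewrite near_withinE; exists e => //= h; rewrite /ball /= sub0r normrN => he h0.
  rewrite -[h *: 1]/(h * 1) mulr1 [h + s]addrC.
  have -> : df - h^-1 *: (f (s + h) - f s) = - (h^-1 *: (f (s + h) - f s - h *: df)).
    by rewrite [in RHS]scalerBr scalerA mulVf// scale1r opprB.
  rewrite normrN normrZ normfV mulrC ler_pdivrMr ?normr_gt0//.
  exact: He.
split; first by apply/cvg_ex; exists df.
exact/cvg_lim.
Qed.

Lemma is_derive_affine (R : realType) (W : normedModType R) (f : R -> W)
    (a b s : R) df :
  is_derive (b + a * s) (1 : R) f df ->
  is_derive s (1 : R) (fun x => f (b + a * x)) (a *: df).
Proof.
move=> /is_derive_approx H; apply: approx_is_derive => eta eta0.
have a0 : 0 < `|a| + 1 by rewrite ltr_wpDl.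
have [e e0 He] := H _ (divr_gt0 eta0 a0).
exists (e / (`|a| + 1)); first exact: divr_gt0.
move=> h; rewrite ltr_pdivlMr// => he.
have ah : `|a * h| <= `|h| * (`|a| + 1) by rewrite normrM mulrC ler_wpM2l// lerDl.
have := He (a * h) (le_lt_trans ah he).
rewrite mulrDr addrA scalerA (mulrC h) => /le_trans; apply.
by rewrite mulrAC ler_pdivrMr// -mulrA ler_wpM2l// ltW.
Qed.

Lemma is_derive_subC (R : realType) (W : normedModType R) (f g : R -> W)
    (m : W) (s : R) df dg :
  is_derive s (1 : R) f df -> is_derive s (1 : R) g dg ->
  is_derive s (1 : R) (fun x => f x - g x - m) (df - dg).
Proof.
move=> Hf Hg; rewrite -[X in is_derive _ _ X _]/(f - g - cst m) -[df - dg]subr0.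
apply: is_deriveB; exact: is_derive_cst.
Qed.

(** [A * K] is the shape of a Gronwall bound with initial size A and a growth factor K independent
    of A; this is how uniqueness is concluded. *)
Lemma eq0_of_small (R : realType) (W : normedModType R) (w : W) (K : R) :
  (forall A, 0 < A -> `|w| <= A * K) -> w = 0.
Proof.
move=> H; apply/eqP; rewrite -normr_le0; apply/ler_addgt0Pl => e e0.
rewrite addr0.
have K0 : 0 < `|K| + 1 by rewrite ltr_wpDl.
apply: le_trans (H (e / (`|K| + 1)) (divr_gt0 e0 K0)) _.
rewrite -[leRHS](@divfK _ (`|K| + 1)) ?gt_eqF// ler_wpM2l//.
  by rewrite divr_ge0// ltW.
by rewrite (le_trans (ler_norm _))// lerDl.
Qed.

Section projections.
Variable R : realType.

Section pairs.
Variables V W : normedModType R.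
Implicit Types x y : V * W.
Lemma fst_sub x y : (x - y).1 = x.1 - y.1. Proof. by []. Qed.
Lemma snd_sub x y : (x - y).2 = x.2 - y.2. Proof. by []. Qed.
Lemma fst_add x y : (x + y).1 = x.1 + y.1. Proof. by []. Qed.
Lemma snd_add x y : (x + y).2 = x.2 + y.2. Proof. by []. Qed.
Lemma fst_opp x : (- x).1 = - x.1. Proof. by []. Qed.
Lemma snd_opp x : (- x).2 = - x.2. Proof. by []. Qed.
Lemma fst_scale (a : R) x : (a *: x).1 = a *: x.1. Proof. by []. Qed.
Lemma snd_scale (a : R) x : (a *: x).2 = a *: x.2. Proof. by []. Qed.
End pairs.

Definition pairE := (fst_sub, snd_sub, fst_add, snd_add, fst_opp, snd_opp,
  fst_scale, snd_scale).

Variables n d : nat.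
Implicit Types z w : phase R n d.
Lemma mom_sub z w : mom (z - w) = mom z - mom w. Proof. by rewrite /mom !pairE. Qed.
Lemma pos_sub z w : pos (z - w) = pos z - pos w. Proof. by rewrite /pos !pairE. Qed.
Lemma act_sub z w : act (z - w) = act z - act w. Proof. by rewrite /act !pairE. Qed.
Lemma ang_sub z w : ang (z - w) = ang z - ang w. Proof. by rewrite /ang !pairE. Qed.
Lemma mom_add z w : mom (z + w) = mom z + mom w. Proof. by rewrite /mom !pairE. Qed.
Lemma pos_add z w : pos (z + w) = pos z + pos w. Proof. by rewrite /pos !pairE. Qed.
Lemma act_add z w : act (z + w) = act z + act w. Proof. by rewrite /act !pairE. Qed.
Lemma ang_add z w : ang (z + w) = ang z + ang w. Proof. by rewrite /ang !pairE. Qed.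
Lemma mom_opp z : mom (- z) = - mom z. Proof. by rewrite /mom !pairE. Qed.
Lemma pos_opp z : pos (- z) = - pos z. Proof. by rewrite /pos !pairE. Qed.
Lemma act_opp z : act (- z) = - act z. Proof. by rewrite /act !pairE. Qed.
Lemma ang_opp z : ang (- z) = - ang z. Proof. by rewrite /ang !pairE. Qed.
Lemma mom_scale (a : R) z : mom (a *: z) = a *: mom z. Proof. by rewrite /mom !pairE. Qed.
Lemma pos_scale (a : R) z : pos (a *: z) = a *: pos z. Proof. by rewrite /pos !pairE. Qed.
Lemma act_scale (a : R) z : act (a *: z) = a *: act z. Proof. by rewrite /act !pairE. Qed.
Lemma ang_scale (a : R) z : ang (a *: z) = a *: ang z. Proof. by rewrite /ang !pairE. Qed.

Definition phaseE := (mom_sub, pos_sub, act_sub, ang_sub, mom_add, pos_add,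
  act_add, ang_add, mom_opp, pos_opp, act_opp, ang_opp,
  mom_scale, pos_scale, act_scale, ang_scale).

End projections.

Section lattice.
Variables (R : realType) (n d : nat).
Implicit Types (m z w : ephase R n d).

(** The kernel of the covering of the extended phase space. Equality modulo the lattice becomes an
    additive condition on differences, so that norms of lifts can be estimated directly. *)
Definition lattice_shift m : Prop :=
  [/\ mom m.1 = 0, lattice (pos m.1), act m.1 = 0, lattice (ang m.1) & m.2 = 0].

Lemma lattice_sub k (u v : 'rV[R]_k) : lattice u -> lattice v -> lattice (u - v).
Proof. by move=> Hu Hv j; rewrite !mxE rpredB. Qed.

Lemma lattice_opp k (u : 'rV[R]_k) : lattice u -> lattice (- u).
Proof. by move=> Hu j; rewrite !mxE rpredN. Qed.

Lemma lattice_add k (u v : 'rV[R]_k) : lattice u -> lattice v -> lattice (u + v).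
Proof. by move=> Hu Hv j; rewrite !mxE rpredD. Qed.

Lemma lattice0 k : lattice (0 : 'rV[R]_k).
Proof. by move=> j; rewrite mxE. Qed.

Lemma teq_shift z w : teq z w <-> lattice_shift (z - w).
Proof.
rewrite /lattice_shift !pairE !phaseE; split.
  by move=> [[h1 h2 h3 h4] h5]; rewrite h1 h3 h5 !subrr; split.
move=> [/eqP h1 h2 /eqP h3 h4 /eqP h5].
move: h1 h3 h5; rewrite !subr_eq0 => /eqP h1 /eqP h3 /eqP h5.
by split; first split.
Qed.

Lemma lattice_shift_opp m : lattice_shift m -> lattice_shift (- m).
Proof.
rewrite /lattice_shift !pairE !phaseE => -[-> h2 -> h4 ->]; rewrite !oppr0.
by split => //; exact: lattice_opp.
Qed.

Lemma lattice_shift_add m m' : lattice_shift m -> lattice_shift m' -> lattice_shift (m + m').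
Proof.
rewrite /lattice_shift !pairE !phaseE => -[-> h2 -> h4 ->] [-> k2 -> k4 ->].
by rewrite !addr0; split => //; exact: lattice_add.
Qed.

Lemma lattice_shift0 : lattice_shift 0.
Proof. by split => //; exact: lattice0. Qed.

Lemma teq_refl z : teq z z.
Proof. by apply/teq_shift; rewrite subrr; exact: lattice_shift0. Qed.

Lemma teq_sym z w : teq z w -> teq w z.
Proof. by move=> /teq_shift/lattice_shift_opp; rewrite opprB => /teq_shift. Qed.

Lemma teq_trans z w v : teq z w -> teq w v -> teq z v.
Proof.
move=> /teq_shift h /teq_shift k; apply/teq_shift.
by rewrite -(subrK w z) -addrA; exact: lattice_shift_add.
Qed.

Lemma teq_addr z m : lattice_shift m -> teq z (z + m).
Proof.
by move=> H; apply/teq_sym/teq_shift; rewrite addrAC subrr add0r.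
Qed.

Lemma centered_int (x k : R) : k \is a Num.int -> centered (x + k) = centered x.
Proof.
move=> kI; rewrite /centered.
have -> : x + k + 2^-1 = x + 2^-1 + k by ring.
by rewrite floorDrz// intrD (floorK kI) opprD addrACA subrr addr0.
Qed.

Lemma centered_small (x : R) : `|x| < 2^-1 -> centered x = x.
Proof.
rewrite ltr_norml => /andP[h1 h2]; rewrite /centered.
have -> : Num.floor (x + 2^-1) = 0; last by rewrite subr0.
by apply/eqP; rewrite floor_eq add0r; move: h1 h2; lra.
Qed.

(** Two representatives smaller than 1/2 that differ by integers coincide, so any lattice translate
    this small is the centered one. *)
Lemma tdiff_small k (u v m : 'rV[R]_k) :
  lattice m -> `|u - v - m| < 2^-1 -> tdiff u v = u - v - m.
Proof.
move=> Hm Hs; apply/rowP => j; rewrite mxE.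
have -> : u 0 j - v 0 j = (u - v - m) 0 j + m 0 j by rewrite !mxE subrK.
rewrite centered_int// centered_small//.
exact: le_lt_trans (row_norm_ge _ _) Hs.
Qed.

Lemma tdiff_lattice k (u v : 'rV[R]_k) : lattice (u - v - tdiff u v).
Proof.
by move=> j; rewrite !mxE /centered opprB addrC subrK intr_int.
Qed.

Lemma ephase_eq z w : mom z.1 = mom w.1 -> pos z.1 = pos w.1 ->
  act z.1 = act w.1 -> ang z.1 = ang w.1 -> z.2 = w.2 -> z = w.
Proof.
case: z => [[[[z1 z2] z3] z4] z5]; case: w => [[[[w1 w2] w3] w4] w5].
by rewrite /mom /pos /act /ang /= => -> -> -> -> ->.
Qed.

Lemma tdist_shift z w :
  exists2 m, lattice_shift m & tdist z w = `|z - w - m|.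
Proof.
exists (0, pos z.1 - pos w.1 - tdiff (pos z.1) (pos w.1), 0,
   ang z.1 - ang w.1 - tdiff (ang z.1) (ang w.1), 0).
  by split => //; exact: tdiff_lattice.
rewrite /tdist; congr (`| _ |); apply: ephase_eq; rewrite !pairE ?phaseE.
- by rewrite subr0.
- by rewrite opprB subrKC.
- by rewrite subr0.
- by rewrite opprB subrKC.
- by rewrite subr0.
Qed.

(** The shift is a witness: once chosen it can be held fixed along an orbit and differentiated
    through, whereas the representative used by [tdist] jumps. *)
Definition close (b : R) z w : Prop :=
  exists2 m, lattice_shift m & `|z - w - m| <= b.

Lemma tdist_close b z w : tdist z w <= b -> close b z w.
Proof. by have [m Hm ->] := tdist_shift z w; exists m. Qed.

Lemma close_sym b z w : close b z w -> close b w z.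
Proof.
move=> [m Hm Em]; exists (- m); first exact: lattice_shift_opp.
by rewrite -normrN opprD opprK opprB.
Qed.

Lemma close_le b b' z w : b <= b' -> close b z w -> close b' z w.
Proof. by move=> bb' [m Hm Em]; exists m => //; apply: le_trans bb'. Qed.

Lemma tdist_teq z z' w w' : teq z z' -> teq w w' -> tdist z w = tdist z' w'.
Proof.
move=> [[a1 a2 a3 a4] a5] [[b1 b2 b3 b4] b5].
have H k (u u' v v' : 'rV[R]_k) : lattice (u - u') -> lattice (v - v') ->
    tdiff u v = tdiff u' v'.
  move=> hu hv; apply/rowP => j; rewrite !mxE.
  have -> : u 0 j - v 0 j = u' 0 j - v' 0 j + ((u - u') - (v - v')) 0 j.
    by rewrite !mxE; ring.
  by rewrite centered_int//; exact: lattice_sub.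
by rewrite /tdist a1 a3 a5 b1 b3 b5 (H _ _ _ _ _ a2 b2) (H _ _ _ _ _ a4 b4).
Qed.

Lemma norm_mom (z : phase R n d) : `|mom z| <= `|z|.
Proof. by apply: le_trans (fst_norm z); apply: le_trans (fst_norm z.1); exact: fst_norm. Qed.
Lemma norm_pos (z : phase R n d) : `|pos z| <= `|z|.
Proof. by apply: le_trans (fst_norm z); apply: le_trans (fst_norm z.1); exact: snd_norm. Qed.
Lemma norm_act (z : phase R n d) : `|act z| <= `|z|.
Proof. by apply: le_trans (fst_norm z); exact: snd_norm. Qed.
Lemma norm_ang (z : phase R n d) : `|ang z| <= `|z|.
Proof. exact: snd_norm. Qed.

Lemma phase_norm_le (z : phase R n d) M : `|mom z| <= M -> `|pos z| <= M ->
  `|act z| <= M -> `|ang z| <= M -> `|z| <= M.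
Proof. by move=> ? ? ? ?; do 3!apply: pair_norm_le => //. Qed.

Lemma is_derive_act (f : R -> ephase R n d) df s : is_derive s (1 : R) f df ->
  is_derive s (1 : R) (fun x => act (f x).1) (act df.1).
Proof.
apply: (@is_derive_linear _ _ _ (fun w : ephase R n d => act w.1) 1) => [a u v|w].
  by rewrite !pairE !phaseE.
by rewrite mul1r; apply: le_trans (fst_norm w); exact: norm_act.
Qed.

Lemma is_derive_ang (f : R -> ephase R n d) df s : is_derive s (1 : R) f df ->
  is_derive s (1 : R) (fun x => ang (f x).1) (ang df.1).
Proof.
apply: (@is_derive_linear _ _ _ (fun w : ephase R n d => ang w.1) 1) => [a u v|w].
  by rewrite !pairE !phaseE.
by rewrite mul1r; apply: le_trans (fst_norm w); exact: norm_ang.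
Qed.

Lemma is_derive_snd (f : R -> ephase R n d) df s : is_derive s (1 : R) f df ->
  is_derive s (1 : R) (fun x => (f x).2) df.2.
Proof.
apply: (@is_derive_linear _ _ _ (fun w : ephase R n d => w.2) 1) => [a u v|w].
  by rewrite !pairE.
by rewrite mul1r; exact: snd_norm.
Qed.

Definition locally_lipschitz (V W : normedModType R) (Y : V -> W) : Prop :=
  forall x, exists L delta : R, [/\ 0 <= L, 0 < delta & forall y y',
    `|y - x| < delta -> `|y' - x| < delta -> `|Y y' - Y y| <= L * `|y' - y|].

(** By periodicity of Y a lattice translate of a solution is again a solution. Y is only locally
    Lipschitz, so equality is propagated by real induction: Gronwall gives the step to the right,
    continuity the limit from the left. *)
Lemma curve_unique_forward (Y : ephase R n d -> ephase R n d)
    (g1 g2 : R -> ephase R n d) m :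
  (forall w w', teq w w' -> Y w = Y w') -> locally_lipschitz Y ->
  (forall s, is_derive s (1 : R) g1 (Y (g1 s))) ->
  (forall s, is_derive s (1 : R) g2 (Y (g2 s))) ->
  lattice_shift m -> g2 0 = g1 0 + m ->
  forall s : R, 0 <= s -> g2 s - g1 s - m = 0.
Proof.
move=> per lip H1 H2 Hm E0 s s0.
apply: (@real_induction R (fun s => g2 s - g1 s - m = 0) s); rewrite ?s0 ?lexx//.
- by rewrite E0 -addrA -opprD subrr.
- move=> a /andP[a0 _] Ea.
  have [L [delta [L0 delta0 Hlip]]] := lip (g2 a).
  have d2 : 0 < delta / 2 by rewrite divr_gt0.
  have [e1 e10 C1] := is_derive_continuous (H1 a) d2.
  have [e2 e20 C2] := is_derive_continuous (H2 a) d2.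
  exists (Num.min e1 e2); first by rewrite lt_min e10.
  move=> u /andP[au]; rewrite -ltrBlDl lt_min => /andP[u1 u2].
  (* The difference vanishes at time a, so Gronwall applies with zero forcing and every initial size
     A > 0. *)
  apply: (@eq0_of_small _ _ _ (expR ((u - a) * (L + 1)))) => A A0.
  have := @gronwall _ _ (u - a) A L 0 (fun h => g2 (a + h) - g1 (a + h) - m)
     (fun h => Y (g2 (a + h)) - Y (g1 (a + h))) L0.
  rewrite lexx A0 => /(_ isT) K.
  have {}K := K _ _ _ (u - a); rewrite subrKC in K; apply: K.
  + move=> h _; apply: is_derive_subC.
      have := @is_derive_affine _ _ g2 1 a h _ (H2 _).
      by rewrite scale1r mul1r; under eq_fun do rewrite mul1r.
    have := @is_derive_affine _ _ g1 1 a h _ (H1 _).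
    by rewrite scale1r mul1r; under eq_fun do rewrite mul1r.
  + by rewrite addr0 Ea normr0 ltW.
  + move=> h /andP[h0 hu] _; rewrite addr0.
    have hN : `|h| = h by rewrite ger0_norm.
    (* Translating the first curve by m brings both arguments into the ball around [g2 a] where the
       Lipschitz bound is available. *)
    rewrite (per (g1 (a + h)) (g1 (a + h) + m)); last exact: teq_addr.
    have -> : g2 (a + h) - g1 (a + h) - m = g2 (a + h) - (g1 (a + h) + m).
      by rewrite opprD addrA.
    apply: Hlip; last first.
      apply: le_lt_trans (C2 h _) _; first by rewrite hN (lt_trans hu).
      by rewrite ltr_pdivrMr// mulr_natr mulr2n ltrDl.
    have -> : g2 a = g1 a + m.
      by move: Ea => /eqP; rewrite subr_eq0 subr_eq addrC => /eqP.
    rewrite opprD addrACA subrr addr0.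
    apply: le_lt_trans (C1 h _) _; first by rewrite hN (lt_trans hu).
    by rewrite ltr_pdivrMr// mulr_natr mulr2n ltrDl.
  + by rewrite lexx subr_ge0 ltW.
- move=> a /andP[a0 _] Hu; apply: (@eq0_of_small _ _ _ 1) => A A0; rewrite mulr1.
  have HF := is_derive_subC m (H2 a) (H1 a).
  have [e e0 He] := is_derive_continuous HF A0.
  pose h := Num.min a e / 2.
  have m0 : 0 < Num.min a e by rewrite lt_min a0.
  have [h0 ha he] : [/\ 0 < h, h <= a & h < e].
    have : h < Num.min a e by rewrite /h; lra.
    by rewrite lt_min => /andP[/ltW ? ?]; split => //; rewrite /h; lra.
  have := He (- h); rewrite normrN gtr0_norm// => /(_ he).
  rewrite (Hu (a - h)) ?sub0r ?normrN//; lra.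
Qed.

(** Negative times follow by reversing time, which replaces the field by [- Y]. *)
Lemma curve_unique (Y : ephase R n d -> ephase R n d)
    (g1 g2 : R -> ephase R n d) :
  (forall w w', teq w w' -> Y w = Y w') -> locally_lipschitz Y ->
  (forall s, is_derive s (1 : R) g1 (Y (g1 s))) ->
  (forall s, is_derive s (1 : R) g2 (Y (g2 s))) ->
  teq (g2 0) (g1 0) -> forall s, g2 s = g1 s + (g2 0 - g1 0).
Proof.
move=> per lip H1 H2 /teq_shift Hm s.
pose m := g2 0 - g1 0.
have E0 : g2 0 = g1 0 + m by rewrite subrKC.
suff : g2 s - g1 s - m = 0 by move/eqP; rewrite subr_eq0 subr_eq addrC => /eqP.
have [s0|s0] := leP 0 s; first exact: (curve_unique_forward per lip).
have D (g : R -> ephase R n d) : (forall s, is_derive s (1 : R) g (Y (g s))) ->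
    forall s, is_derive s (1 : R) (fun x => g (- x)) (- Y (g (- s))).
  move=> H x; have := @is_derive_affine _ _ g (-1) 0 x _ (H _).
  by rewrite add0r scaleN1r mulN1r; under eq_fun do rewrite add0r mulN1r.
have := @curve_unique_forward (fun w => - Y w) (fun x => g1 (- x))
  (fun x => g2 (- x)) m _ _ (D _ H1) (D _ H2) Hm _ (- s).
rewrite opprK oppr0 => K; apply: K => //; last by rewrite oppr_ge0 ltW.
  by move=> w w' /per ->.
move=> x; have [L [delta [L0 d0 Hl]]] := lip x.
exists L, delta; split => // y y' hy hy'.
by rewrite -opprD normrN; exact: Hl.
Qed.

End lattice.

(** * The unperturbed field *)

Lemma Ck_weaken (R : realType) (V W : normedModType R) k k' (U : set V) (f : V -> W) :
  (k <= k')%N -> Ck k' U f -> Ck k U f.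
Proof.
elim: k' k f => [|k' IH] [|k] f //; last first.
  by rewrite ltnS => kk [Hd HD]; split => // v; exact: (IH _ _ kk (HD v)).
by move=> _ [Hd _] x Ux; by apply: differentiable_continuous; exact: Hd.
Qed.

Lemma Ck_bounded_weaken (R : realType) (V W : normedModType R) k k' (U : set V)
    (f : V -> W) : (k <= k')%N -> Ck_bounded k' U f -> Ck_bounded k U f.
Proof.
elim: k' k f => [|k' IH] [|k] f //; last first.
  by rewrite ltnS => kk [HB [Hd HD]]; split => //; split => // v; exact: (IH _ _ kk (HD v)).
move=> _ [HB [Hd _]]; split => // x Ux; by apply: differentiable_continuous; exact: Hd.
Qed.

Lemma derive_along (R : realType) (V W : normedModType R) (f : V -> W) z v df :
  is_derive (0 : R) (1 : R) (fun h => f (z + h *: v)) df -> 'D_v f z = df.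
Proof.
case=> _ <-; rewrite /derive.
have -> // : (fun h : R => h^-1 *: (((fun h => f (z + h *: v)) \o shift 0) (h *: (1 : R)) -
    f (z + 0 *: v))) = (fun h : R => h^-1 *: ((f \o shift z) (h *: v) - f z)).
apply/funext => h /=.
by rewrite -[h *: 1]/(h * 1) mulr1 addr0 scale0r addr0 [z + _]addrC.
Qed.

Lemma derive_affine (R : realType) (V W : normedModType R) (f : V -> W) z v w :
  (forall h : R, f (z + h *: v) = f z + h *: w) -> 'D_v f z = w.
Proof.
move=> H; apply: derive_along; apply: approx_is_derive => eta eta0.
exists 1 => // h _.
by rewrite add0r !H scale0r addr0 -addrA -opprD subrr normr0 mulr_ge0// ltW.
Qed.

Lemma is_derive_affine_image (R : realType) (K c df : R) (f : R -> R) s :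
  is_derive s (1 : R) f df -> is_derive s (1 : R) (fun x => K + c * f x) (c * df).
Proof.
move=> H; rewrite -[X in is_derive _ _ X _]/(cst K + c \*: f) -[c * df]add0r.
by apply: is_deriveD; exact: is_deriveZ.
Qed.

Lemma derive_ang (R : realType) n d (z v : phase R n d) : 'D_v ang z = ang v.
Proof. by apply: derive_affine => h; rewrite !phaseE. Qed.

Lemma derive_act (R : realType) n d (z v : phase R n d) : 'D_v act z = act v.
Proof. by apply: derive_affine => h; rewrite !phaseE. Qed.

Lemma vf_act_ang (R : realType) n d (X : phase R n d -> phase R n d) z :
  vf_act X ang z = ang (X z).
Proof.
rewrite /vf_act big1 ?add0r => [|i _]; last first.
  by rewrite !derive_ang /ang /= !scaler0 addr0.
rewrite [RHS]row_sum_delta; apply: eq_bigr => j _.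
by rewrite !derive_ang {2 4}/ang /= scaler0 add0r.
Qed.

Lemma vf_act_act (R : realType) n d (X : phase R n d -> phase R n d) z :
  vf_act X act z = act (X z).
Proof.
rewrite /vf_act big1 ?add0r => [|i _]; last first.
  by rewrite !derive_act /act /= !scaler0 addr0.
rewrite [RHS]row_sum_delta; apply: eq_bigr => j _.
by rewrite !derive_act {2 4}/act /= scaler0 addr0.
Qed.

(** The bracket with H is the derivative along the field J grad H. This is where the sign
    conventions of the two meet, and it reduces the Hamiltonian formula to the general one. *)
Lemma pbracket_vf_act (R : realType) n d (W : normedModType R)
    (f : phase R n d -> W) (H : phase R n d -> R) z :
  pbracket f H z = vf_act (ham_field H) f z.
Proof.
rewrite /pbracket /vf_act; congr (_ + _); apply: eq_bigr => j _.
  by rewrite /ham_field /mom /pos /= !mxE scaleNr addrC.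
by rewrite /ham_field /act /ang /= !mxE scaleNr addrC.
Qed.

Section unperturbed.
Variables (R : realType) (n d : nat).

Definition frequency (h0 : 'rV[R]_d -> R) (I : 'rV[R]_d) : 'rV[R]_d :=
  \row_j 'D_(delta_mx 0 j) h0 I.

(** Each partial derivative is taken along a coordinate line, on which all of the Hamiltonian but
    one term is a constant, called [K] in each case. *)
Lemma ham_field_rotator_pendulum (h0 : 'rV[R]_d -> R) (sg : 'I_n -> bool)
    (V : 'I_n -> R -> R) (z : phase R n d) :
  (forall I, differentiable h0 I) -> (forall i x, derivable (V i) x 1) ->
  ham_field (rotator_pendulum h0 sg V) z =
  (\row_i - ((-1) ^+ sg i * derive1 (V i) (pos z 0 i)),
   \row_i ((-1) ^+ sg i * mom z 0 i), 0, frequency h0 (act z)).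
Proof.
move=> dh dV; rewrite /ham_field; congr (_, _, _, _); apply/rowP => j; rewrite !mxE.
- congr (- _); apply: derive_along.
  pose K := h0 (act z) + \sum_(i < n | i != j) (-1) ^+ sg i *
    (2^-1 * mom z 0 i ^+ 2 + V i (pos z 0 i)) + (-1) ^+ sg j * (2^-1 * mom z 0 j ^+ 2).
  have -> : (fun h => rotator_pendulum h0 sg V (z + h *: e_pos j)) =
      (fun h => K + (-1) ^+ sg j * V j (pos z 0 j + 1 * h)).
    apply/funext => h; rewrite /rotator_pendulum !phaseE.
    have -> : act (@e_pos R n d j) = 0 by [].
    have -> : mom (@e_pos R n d j) = 0 by [].
    have -> : pos (@e_pos R n d j) = delta_mx 0 j by [].
    rewrite !scaler0 !addr0 (bigD1 j)//= !mxE !eqxx mulr1 mul1r.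
    rewrite (eq_bigr (fun i => (-1) ^+ sg i *
      (2^-1 * mom z 0 i ^+ 2 + V i (pos z 0 i)))); last first.
      by move=> i ij; rewrite !mxE (negbTE ij) andbF mulr0 addr0.
    by rewrite /K; ring.
  apply: is_derive_affine_image; rewrite -[X in is_derive _ _ _ X]scale1r.
  apply: is_derive_affine; rewrite mulr0 addr0 derive1E.
  exact: derivableP.
- apply: derive_along.
  pose K := h0 (act z) + \sum_(i < n | i != j) (-1) ^+ sg i *
    (2^-1 * mom z 0 i ^+ 2 + V i (pos z 0 i)) + (-1) ^+ sg j * V j (pos z 0 j).
  have -> : (fun h => rotator_pendulum h0 sg V (z + h *: e_mom j)) =
      (fun h => K + (-1) ^+ sg j * (2^-1 * (mom z 0 j + h) ^+ 2)).
    apply/funext => h; rewrite /rotator_pendulum !phaseE.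
    have -> : act (@e_mom R n d j) = 0 by [].
    have -> : pos (@e_mom R n d j) = 0 by [].
    have -> : mom (@e_mom R n d j) = delta_mx 0 j by [].
    rewrite !scaler0 !addr0 (bigD1 j)//= !mxE !eqxx mulr1.
    rewrite (eq_bigr (fun i => (-1) ^+ sg i *
      (2^-1 * mom z 0 i ^+ 2 + V i (pos z 0 i)))); last first.
      by move=> i ij; rewrite !mxE (negbTE ij) andbF mulr0 addr0.
    by rewrite /K; ring.
  apply: is_derive_affine_image; apply: approx_is_derive => eta eta0.
  exists eta => // h he; rewrite -[h *: _]/(h * _).
  have -> : 2^-1 * (mom z 0 j + (0 + h)) ^+ 2 - 2^-1 * (mom z 0 j + 0) ^+ 2 -
    h * mom z 0 j = 2^-1 * h * h by field.
  rewrite !normrM ler_wpM2r// ger0_norm ?invr_ge0//.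
  by move: he; have := normr_ge0 h; lra.
- apply/eqP; rewrite oppr_eq0; apply/eqP; apply: derive_affine => h.
  rewrite /rotator_pendulum !phaseE.
  have -> : act (@e_ang R n d j) = 0 by [].
  have -> : pos (@e_ang R n d j) = 0 by [].
  have -> : mom (@e_ang R n d j) = 0 by [].
  by rewrite !scaler0 !addr0.
- apply: derive_along.
  pose K := \sum_(i < n) (-1) ^+ sg i * (2^-1 * mom z 0 i ^+ 2 + V i (pos z 0 i)).
  have -> : (fun h => rotator_pendulum h0 sg V (z + h *: e_act j)) =
      (fun h => K + 1 * h0 (act z + h *: delta_mx 0 j)).
    apply/funext => h; rewrite /rotator_pendulum !phaseE.
    have -> : act (@e_act R n d j) = delta_mx 0 j by [].
    have -> : pos (@e_act R n d j) = 0 by [].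
    have -> : mom (@e_act R n d j) = 0 by [].
    by rewrite !scaler0 !addr0 mul1r addrC.
  rewrite -[X in is_derive _ _ _ X]mul1r; apply: is_derive_affine_image.
  apply: is_derive_line; rewrite scale0r addr0; apply: derivableP.
  exact: diff_derivable.
Qed.

Lemma periodic_int (f : R -> R) : (forall x, f (x + 1) = f x) ->
  forall x k, k \is a Num.int -> f (x + k) = f x.
Proof.
move=> per x _ /intrP[k ->].
have P m y : f (y + m%:R) = f y.
  by elim: m => [|m IH]; rewrite ?addr0// -addn1 natrD addrA per.
case: k => m; first exact: P.
by rewrite NegzE mulrNz -[x in RHS](subrK (m.+1%:R) x) P.
Qed.

Lemma derive_periodic (f : R -> R) : (forall x, f (x + 1) = f x) ->
  forall x, 'D_1 f (x + 1) = 'D_1 f x.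
Proof.
move=> per x; rewrite /derive.
have -> // : (fun h : R => h^-1 *: ((f \o shift (x + 1)) (h *: (1 : R)) - f (x + 1))) =
    (fun h : R => h^-1 *: ((f \o shift x) (h *: (1 : R)) - f x)).
by apply/funext => h /=; rewrite addrA !per.
Qed.

(** The second derivative is continuous and periodic, hence bounded by its maximum over one period.
    A global constant is wanted because positions are lifts and range over all of R^n. *)
Lemma periodic_derive_lipschitz (V : R -> R) : Ck 2 setT V ->
  (forall x, V (x + 1) = V x) ->
  exists2 L, 0 <= L & forall x y, `|derive1 V y - derive1 V x| <= L * `|y - x|.
Proof.
move=> [_ /(_ 1) [dV' /(_ 1) cV'']] per.
pose g x := 'D_1 (fun x => 'D_1 V x) x.
have pg x k : k \is a Num.int -> g (x + k) = g x.
  by apply: periodic_int; apply: derive_periodic; exact: derive_periodic.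
have cg : {within `[0, 1], continuous (fun x => `|g x|)}.
  apply: continuous_subspaceT => x.
  by apply: continuous_comp; [exact: cV'' | exact: norm_continuous].
have [c _ Hc] := EVT_max (ler01) cg.
exists `|g c| => // x y.
have co : coordinates (fun=> 1 : R) (fun (_ : unit) (v : R) => v).
  move=> v; split => //; rewrite (big_pred1 tt) => [|[]//].
  by rewrite -[v *: _]/(v * _) mulr1.
have bound t : `|g t| <= `|g c|.
  have kI : - (Num.floor t)%:~R \is a @Num.int R by rewrite rpredN intr_int.
  rewrite -(pg t _ kI); apply: Hc; rewrite in_itv /= subr_ge0 floor_le_tmp /=.
  by rewrite lerBlDl -[1]/(1%:~R) -intrD ltW// floorD1_gt.
have H := @lipschitz_convex _ _ _ _ _ _ setT (fun x => 'D_1 V x) `|g c| co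
  (fun _ _ _ _ _ _ => I) dV' (fun _ t _ => bound t) x y I I.
rewrite card_unit mul1r in H.
by rewrite !derive1E; exact: H.
Qed.

(** The entries of the Hessian are C^1, hence within O(r) of their values at [I0] on the ball of
    radius r. The mean value inequality on the segment from I2 to I1, applied to the frequency minus
    its linear part at [I0], yields an error that is a product of r and the action difference. *)
Lemma frequency_expansion (h0 : 'rV[R]_d -> R) (I0 : 'rV[R]_d) : Ck 3 setT h0 ->
  exists C delta : R, [/\ 0 <= C, 0 < delta & forall r I1 I2, r < delta ->
    `|I1 - I0| <= r -> `|I2 - I0| <= r ->
    `|frequency h0 I1 - frequency h0 I2 - (I1 - I2) *m hessian h0 I0|
      <= C * r * `|I1 - I2|].
Proof.
move=> [_ Hh].
pose w j := fun J => 'D_(delta_mx 0 j) h0 J.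
pose f (ij : 'I_d * 'I_d) := fun I => 'D_(delta_mx 0 ij.1) (w ij.2) I.
have /choice[L HL] : forall ij, exists L : R,
    \forall I \near I0, `|f ij I - f ij I0| <= L * `|I - I0|.
  move=> [i j]; have [_ /(_ (delta_mx 0 i)) H] := Hh (delta_mx 0 j).
  have [L [delta [L0 delta0 HL]]] :=
    Ck_locally_lipschitz (coordinatized_row _ d) openT H (I : setT I0).
  exists L; apply/nbhs_ballP; exists delta => //= I.
  rewrite -ball_normE /= distrC => HI; apply: HL => //.
  by rewrite subrr normr0.
have := @filter_forall _ ('I_d * 'I_d)%type
  (fun ij I => `|f ij I - f ij I0| <= L ij * `|I - I0|) _ (nbhs_filter I0) HL.
move=> /nbhs_ballP[delta /= delta0 Hball].
pose M := \sum_ij `|L ij|.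
have M0 : 0 <= M by apply: sumr_ge0.
exists (d%:R * M), delta; split => //; first by rewrite mulr_ge0.
move=> r I1 I2 rd h1 h2.
have r0 : 0 <= r by apply: le_trans h1.
pose v := I1 - I2; rewrite -/v.
apply: row_norm_le => [|j]; first by rewrite !mulr_ge0.
rewrite !mxE.
have Ew s : is_derive s (1 : R) (fun s => w j (I2 + s *: v))
    ('D_v (w j) (I2 + s *: v)).
  apply: is_derive_line; apply: derivableP; apply: diff_derivable.
  by have [+ _] := Hh (delta_mx 0 j); apply.
have Ed s : is_derive s (1 : R) (fun s => w j (I2 + s *: v) - s * (v *m hessian h0 I0) 0 j)
    ('D_v (w j) (I2 + s *: v) - (v *m hessian h0 I0) 0 j).
  set c := _ 0 j.
  have -> : (fun s => w j (I2 + s *: v) - s * c) = (fun s => w j (I2 + s *: v)) + (- c \*: id).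
    by apply/funext => t /=; rewrite -[RHS]/(_ + - c * t) mulNr mulrC.
  apply: is_deriveD; rewrite -[X in is_derive _ _ _ X]mulr1.
  exact: (@is_deriveZ _ _ _ id).
have := @mean_value_norm _ _ 1 (d%:R * M * r * `|v|) _ _ ler01 (fun s _ => Ed s).
rewrite mulr1 scale1r scale0r addr0 /= mul0r subr0 mul1r subrKC => H.
have -> : 'D_(delta_mx 0 j) h0 I1 - 'D_(delta_mx 0 j) h0 I2
    - \sum_k (I1 - I2) 0 k * hessian h0 I0 k j =
    w j I1 - (v *m hessian h0 I0) 0 j - w j I2.
  by rewrite !mxE addrAC.
apply: H => s s01.
pose p := I2 + s *: v.
have pr : `|p - I0| <= r.
  have [s0 s1] := andP s01.
  have -> : p - I0 = (1 - s) *: (I2 - I0) + s *: (I1 - I0).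
    have Ev : v = (I1 - I0) - (I2 - I0) by rewrite opprB addrA subrK.
    by rewrite /p Ev addrAC scalerBr scalerBl scale1r -[RHS]addrA [- _ + _]addrC.
  apply: le_trans (ler_normD _ _) _; rewrite !normrZ.
  have s1' : 0 <= 1 - s by rewrite subr_ge0.
  rewrite (ger0_norm s0) (ger0_norm s1').
  have : s * `|I1 - I0| <= s * r by rewrite ler_wpM2l.
  have : (1 - s) * `|I2 - I0| <= (1 - s) * r by rewrite ler_wpM2l.
  lra.
have co : coordinates (fun j : 'I_d => delta_mx 0 j : 'rV[R]_d)
    (fun j (v : 'rV[R]_d) => v 0 j).
  by move=> u; split; [exact: row_sum_delta | move=> i; exact: row_norm_ge].
rewrite (derive_coordinates v co); last first.
  by have [+ _] := Hh (delta_mx 0 j); apply.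
rewrite mxE -sumrB; apply: le_trans (ler_norm_sum _ _ _) _.
have -> : d%:R * M * r * `|v| = \sum_(i < d) M * r * `|v|.
  by rewrite sumr_const card_ord -!mulrA mulr_natl.
apply: ler_sum => i _.
rewrite [hessian _ _ _ _]mxE -[v 0 i *: _]/(v 0 i * _) -mulrBr normrM mulrC.
apply: ler_pM => //; last exact: row_norm_ge.
have := Hball p; rewrite -ball_normE /= distrC => /(_ (le_lt_trans pr rd)) /(_ (i, j)).
move/le_trans; apply; apply: (@le_trans _ _ (`|L (i, j)| * `|p - I0|)).
  by rewrite ler_wpM2r// ler_norm.
by apply: ler_pM => //; rewrite /M (bigD1 (i, j))//= lerDl sumr_ge0.
Qed.

End unperturbed.

(** * Exponentially decaying integrals *)

Section exponential_decay.
Variable R : realType.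
Local Notation mu := (@lebesgue_measure R).

Lemma continuous_exp_abs (nu : R) : continuous (fun x : R => expR (- (nu * `|x|))).
Proof.
move=> x; apply: continuous_comp; last exact: continuous_expR.
apply: continuousN; apply: continuousM; first exact: cst_continuous.
exact: norm_continuous.
Qed.

(** Symmetry reduces to the half-line, where nu times the function is the exponential density. *)
Lemma integrable_exp_abs (nu : R) : 0 < nu ->
  mu.-integrable setT (fun x => (expR (- (nu * `|x|)))%:E).
Proof.
move=> nu0.
have mg : measurable_fun [set: R] (EFin \o (fun x : R => expR (- (nu * `|x|)))).
  apply/measurable_EFinP; apply: continuous_measurable_fun.
  exact: continuous_exp_abs.
apply/integrableP; split => //.
have -> : (\int[mu]_x `|(expR (- (nu * `|x|)))%:E|)%E =
    (\int[mu]_x (expR (- (nu * `|x|)))%:E)%E.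
  by apply: eq_integral => x _; rewrite abse_EFin ger0_norm// expR_ge0.
rewrite ge0_symfun_integralT; first last.
- by move=> x /=; rewrite normrN.
- exact: continuous_exp_abs.
- by move=> x; exact: expR_ge0.
have mE : measurable [set x : R | 0 <= x] by rewrite -set_itvcy.
have Ipdf : mu.-integrable setT (fun x => (exponential_pdf nu x)%:E).
  apply/integrableP; split.
    by apply/measurable_EFinP; exact: measurable_exponential_pdf.
  have -> : (\int[mu]_x `|(exponential_pdf nu x)%:E|)%E =
      (\int[mu]_x (exponential_pdf nu x)%:E)%E.
    by apply: eq_integral => x _; rewrite abse_EFin ger0_norm// exponential_pdf_ge0// ltW.
  by rewrite integral_exponential_pdf// ltry.
have IE : mu.-integrable [set x : R | 0 <= x] (fun x => (expR (- (nu * `|x|)))%:E).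
  have Ig : mu.-integrable [set x : R | 0 <= x]
      (fun x => ((nu^-1)%:E * (exponential_pdf nu x)%:E)%E).
    by apply: integrableZl => //; apply: integrableS Ipdf.
  apply: (le_integrable _ _ _ Ig); first exact: mE.
  - exact: measurable_funS mg.
  - move=> x /= x0; rewrite exponential_pdfE// lee_fin ger0_norm ?expR_ge0//.
    rewrite mulrA mulVf ?gt_eqF// mul1r (ger0_norm x0) mulNr.
    by rewrite ger0_norm ?expR_ge0.
rewrite lte_mul_pinfty//.
exact: integrable_lty.
Qed.

(** The decay rate is split in two: for |s| >= T one half of it produces the small factor, the other
    half keeps the integral finite. *)
Lemma integral_tail (f : R -> R) (C nu T : R) (D : set R) : 0 < nu -> 0 <= C ->
  measurable D -> continuous f ->
  (forall s, `|f s| <= C * expR (- (nu * `|s|))) -> (forall s, D s -> T <= `|s|) ->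
  `|Rintegral mu D f| <=
    expR (- (nu / 2 * T)) * (C * Rintegral mu setT (fun s => expR (- (nu / 2 * `|s|)))).
Proof.
move=> nu0 C0 mD cf Hf DT.
have nu20 : 0 < nu / 2 by rewrite divr_gt0.
have mf : measurable_fun D f.
  by apply: measurable_funS (continuous_measurable_fun cf).
have Ih := integrable_exp_abs nu20.
pose c := expR (- (nu / 2 * T)) * C.
have c0 : 0 <= c by rewrite mulr_ge0 ?expR_ge0.
pose g (s : R) := c * expR (- (nu / 2 * `|s|)).
have Ig : mu.-integrable setT (EFin \o g).
  have -> : EFin \o g = (fun x => (c%:E * (expR (- (nu / 2 * `|x|)))%:E)%E) by [].
  exact: integrableZl.
have IgD : mu.-integrable D (EFin \o g) by apply: integrableS Ig.
have fg s : D s -> `|f s| <= g s.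
  move=> Ds; apply: le_trans (Hf s) _; rewrite /g /c mulrAC -expRD mulrC.
  rewrite ler_wpM2r// ler_expR -opprD lerN2 -mulrDr.
  have /= := DT s Ds; have -> : nu * `|s| = nu / 2 * (`|s| + `|s|) by field.
  by move=> ?; rewrite ler_wpM2l ?lerD2r// ltW.
have If : mu.-integrable D (EFin \o f).
  apply: (le_integrable _ _ _ IgD); first exact: mD.
    exact/measurable_EFinP.
  by move=> s Ds /=; rewrite lee_fin (le_trans (fg s Ds))// ler_norm.
apply: le_trans (le_normr_Rintegral _ If) _ => //.
apply: (@le_trans _ _ (Rintegral mu D g)).
  apply: le_Rintegral => //.
  apply: (le_integrable _ _ _ If); first exact: mD.
    by apply/measurable_EFinP; exact: measurableT_comp.
  by move=> s Ds /=; rewrite normr_id.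
rewrite mulrA -/c -RintegralZl//.
rewrite /Rintegral fine_le//.
- exact: integrable_fin_num.
- exact: integrable_fin_num.
apply: ge0_subset_integral => //.
  by apply: (measurable_int mu).
by move=> s _; rewrite lee_fin mulr_ge0// expR_ge0.
Qed.

(** Trades the improper integral for a primitive, which is all that estimates on [0, T] can see.
    With F the integral from minus infinity, [F T - F (- T)] misses exactly the two tails beyond T
    in absolute value. *)
Lemma decaying_integral (f : R -> R) (C nu : R) : 0 < nu -> 0 <= C ->
  continuous f -> (forall s, `|f s| <= C * expR (- (nu * `|s|))) ->
  mu.-integrable setT (fun s => (f s)%:E) /\
  exists (F : R -> R) (C' : R), [/\ 0 <= C',
    forall s, is_derive s (1 : R) F (f s) &
    forall T, 0 <= T ->
      `|Rintegral mu setT f - (F T - F (- T))| <= C' * expR (- (nu / 2 * T))].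
Proof.
move=> nu0 C0 cf Hf.
have mf : measurable_fun setT f by exact: continuous_measurable_fun.
have If : mu.-integrable setT (EFin \o f).
  have Ig : mu.-integrable setT (fun s => (C%:E * (expR (- (nu * `|s|)))%:E)%E).
    by apply: integrableZl => //; exact: integrable_exp_abs.
  apply: (le_integrable _ _ _ Ig); first exact: measurableT.
  - exact/measurable_EFinP.
  - move=> s _ /=; rewrite lee_fin (le_trans (Hf s))//.
    exact: ler_norm.
split => //.
pose F x := Rintegral mu `]-oo, x] f.
pose J := Rintegral mu setT (fun s => expR (- (nu / 2 * `|s|))).
have J0 : 0 <= J by apply: Rintegral_ge0 => s _; exact: expR_ge0.
exists F, (2 * (C * J)); split.
- by rewrite !mulr_ge0.
- move=> s.
  have [] := @continuous_FTC1 R f -oo%O s (s + 1) _ _ _ (cf s).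
  + by rewrite ltrDl.
  + by apply: integrableS If.
  + by rewrite ltNyr.
  by move=> dF; rewrite derive1E => E; split.
move=> T T0.
have EB : Rintegral mu setT f - F T = Rintegral mu `]T, +oo[ f.
  have := @Rintegral_itvB R f -oo%O +oo%O T.
  by rewrite set_itvNyy => ->.
rewrite opprB addrCA addrC EB.
have t1 := @integral_tail f C nu T `]T, +oo[ nu0 C0 (measurable_itv _) cf Hf.
have t2 := @integral_tail f C nu T `]-oo, (- T)] nu0 C0 (measurable_itv _) cf Hf.
have -> : 2 * (C * J) * expR (- (nu / 2 * T)) =
  expR (- (nu / 2 * T)) * (C * J) + expR (- (nu / 2 * T)) * (C * J) by ring.
apply: le_trans (ler_normD _ _) _; apply: lerD.
  apply: t1 => s /=; rewrite in_itv /= andbT => /ltW Ts.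
  by rewrite (le_trans Ts)// ler_norm.
apply: t2 => s /=; rewrite in_itv /= => sT.
by rewrite -normrN (le_trans _ (ler_norm _))// lerNr.
Qed.

End exponential_decay.

(** * The half-line estimate *)

(** The growing bound [u * exp (s L)] and the decaying bound [exp (- nu s)] cross where s (L + nu) =
    - ln u, and there both equal u to the power nu / (L + nu). Before the crossing the first bound
    suffices, after it the second. *)
Lemma interpolation (R : realType) (L nu s u a : R) : 0 < L -> 0 < nu -> 0 < u ->
  a <= u * expR (s * L) -> a <= expR (- (nu * s)) -> a <= u `^ (nu / (L + nu)).
Proof.
move=> L0 nu0 u0 h1 h2.
have Ln : 0 < L + nu by rewrite addr_gt0.
pose l := ln u; have El : u = expR l by rewrite lnK.
rewrite /powR gt_eqF// -/l.
have [sl|sl] := leP (s * (L + nu)) (- l).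
  apply: le_trans h1 _; rewrite El -expRD ler_expR.
  rewrite -(ler_pM2r Ln) (mulrAC _ l) divfK ?gt_eqF//.
  by move: sl L0 nu0; rewrite /l; set k := ln u; nra.
apply: le_trans h2 _; rewrite ler_expR -(ler_pM2r Ln) (mulrAC _ l) divfK ?gt_eqF//.
by move: sl L0 nu0; rewrite /l; set k := ln u; nra.
Qed.

Lemma norm_triangle (R : realType) (W : normedModType R) (a b c : W) (p q : R) :
  a = b + c -> `|b| <= p -> `|c| <= q -> `|a| <= p + q.
Proof. by move=> -> hb hc; apply: le_trans (ler_normD _ _) _; exact: lerD. Qed.

(** A continuation argument: the speed is controlled only within distance r of the start, but at
    that speed the curve cannot travel r by time S. The factor 2 makes the barrier strict. *)
Lemma bounded_drift (R : realType) (W : normedModType R) (S eta r : R)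
    (g dg : R -> W) : 0 < eta -> eta * 2 * S < r ->
  (forall s : R, 0 <= s <= S -> is_derive s (1 : R) g (dg s)) ->
  (forall s : R, 0 <= s <= S -> `|g s - g 0| < r -> `|dg s| <= eta) ->
  forall s : R, 0 <= s <= S -> `|g s - g 0| <= eta * 2 * s.
Proof.
move=> eta0 etaS Hg Hdg.
apply: (@barrier _ _ S (fun s => g s - g 0) dg (fun s => eta * 2 * s) (fun=> eta * 2)).
- move=> s sS; rewrite -[X in is_derive _ _ X _]/(g - cst (g 0)) -[dg s]subr0.
  by apply: is_deriveB; first [exact: Hg | exact: is_derive_cst].
- move=> s _; rewrite -[X in is_derive _ _ _ X]mulr1.
  exact: (@is_deriveZ _ _ _ id).
- by rewrite subrr normr0 mulr0.
- move=> s /andP[s0 sS] gs; apply: (@le_lt_trans _ _ eta); last by lra.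
  apply: Hdg; first by rewrite s0 ltW.
  apply: le_lt_trans gs _; apply: le_lt_trans etaS.
  by rewrite ler_wpM2l ?mulr_ge0// ltW.
Qed.

Lemma mean_value_from0 (R : realType) (W : normedModType R) (S M s : R)
    (f df : R -> W) :
  (forall s : R, 0 <= s <= S -> is_derive s (1 : R) f (df s)) ->
  (forall s : R, 0 <= s <= S -> `|df s| <= M) ->
  0 <= s <= S -> `|f s - f 0| <= M * s.
Proof.
move=> Hf HM /andP[s0 sS].
have H t : 0 <= t <= s -> 0 <= t <= S.
  by move=> /andP[-> ts]; rewrite (le_trans ts).
by apply: (mean_value_norm s0) => t /H; [exact: Hf | exact: HM].
Qed.

Lemma ext_field_fst (R : realType) n d (X0 : phase R n d -> phase R n d)
    (X1 : phase R n d -> R -> R -> phase R n d) eps w :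
  (ext_field X0 X1 eps w).1 = X0 w.1 + eps *: X1 w.1 w.2 eps.
Proof. by []. Qed.

Lemma ext_field_snd (R : realType) n d (X0 : phase R n d -> phase R n d)
    (X1 : phase R n d -> R -> R -> phase R n d) eps w :
  (ext_field X0 X1 eps w).2 = 1.
Proof. by []. Qed.

Lemma is_derive_scale (R : realType) (W : normedModType R) (c s : R) (f : R -> W) df :
  is_derive s (1 : R) f df ->
  is_derive s (1 : R) (fun x => (c * x) *: f x) (c *: f s + (c * s) *: df).
Proof.
move=> Hf; apply: approx_is_derive => eta eta0.
have k0 : 0 < `|c * s| + `|c| + 1 by rewrite ltr_wpDl// addr_ge0.
pose eta' := eta / (`|c * s| + `|c| + 1).
have eta'0 : 0 < eta' by rewrite divr_gt0.
have [e1 e10 H1] := is_derive_approx Hf eta'0.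
have [e2 e20 H2] := is_derive_continuous Hf eta'0.
exists (Num.min e1 e2); first by rewrite lt_min e10.
move=> h; rewrite lt_min => /andP[/H1 {}H1 /H2 {}H2].
have -> : (c * (s + h)) *: f (s + h) - (c * s) *: f s - h *: (c *: f s + (c * s) *: df) =
    (c * s) *: (f (s + h) - f s - h *: df) + (h * c) *: (f (s + h) - f s).
  rewrite mulrDr scalerDl scalerDr opprD !scalerBr !scalerA mulrA.
  by rewrite [h * c]mulrC [c * s * h]mulrAC [c * h * s]mulrAC (AC (3*2) (1*3*5*(2*4))).
apply: le_trans (ler_normD _ _) _.
rewrite [`|(c * s) *: _|]normrZ [`|(h * c) *: _|]normrZ.
have -> : eta = (`|c * s| + `|c| + 1) * eta' by rewrite mulrC divfK// gt_eqF.
have h1 : `|c * s| * `|f (s + h) - f s - h *: df| <= `|c * s| * (eta' * `|h|).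
  by rewrite ler_wpM2l.
have h2 : `|h * c| * `|f (s + h) - f s| <= `|h * c| * eta' by rewrite ler_wpM2l.
apply: le_trans (lerD h1 h2) _; rewrite [`|h * c|]normrM.
have : 0 <= eta' * `|h| by rewrite mulr_ge0// ltW.
lra.
Qed.

(** * Comparison of perturbed and unperturbed orbits on [0, T] *)

Section half_line.
Variables (R : realType) (n d : nat).
Variables (X0 : phase R n d -> phase R n d)
  (X1 : phase R n d -> R -> R -> phase R n d)
  (freq : 'rV[R]_d -> 'rV[R]_d) (hess : 'M[R]_d) (I0 : 'rV[R]_d).
Variables (eps0 delta M nu : R).

(** Only p and q are given global Lipschitz bounds. The angular velocity is a function of the
    actions, controlled near [I0] alone by [tame_frequency]. *)
Definition tame_field : Prop :=
  [/\ (forall z, act (X0 z) = 0) /\ (forall z, ang (X0 z) = freq (act z)),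
      forall z w, meq z w -> X0 z = X0 w,
      forall z w, `|mom (X0 z) - mom (X0 w)| <= M * `|z - w|
    & forall z w, `|pos (X0 z) - pos (X0 w)| <= M * `|z - w| ].

Definition tame_perturbation : Prop :=
  [/\ forall z w t eps, meq z w -> X1 z t eps = X1 w t eps,
      forall z t eps, `|eps| < eps0 -> `|X1 z t eps| <= M
    & forall (w w' : ephase R n d) eps eps', `|eps| < eps0 -> `|eps'| < eps0 ->
        `|X1 w'.1 w'.2 eps' - X1 w.1 w.2 eps| <= M * (`|w' - w| + `|eps' - eps|) ].

Definition tame_frequency : Prop :=
  (forall r I1 I2, r < delta -> `|I1 - I0| <= r -> `|I2 - I0| <= r ->
    `|freq I1 - freq I2 - (I1 - I2) *m hess| <= M * r * `|I1 - I2|) /\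
  (forall v : 'rV[R]_d, `|v *m hess| <= M * `|v|).

Hypotheses (M1 : 1 <= M) (delta1 : delta <= 1) (nu0 : 0 < nu) (eps00 : 0 < eps0).
Hypotheses (HX0 : tame_field) (HX1 : tame_perturbation) (Hfreq : tame_frequency).

Let M0 : 0 <= M. Proof. by apply: le_trans M1. Qed.

(** Periodicity moves the shift m onto w0. The factor [2 * M] is due to the angles: the frequency
    differs from its value at [I0] by at most [M * r + M] times the action distance, and r < 1. *)
Lemma field_difference (eps r : R) (w w0 m : ephase R n d) : `|eps| < eps0 ->
  r < delta -> lattice_shift m -> act w0.1 = I0 -> `|act w.1 - I0| <= r ->
  `|ext_field X0 X1 eps w - ext_field X0 X1 0 w0| <=
     2 * M * `|w - w0 - m| + `|eps| * M.
Proof.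
move=> eps_lt rd Hm Ew0 Iw.
have [[act0 ang0] per momL posL] := HX0.
have [_ X1M _] := HX1.
have [fexp hM] := Hfreq.
have r0 : 0 <= r by apply: le_trans Iw.
pose w0' := w0 + m.
have E0 : X0 w0.1 = X0 w0'.1 by apply: per; case: (teq_addr w0 Hm).
have Ew : w - w0 - m = w - w0' by rewrite opprD addrA.
set N := `|w - w0 - m|.
have N0 : 0 <= N by exact: normr_ge0.
have N1 : `|w.1 - w0'.1| <= N by rewrite /N Ew -fst_sub fst_norm.
have NI : `|act w.1 - I0| <= N.
  apply: le_trans N1; rewrite -Ew0.
  have -> : act w0.1 = act w0'.1.
    by rewrite /w0' fst_add act_add; case: Hm => _ _ -> _ _; rewrite addr0.
  by rewrite -act_sub norm_act.
have eX : `|eps *: X1 w.1 w.2 eps| <= `|eps| * M.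
  by rewrite normrZ ler_wpM2l// X1M.
have dX0 : `|X0 w.1 - X0 w0'.1| <= 2 * M * N.
  have MN : M * N <= 2 * M * N by rewrite ler_wpM2r// ler_peMl// ler1n.
  have MN1 : M * `|w.1 - w0'.1| <= M * N by rewrite ler_wpM2l.
  apply: phase_norm_le; rewrite phaseE.
  - exact: le_trans (momL _ _) (le_trans MN1 MN).
  - exact: le_trans (posL _ _) (le_trans MN1 MN).
  - by rewrite !act0 subrr normr0 !mulr_ge0.
  - rewrite -E0 !ang0 Ew0.
    have F := fexp r (act w.1) I0 rd Iw (ltac:(by rewrite subrr normr0)).
    have := norm_triangle (esym (subrK _ _)) F (hM _).
    move=> /le_trans; apply.
    have : M * r * `|act w.1 - I0| <= M * N.
      have Mr : M * r <= M by rewrite ler_piMr// (le_trans (ltW rd)).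
      by apply: ler_pM => //; rewrite mulr_ge0.
    have : M * `|act w.1 - I0| <= M * N by rewrite ler_wpM2l.
    lra.
apply: pair_norm_le; rewrite !pairE ?ext_field_fst ?ext_field_snd.
  rewrite scale0r addr0 E0 addrAC.
  by apply: norm_triangle (erefl _) _ _.
by rewrite subrr normr0 addr_ge0 ?mulr_ge0.
Qed.

Lemma perturbation_difference (eps eps' : R) (w w' m : ephase R n d) :
  `|eps| < eps0 -> `|eps'| < eps0 -> lattice_shift m ->
  `|X1 w'.1 w'.2 eps' - X1 w.1 w.2 eps| <= M * (`|w' - w - m| + `|eps' - eps|).
Proof.
move=> he he' Hm; have [per _ L] := HX1.
have [mw tw] := teq_addr w Hm.
rewrite (per w.1 (w + m).1)// tw.
have -> : w' - w - m = w' - (w + m) by rewrite opprD addrA.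
exact: L.
Qed.

(** [x] and [y] stand for the perturbed orbits of the homoclinic point and of its foot point, [x0]
    and [y0] for their unperturbed counterparts. Time is multiplied by [sigma], which is 1 or -1, so
    that increasing s always leads towards the invariant manifold. *)
Variables (sigma eps T : R) (x y x0 y0 : R -> ephase R n d).
Local Notation e := (`|eps|).
Local Notation tau := (1 + T).
Local Notation L := (2 * M + 1).

Hypotheses (sigma1 : `|sigma| = 1) (eps_neq0 : 0 < e) (eps_lt : e < eps0) (eps1 : e <= 1)
  (T0 : 0 <= T).
Hypothesis Hx : forall s : R, 0 <= s <= T ->
  is_derive s (1 : R) x (sigma *: ext_field X0 X1 eps (x s)).
Hypothesis Hy : forall s : R, 0 <= s <= T ->
  is_derive s (1 : R) y (sigma *: ext_field X0 X1 eps (y s)).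
Hypothesis Hx0 : forall s : R, 0 <= s <= T ->
  is_derive s (1 : R) x0 (sigma *: ext_field X0 X1 0 (x0 s)).
Hypothesis Hy0 : forall s : R, 0 <= s <= T ->
  is_derive s (1 : R) y0 (sigma *: ext_field X0 X1 0 (y0 s)).
Hypothesis Ix0 : forall s : R, 0 <= s <= T -> act (x0 s).1 = I0.
Hypothesis Iy0 : forall s : R, 0 <= s <= T -> act (y0 s).1 = I0.
Hypothesis Hxy : forall s : R, 0 <= s <= T -> close (M * expR (- (nu * s))) (y s) (x s).
Hypothesis Hxy0 : forall s : R, 0 <= s <= T -> close (M * expR (- (nu * s))) (y0 s) (x0 s).
Hypothesis HT : expR (- (nu * T)) <= e ^+ 2.
Hypothesis Hinit : close (M * e) (x 0) (x0 0).
Hypothesis Hmom : `|mom (y 0).1| <= M * e.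
Hypothesis Hpos : exists2 k, lattice k & `|pos (y 0).1 - k| <= M * e.
Hypothesis Hy00 : [/\ mom (y0 0).1 = 0, lattice (pos (y0 0).1),
  lattice (ang (x0 0).1 - ang (y0 0).1) & (y0 0).2 = (x0 0).2].
Hypothesis small : 5 * M * e * tau < delta.

Let e0 : 0 <= e. Proof. exact: ltW. Qed.
Let tau1 : 1 <= tau. Proof. by rewrite lerDl. Qed.
Let tau0 : 0 <= tau. Proof. exact: le_trans tau1. Qed.
Let inT0 : 0 <= (0 : R) <= T. Proof. by rewrite lexx. Qed.
Let inTT : 0 <= T <= T. Proof. by rewrite lexx T0. Qed.
Let Me0 : 0 <= M * e. Proof. by rewrite mulr_ge0. Qed.
Let eT : e <= e * tau. Proof. by rewrite ler_peMr. Qed.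
Let eTT : e * tau <= e * tau ^+ 2.
Proof. by rewrite ler_wpM2l// expr2 ler_peMr. Qed.
Let norm_sigmaZ (W : normedModType R) (v : W) : `|sigma *: v| = `|v|.
Proof. by rewrite normrZ sigma1 mul1r. Qed.
Let endMe2 : M * expR (- (nu * T)) <= M * e ^+ 2.
Proof. by rewrite ler_wpM2l. Qed.
Let e2e : M * e ^+ 2 <= M * e.
Proof. by rewrite ler_wpM2l// expr2 ler_piMr. Qed.

Lemma derive_action (g : R -> ephase R n d) s :
  is_derive s (1 : R) g (sigma *: ext_field X0 X1 eps (g s)) ->
  is_derive s (1 : R) (fun s => act (g s).1)
    ((sigma * eps) *: act (X1 (g s).1 (g s).2 eps)).
Proof.
move=> /is_derive_act; rewrite fst_scale phaseE ext_field_fst !phaseE.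
by have [[-> _] _ _ _] := HX0; rewrite add0r scalerA.
Qed.

Lemma derive_angle (g : R -> ephase R n d) s :
  is_derive s (1 : R) g (sigma *: ext_field X0 X1 eps (g s)) ->
  is_derive s (1 : R) (fun s => ang (g s).1)
    (sigma *: (freq (act (g s).1) + eps *: ang (X1 (g s).1 (g s).2 eps))).
Proof.
move=> /is_derive_ang; rewrite fst_scale phaseE ext_field_fst !phaseE.
by have [[_ ->] _ _ _] := HX0.
Qed.

Lemma action_drift (g : R -> ephase R n d) s :
  (forall s : R, 0 <= s <= T -> is_derive s (1 : R) g (sigma *: ext_field X0 X1 eps (g s))) ->
  0 <= s <= T -> `|act (g s).1 - act (g 0).1| <= M * e * T.
Proof.
move=> Hg sT.
apply: (@le_trans _ _ (M * e * s)); last by rewrite ler_wpM2l//; case/andP: sT.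
apply: (mean_value_from0 (S := T) (fun t tT => derive_action (Hg t tT))) => // t tT.
rewrite normrZ normrM sigma1 mul1r mulrC; apply: ler_wpM2r => //.
by apply: le_trans (norm_act _) _; have [_ + _] := HX1; apply.
Qed.

Lemma action_x s : 0 <= s <= T -> `|act (x s).1 - I0| <= M * e * tau.
Proof.
move=> sT.
have [m [_ _ am _ _] Em] := Hinit.
have h : `|act (x 0).1 - I0| <= M * e.
  rewrite -(Ix0 inT0); apply: le_trans Em.
  apply: le_trans (fst_norm _); apply: le_trans (norm_act _).
  by rewrite !pairE !phaseE am subr0.
have := norm_triangle (esym (subrKA _ _ _)) (action_drift Hx sT) h.
by rewrite mulrDr mulr1 [M * e + _]addrC.
Qed.

Lemma final_shift : exists2 m, lattice_shift m & `|y T - x T - m| <= M * e ^+ 2.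
Proof.
exact: close_le endMe2 (Hxy inTT).
Qed.

(** The gap is at most M e^2 at time T. Going from T back to s through time 0, each of the two
    actions makes two drifts of size M e T, whence four in all. *)
Lemma action_gap s : 0 <= s <= T -> `|act (y s).1 - act (x s).1| <= 4 * (M * e * tau).
Proof.
move=> sT.
have [m [_ _ am _ _] Em] := final_shift.
have h : `|act (y T).1 - act (x T).1| <= M * e ^+ 2.
  apply: le_trans Em; apply: le_trans (fst_norm _); apply: le_trans (norm_act _).
  by rewrite !pairE !phaseE am subr0.
have hx := action_drift Hx sT; have hxT := action_drift Hx inTT.
have hy := action_drift Hy sT; have hyT := action_drift Hy inTT.
move: h hx hxT hy hyT.
set a := act _; set b := act _; set a' := act (x s).1; set b' := act (x 0).1.
set c' := act (y s).1; set d' := act (y 0).1 => h hx hxT hy hyT.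
have -> : c' - a' = (a - b) + ((b - b') - (a' - b')) - ((a - d') - (c' - d')).
  by apply/rowP => j; rewrite !mxE; ring.
apply: le_trans (ler_normB _ _) _.
have h1 := le_trans (ler_normB (b - b') (a' - b')) (lerD hxT hx).
have h2 := le_trans (ler_normB (a - d') (c' - d')) (lerD hyT hy).
have h3 := le_trans (ler_normD (a - b) _) (lerD h h1).
apply: le_trans (lerD h3 h2) _.
by move: e2e Me0; lra.
Qed.

(** The gap of 4 plus the distance 1 of [x] from [I0]; this is the source of the constant 5 in
    [small]. *)
Lemma action_y s : 0 <= s <= T -> `|act (y s).1 - I0| <= 5 * M * e * tau.
Proof.
move=> sT; have := norm_triangle (esym (subrKA _ _ _)) (action_gap sT) (action_x sT).
by have -> : 4 * (M * e * tau) + M * e * tau = 5 * M * e * tau by ring.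
Qed.

Lemma frequency_gap s : 0 <= s <= T ->
  `|freq (act (y s).1) - freq (act (x s).1) - (act (y s).1 - act (x s).1) *m hess|
     <= 20 * M ^+ 3 * (e * tau) ^+ 2.
Proof.
move=> sT; have [fexp _] := Hfreq.
have hx : `|act (x s).1 - I0| <= 5 * M * e * tau.
  apply: le_trans (action_x sT) _.
  have : 0 <= M * e * tau by rewrite mulr_ge0.
  lra.
apply: le_trans (fexp _ _ _ small (action_y sT) hx) _.
have := action_gap sT; set g := `|_|.
have : 0 <= M * (5 * M * e * tau) by rewrite !mulr_ge0.
by move=> p /(ler_wpM2l p) /le_trans; apply; lra.
Qed.

Lemma angle_gap_rough s : 0 <= s <= T ->
  `|freq (act (y s).1) - freq (act (x s).1)| <= 8 * M ^+ 2 * (e * tau).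
Proof.
move=> sT; have [fexp hM] := Hfreq.
have hx : `|act (x s).1 - I0| <= 5 * M * e * tau.
  apply: le_trans (action_x sT) _.
  have : 0 <= M * e * tau by rewrite mulr_ge0.
  lra.
have F := fexp _ _ _ small (action_y sT) hx.
apply: le_trans (norm_triangle (esym (subrK _ _)) F (hM _)) _.
have := action_gap sT; set g := `|_| => Hg.
have g0 : 0 <= g by exact: normr_ge0.
have : M * (5 * M * e * tau) * g <= M * g.
  by rewrite ler_wpM2r// ler_piMr// (le_trans (ltW small)).
have : M * g <= M * (4 * (M * e * tau)) by rewrite ler_wpM2l.
lra.
Qed.

Lemma perturbation_le z t : `|X1 z t eps| <= M.
Proof. by have [_ + _] := HX1; apply. Qed.

(** Integration backwards from T. The frequencies contribute 8 and the perturbation 2 to the speed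
    of the angle gap, which acts for a time T; the terminal gap adds 1. *)
Lemma initial_angle_gap m : lattice_shift m -> `|y T - x T - m| <= M * e ^+ 2 ->
  `|ang (y 0).1 - ang (x 0).1 - ang m.1| <= 11 * M ^+ 2 * (e * tau ^+ 2).
Proof.
move=> Hm Em.
pose g s := ang (y s).1 - ang (x s).1 - ang m.1.
have gT : `|g T| <= M * e ^+ 2.
  apply: le_trans Em; apply: le_trans (fst_norm _); apply: le_trans (norm_ang _).
  by rewrite !pairE !phaseE.
have MM : M <= M ^+ 2 by rewrite expr2 ler_peMr.
have D : `|g T - g 0| <= 10 * M ^+ 2 * (e * tau) * T.
  apply: (mean_value_from0 (S := T)
    (fun t tT => is_derive_subC (ang m.1) (derive_angle (Hy tT)) (derive_angle (Hx tT)))) => //.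
  move=> t tT; rewrite -scalerBr norm_sigmaZ opprD addrACA -scalerBr.
  apply: le_trans (ler_normD _ _) _.
  have F := angle_gap_rough tT.
  have : `|eps *: (ang (X1 (y t).1 (y t).2 eps) - ang (X1 (x t).1 (x t).2 eps))| <= e * (2 * M).
    rewrite normrZ ler_wpM2l// mulr2n mulrDl mul1r; apply: le_trans (ler_normB _ _) _.
    by apply: lerD; apply: le_trans (norm_ang _) (perturbation_le _ _).
  have : e * M <= e * tau * M ^+ 2 by apply: ler_pM.
  lra.
have -> : ang (y 0).1 - ang (x 0).1 - ang m.1 = g T - (g T - g 0) by rewrite opprB subrKC.
apply: le_trans (ler_normB _ _) _.
have : M * e ^+ 2 <= M ^+ 2 * (e * tau ^+ 2).
  apply: le_trans e2e _; apply: ler_pM => //.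
  exact: le_trans eT eTT.
have : M ^+ 2 * (e * tau) * T <= M ^+ 2 * (e * tau ^+ 2).
  have -> : M ^+ 2 * (e * tau ^+ 2) = M ^+ 2 * (e * tau) * tau by ring.
  by rewrite ler_wpM2l ?lerDr// !mulr_ge0// exprn_ge0.
move: gT D; lra.
Qed.

Lemma trajectory_x s : 0 <= s <= T -> exists2 m, lattice_shift m &
  `|x s - x0 s - m| <= 2 * M * e * expR (s * L).
Proof.
move=> sT; have [m Hm Em] := Hinit.
exists m => //.
(* Twice the initial error, so that the forcing [e * M] lies strictly below it. *)
apply: (@gronwall _ _ T (2 * M * e) (2 * M) (e * M) (fun s => x s - x0 s - m)
  (fun s => sigma *: ext_field X0 X1 eps (x s) - sigma *: ext_field X0 X1 0 (x0 s))) => //.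
- by rewrite mulr_ge0.
- have : 0 < M * e by rewrite mulr_gt0// (lt_le_trans ltr01).
  by rewrite [e * M]mulrC Me0 /=; lra.
- by move=> t tT; apply: is_derive_subC; [exact: Hx | exact: Hx0].
- apply: le_trans Em _; move: Me0; lra.
- move=> t /andP[t0 tT] _; rewrite -scalerBr norm_sigmaZ.
  have tI : 0 <= t <= T by rewrite t0 ltW.
  apply: (@field_difference _ (M * e * tau)) => //; first last.
  + exact: action_x.
  + exact: Ix0.
  + apply: le_lt_trans small; have : 0 <= M * e * tau by rewrite mulr_ge0.
    lra.
Qed.

(** The initial error is assembled by component: p and q from the position of the manifold, the
    action from [action_y], the angle from [initial_angle_gap], the time from time T. The angle is
    the worst with 11 + 1; 13 leaves room for it. *)
Lemma trajectory_y s : 0 <= s <= T -> exists2 m, lattice_shift m &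
  `|y s - y0 s - m| <= 13 * M ^+ 2 * (e * tau ^+ 2) * expR (s * L).
Proof.
move=> sT.
have [mx Hmx init_x] := Hinit.
have [mT HmT EmT] := final_shift.
have [k Hk Ek] := Hpos.
have [mom0 pos0 ang0 t0] := Hy00.
have A := initial_angle_gap HmT EmT.
(* The angular shifts add up along the chain from [y] to [x] at time T, from [x] to [x0] at time 0,
   and from [x0] to [y0]. *)
pose a := ang mT.1 + ang mx.1 + (ang (x0 0).1 - ang (y0 0).1).
pose m : ephase R n d := (0, k - pos (y0 0).1, 0, a, 0).
have Hm : lattice_shift m.
  split => //; first exact: lattice_sub.
  by apply: lattice_add => //; apply: lattice_add; [case: HmT | case: Hmx].
have MM : M <= M ^+ 2 by rewrite expr2 ler_peMr.
have Mt : M * e <= M ^+ 2 * (e * tau ^+ 2).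
  by apply: ler_pM => //; exact: le_trans eT eTT.
have Met : M * e * tau <= M ^+ 2 * (e * tau ^+ 2).
  by rewrite -mulrA; apply: ler_pM => //; rewrite mulr_ge0.
have B0 : 0 <= M ^+ 2 * (e * tau ^+ 2) by exact: le_trans Mt.
exists m => //.
apply: (@gronwall _ _ T (13 * M ^+ 2 * (e * tau ^+ 2)) (2 * M) (e * M)
  (fun s => y s - y0 s - m)
  (fun s => sigma *: ext_field X0 X1 eps (y s) - sigma *: ext_field X0 X1 0 (y0 s))) => //.
- by rewrite mulr_ge0.
- have : 0 < M * e by rewrite mulr_gt0// (lt_le_trans ltr01).
  by rewrite [e * M]mulrC Me0 /=; move: Mt; lra.
- by move=> t tT; apply: is_derive_subC; [exact: Hy | exact: Hy0].
- apply: pair_norm_le; last first.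
    (* Both clocks run at the same speed, so their difference at time 0 is the one at time T. *)
    have D (g : R -> ephase R n d) eps' :
        (forall s : R, 0 <= s <= T -> is_derive s (1 : R) g (sigma *: ext_field X0 X1 eps' (g s))) ->
        forall s : R, 0 <= s <= T -> is_derive s (1 : R) (fun s => (g s).2) (sigma *: 1).
      by move=> Hg t tT; have := is_derive_snd (Hg t tT); rewrite snd_scale ext_field_snd.
    have := mean_value_from0 (S := T) (M := 0)
      (fun t tT => is_derive_subC 0 (D _ _ Hy t tT) (D _ _ Hx t tT))
      (fun t tT => ltac:(by rewrite subrr normr0)) inTT.
    rewrite mul0r normr_le0 subr_eq0 !subr0 => /eqP E.
    have h1 : `|(y T).2 - (x T).2| <= M * e ^+ 2.
      apply: le_trans EmT; apply: le_trans (snd_norm _); rewrite !pairE.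
      by case: HmT => _ _ _ _ ->; rewrite subr0.
    have h2 : `|(x 0).2 - (x0 0).2| <= M * e.
      apply: le_trans init_x; apply: le_trans (snd_norm _); rewrite !pairE.
      by case: Hmx => _ _ _ _ ->; rewrite subr0.
    rewrite !pairE subr0 t0; rewrite E in h1.
    apply: le_trans (norm_triangle (esym (subrKA _ _ _)) h1 h2) _.
    move: e2e Mt B0; lra.
  rewrite !pairE; apply: phase_norm_le; rewrite !phaseE.
  + rewrite mom0 /mom /= !subr0; apply: le_trans Hmom _; move: Mt B0; lra.
  + rewrite {3}/pos /= opprB addrA subrK.
    apply: le_trans Ek _; move: Mt B0; lra.
  + rewrite (Iy0 inT0) {2}/act /= subr0.
    apply: le_trans (action_y inT0) _; move: Met B0; lra.
  + rewrite {3}/ang /= /a.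
    have h : `|ang (x 0).1 - ang (x0 0).1 - ang mx.1| <= M * e.
      apply: le_trans init_x; apply: le_trans (fst_norm _); apply: le_trans (norm_ang _).
      by rewrite !pairE !phaseE.
    apply: le_trans (norm_triangle _ A h) _; last by move: Mt B0; lra.
    by apply/rowP => j; rewrite !mxE; ring.
- move=> t /andP[t0' tT] _; rewrite -scalerBr norm_sigmaZ.
  have tI : 0 <= t <= T by rewrite t0' ltW.
  apply: (@field_difference _ (5 * M * e * tau)) => //.
  + exact: Iy0.
  + exact: action_y.
Qed.

(** The second difference is bounded in two ways. Pairing each orbit with its unperturbed one gives
    e tau^2 exp (s L); pairing the homoclinic orbit with its foot-point orbit gives exp (- nu s).
    Interpolation removes s. *)
Lemma perturbation_gap s : 0 <= s <= T ->
  `|X1 (y s).1 (y s).2 eps - X1 (x s).1 (x s).2 eps -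
    (X1 (y0 s).1 (y0 s).2 0 - X1 (x0 s).1 (x0 s).2 0)|
  <= 17 * M ^+ 3 * (e * tau ^+ 2) `^ (nu / (L + nu)).
Proof.
move=> sT.
have eps00' : `|0 : R| < eps0 by rewrite normr0.
have M30 : 0 < 17 * M ^+ 3 by rewrite mulr_gt0// exprn_gt0// (lt_le_trans ltr01).
have etau0 : 0 < e * tau ^+ 2 by rewrite mulr_gt0// exprn_gt0// (lt_le_trans ltr01).
have exp1 : 1 <= expR (s * L).
  rewrite -[X in X <= _]expR0 ler_expR mulr_ge0//; first by case/andP: sT.
  by rewrite addr_ge0// mulr_ge0.
set a := `|_|.
rewrite -ler_pdivrMl//.
have L0 : 0 < L by rewrite ltr_wpDl// mulr_ge0.
apply: (interpolation (s := s)) => //; rewrite ler_pdivrMl//.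
- have [mx Hmx Ex] := trajectory_x sT.
  have [my Hmy Ey] := trajectory_y sT.
  have dx := @perturbation_difference 0 eps (x0 s) (x s) mx eps00' eps_lt Hmx.
  have dy := @perturbation_difference 0 eps (y0 s) (y s) my eps00' eps_lt Hmy.
  rewrite subr0 in dx dy.
  (* 17 = 14 + 3: the distance of orbits and the change of the parameter in the perturbation cost 13
     + 1 for the foot point and 2 + 1 for the homoclinic point. *)
  have -> : 17 * M ^+ 3 * (e * tau ^+ 2 * expR (s * L)) =
    14 * M ^+ 3 * (e * tau ^+ 2 * expR (s * L)) + 3 * M ^+ 3 * (e * tau ^+ 2 * expR (s * L)).
    by ring.
  have u1 : e <= e * tau ^+ 2 * expR (s * L).
    by apply: le_trans (le_trans eT eTT) _; rewrite ler_peMr// ltW.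
  have MM : M <= M ^+ 3 by rewrite exprS ler_peMr// expr2 mulr_ege1.
  have u2 : M * e <= M ^+ 3 * (e * tau ^+ 2 * expR (s * L)) by apply: ler_pM.
  apply: (@norm_triangle _ _ _
    (X1 (y s).1 (y s).2 eps - X1 (y0 s).1 (y0 s).2 0)
    (- (X1 (x s).1 (x s).2 eps - X1 (x0 s).1 (x0 s).2 0))).
  + by rewrite !opprB addrACA [RHS]addrACA; congr (_ + _); rewrite addrC.
  + apply: le_trans dy _; rewrite mulrDr.
    have -> : 14 * M ^+ 3 * (e * tau ^+ 2 * expR (s * L)) =
      M * (13 * M ^+ 2 * (e * tau ^+ 2) * expR (s * L)) +
      M ^+ 3 * (e * tau ^+ 2 * expR (s * L)) by ring.
    by apply: lerD => //; rewrite ler_wpM2l.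
  + rewrite normrN; apply: le_trans dx _; rewrite mulrDr.
    have -> : 3 * M ^+ 3 * (e * tau ^+ 2 * expR (s * L)) =
      2 * M ^+ 3 * (e * tau ^+ 2 * expR (s * L)) +
      M ^+ 3 * (e * tau ^+ 2 * expR (s * L)) by ring.
    apply: lerD => //.
    apply: (@le_trans _ _ (M * (2 * M * e * expR (s * L)))); first by rewrite ler_wpM2l.
    have -> : M * (2 * M * e * expR (s * L)) = 2 * M ^+ 2 * (e * expR (s * L)) by ring.
    apply: ler_pM; rewrite ?mulr_ge0 ?exprn_ge0 ?expR_ge0//.
      by rewrite ler_wpM2l// [leRHS]exprSr ler_peMr// exprn_ge0.
    by rewrite ler_wpM2r ?expR_ge0// (le_trans eT).
- have [my Hmy Ey] := Hxy sT; have [m0 Hm0 E0] := Hxy0 sT.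
  have d1 := @perturbation_difference eps eps (x s) (y s) my eps_lt eps_lt Hmy.
  have d2 := @perturbation_difference 0 0 (x0 s) (y0 s) m0 eps00' eps00' Hm0.
  rewrite subrr normr0 addr0 in d1; rewrite subrr normr0 addr0 in d2.
  apply: le_trans (ler_normB _ _) _; apply: le_trans (lerD d1 d2) _.
  have h1 := ler_wpM2l M0 Ey; have h2 := ler_wpM2l M0 E0.
  apply: le_trans (lerD h1 h2) _.
  have -> : M * (M * expR (- (nu * s))) + M * (M * expR (- (nu * s))) =
    2 * M ^+ 2 * expR (- (nu * s)) by ring.
  apply: ler_wpM2r; first exact: expR_ge0.
  apply: ler_pM; rewrite ?exprn_ge0 ?ler_nat//.
  by rewrite [leRHS]exprSr ler_peMr// exprn_ge0.
Qed.

(** The constant 22 is 1 + 1 for the boundary terms at T, where angles and actions differ by O(e^2),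
    plus 20 for the quadratic remainder of the frequency; the interpolated term takes only 17. *)
Lemma half_line_angle (Q : R -> 'rV[R]_d) :
  (forall s : R, 0 <= s <= T -> is_derive s (1 : R) Q
     (ang (X1 (y0 s).1 (y0 s).2 0 - X1 (x0 s).1 (x0 s).2 0) - (sigma * s) *:
       (act (X1 (y0 s).1 (y0 s).2 0 - X1 (x0 s).1 (x0 s).2 0) *m hess))) ->
  exists2 k : 'rV[R]_d, lattice k &
    `|ang (y 0).1 - ang (x 0).1 - k + (sigma * eps) *: (Q T - Q 0)| <=
      22 * M ^+ 4 * (e ^+ 2 * tau ^+ 3 + e * tau ^+ 2 * (e * tau ^+ 2) `^ (nu / (L + nu))).
Proof.
move=> HQ.
have [m Hm Em] := final_shift.
have [_ hM] := Hfreq.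
have HA : `|ang (y T).1 - ang (x T).1 - ang m.1| <= M * e ^+ 2.
  apply: le_trans Em; apply: le_trans (fst_norm _); apply: le_trans (norm_ang _).
  by rewrite !pairE !phaseE.
have HI : `|act (y T).1 - act (x T).1| <= M * e ^+ 2.
  apply: le_trans Em; apply: le_trans (fst_norm _); apply: le_trans (norm_act _).
  by rewrite !pairE !phaseE; case: Hm => _ _ -> _ _; rewrite subr0.
exists (ang m.1); first by case: Hm.
set P := _ `^ _; have P0 : 0 <= P by exact: powR_ge0.
pose DI s := act (y s).1 - act (x s).1.
(* The weighted action term vanishes at 0 and is T O(e^2) at T. Up to terms at T, [- (G T - G 0)] is
   therefore the initial angle gap plus the increment of [(sigma * eps) *: Q]. *)
pose G s := ang (y s).1 - ang (x s).1 - (sigma * s) *: (DI s *m hess) - (sigma * eps) *: Q s.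
pose dDI s := (sigma * eps) *: act (X1 (y s).1 (y s).2 eps) -
  (sigma * eps) *: act (X1 (x s).1 (x s).2 eps).
pose A s := X1 (y s).1 (y s).2 eps - X1 (x s).1 (x s).2 eps.
pose A0 s := X1 (y0 s).1 (y0 s).2 0 - X1 (x0 s).1 (x0 s).2 0.
(* The product rule for the weighted action term yields [- sigma *: (DI s *m hess)], which cancels
   the linear part of the frequency difference; [Q] replaces the perturbed integrand [A] by the
   difference [A - A0]. *)
pose dG s := sigma *: (freq (act (y s).1) - freq (act (x s).1) - DI s *m hess) +
  (sigma * eps) *: (ang (A s - A0 s) - (sigma * s) *: (act (A s - A0 s) *m hess)).
have HG s : 0 <= s <= T -> is_derive s (1 : R) G (dG s).
  move=> sT.
  have HDI : is_derive s (1 : R) (fun s => DI s *m hess) (dDI s *m hess).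
    apply: (@is_derive_linear _ _ _ (fun v : 'rV[R]_d => v *m hess) M).
    - by move=> a u v; rewrite mulmxDl scalemxAl.
    - exact: hM.
    rewrite -[dDI s]subr0; have := is_derive_subC 0 (derive_action (Hy sT)) (derive_action (Hx sT)).
    by under eq_fun do rewrite subr0; rewrite subr0.
  have HQ' : is_derive s (1 : R) (fun s => (sigma * eps) *: Q s)
      ((sigma * eps) *: (ang (A0 s) - (sigma * s) *: (act (A0 s) *m hess))).
    exact: (@is_deriveZ _ _ _ Q (sigma * eps) _ _ _ (HQ _ sT)).
  have H1 := is_deriveB (derive_angle (Hy sT)) (derive_angle (Hx sT)).
  have H2 := is_deriveB (is_deriveB H1 (is_derive_scale sigma HDI)) HQ'.
  apply: (@is_derive_eq _ _ _ _ _ _ _ _ H2).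
  have -> : dDI s *m hess = (sigma * eps) *: (act (X1 (y s).1 (y s).2 eps) *m hess -
      act (X1 (x s).1 (x s).2 eps) *m hess).
    by rewrite /dDI -scalerBr -scalemxAl mulmxBl.
  rewrite /dG /A !(act_sub, ang_sub) !mulmxBl.
  set a1 := act (X1 _ _ eps) *m hess; set a2 := act (X1 (x s).1 _ eps) *m hess.
  set a3 := act (A0 s) *m hess; set a4 := DI s *m hess.
  by apply/rowP => j; rewrite !mxE; ring.
have bG s : 0 <= s <= T ->
    `|dG s| <= 20 * M ^+ 3 * (e * tau) ^+ 2 + e * (17 * M ^+ 4 * tau * P).
  move=> sT; apply: le_trans (ler_normD _ _) _; apply: lerD.
    by rewrite norm_sigmaZ; exact: frequency_gap.
  have gap := perturbation_gap sT; rewrite -/(A s) -/(A0 s) -/P in gap.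
  rewrite normrZ normrM sigma1 mul1r ler_wpM2l//.
  apply: le_trans (ler_normB _ _) _.
  have g1 : `|ang (A s - A0 s)| <= 17 * M ^+ 3 * P by exact: le_trans (norm_ang _) gap.
  have g2 : `|(sigma * s) *: (act (A s - A0 s) *m hess)| <= T * (M * (17 * M ^+ 3 * P)).
    rewrite normrZ normrM sigma1 mul1r; have [s0 sT'] := andP sT.
    apply: ler_pM => //; first by rewrite ger0_norm.
    by apply: le_trans (hM _) _; rewrite ler_wpM2l// (le_trans (norm_act _)).
  apply: le_trans (lerD g1 g2) _.
  have : M ^+ 3 * P <= M ^+ 4 * P by rewrite ler_wpM2r// [leRHS]exprSr ler_peMr// exprn_ge0.
  lra.
have D := mean_value_from0 HG bG inTT.
have -> : ang (y 0).1 - ang (x 0).1 - ang m.1 + (sigma * eps) *: (Q T - Q 0) =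
    ang (y T).1 - ang (x T).1 - ang m.1 - (sigma * T) *: (DI T *m hess) - (G T - G 0).
  rewrite /G mulr0 scale0r; set a1 := DI T *m hess.
  by apply/rowP => j; rewrite !mxE; ring.
apply: le_trans (ler_normB _ _) _.
have h2 : `|(sigma * T) *: (DI T *m hess)| <= T * (M * (M * e ^+ 2)).
  rewrite normrZ normrM sigma1 mul1r (ger0_norm T0); apply: ler_wpM2l => //.
  by apply: le_trans (hM _) _; rewrite ler_wpM2l.
apply: le_trans (lerD (le_trans (ler_normB _ _) (lerD HA h2)) D) _.
have M4 k : (k <= 4)%N -> M ^+ k <= M ^+ 4 by move=> k4; apply: ler_weXn2l.
have t3 k : (k <= 3)%N -> tau ^+ k <= tau ^+ 3 by move=> k3; apply: ler_weXn2l.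
have e20 : 0 <= e ^+ 2 by exact: exprn_ge0.
have M40 : 0 <= M ^+ 4 by exact: exprn_ge0.
have q1 : M * e ^+ 2 <= M ^+ 4 * (e ^+ 2 * tau ^+ 3).
  apply: ler_pM => //; first by rewrite -[X in X <= _]expr1 M4.
  by rewrite ler_peMr// exprn_ege1.
have q2 : T * (M * (M * e ^+ 2)) <= M ^+ 4 * (e ^+ 2 * tau ^+ 3).
  have -> : T * (M * (M * e ^+ 2)) = M ^+ 2 * (e ^+ 2 * T) by ring.
  apply: ler_pM; rewrite ?mulr_ge0 ?exprn_ge0//; first exact: M4.
  apply: ler_wpM2l => //; apply: le_trans (t3 1%N _) => //.
  by rewrite expr1 lerDr.
have q3 : M ^+ 3 * (e * tau) ^+ 2 * T <= M ^+ 4 * (e ^+ 2 * tau ^+ 3).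
  have -> : M ^+ 3 * (e * tau) ^+ 2 * T = M ^+ 3 * (e ^+ 2 * (tau ^+ 2 * T)) by ring.
  apply: ler_pM; rewrite ?mulr_ge0 ?exprn_ge0//; first exact: M4.
  by apply: ler_wpM2l => //; rewrite [leRHS]exprSr ler_wpM2l ?exprn_ge0// lerDr.
have q4 : e * (M ^+ 4 * tau * P) * T <= M ^+ 4 * (e * tau ^+ 2 * P).
  have -> : e * (M ^+ 4 * tau * P) * T = M ^+ 4 * (e * (tau * T) * P) by ring.
  apply: ler_wpM2l => //; apply: ler_wpM2r => //; apply: ler_wpM2l => //.
  by rewrite expr2 ler_wpM2l// lerDr.
have q5 : 0 <= M ^+ 4 * (e * tau ^+ 2 * P) by rewrite !mulr_ge0 ?exprn_ge0.
move: q1 q2 q3 q4 q5; lra.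
Qed.

End half_line.

(* With the time horizon [T = -(8/nu) ln e], powers of [1 + T] are absorbed by
   arbitrarily small powers of [e]. *)
Lemma log_horizon_bound (R : realType) (nu th : R) : 0 < nu -> 0 < th < 1 ->
  exists2 C : R, 0 <= C & forall e : R, 0 < e <= 1 ->
    let tau := 1 + 8 / nu * - ln e in
    e * tau <= C * e `^ 2^-1 /\
    e ^+ 2 * tau ^+ 3 + e * tau ^+ 2 * (e * tau ^+ 2) `^ th <= C * e `^ (1 + th / 2).
Proof.
move=> nu0 /andP[th0 th1].
(* The slack ka per factor tau is chosen so that (1 - 2 ka) (1 + th) >= 1 + th / 2, which for ka =
   th / 8 amounts to th <= 1. *)
pose ka := th / 8; have ka0 : 0 < ka by rewrite divr_gt0.
pose K := 1 + 8 / nu / ka.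
have nk0 : 0 <= 8 / nu by rewrite divr_ge0// ltW.
have K1 : 1 <= K by rewrite lerDl divr_ge0// ltW.
have K0 : 0 <= K by exact: le_trans K1.
exists (K ^+ 3 + K ^+ 4); first by rewrite addr_ge0// exprn_ge0.
move=> e /andP[e0 e1] tau.
have en0 : e != 0 by rewrite gt_eqF.
have p0 a : 0 <= e `^ a by exact: powR_ge0.
have pD a b : e `^ a * e `^ b = e `^ (a + b) by rewrite powRD// en0 implybT.
have pI a b : b <= a -> e `^ a <= e `^ b by move=> ab; rewrite ger_powR// e0.
have pe : e = e `^ 1 by rewrite powRr1// ltW.
have l0 : 0 <= - ln e by rewrite oppr_ge0 ln_le0.
have tau0 : 0 <= tau by rewrite addr_ge0// mulr_ge0.
(* This is 1 + x <= exp x at x = ka (- ln e). *)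
have tauK : tau <= K * e `^ (- ka).
  have h : ka * - ln e + 1 <= e `^ (- ka).
    by rewrite /powR (negbTE en0) mulNr -mulrN addrC expR_ge1Dx.
  have q0 : 0 <= ka * - ln e by rewrite mulr_ge0// ltW.
  have Et : tau = 1 + 8 / nu / ka * (ka * - ln e).
    by rewrite /tau mulrA divfK// gt_eqF.
  have EK : K * e `^ (- ka) = e `^ (- ka) + 8 / nu / ka * e `^ (- ka) by rewrite /K; ring.
  rewrite Et EK; apply: lerD; first by move: h q0; lra.
  by apply: ler_wpM2l; [rewrite divr_ge0// ltW | move: h; lra].
have tauX k : tau ^+ k <= K ^+ k * e `^ (- ka * k%:R).
  by rewrite powRrM powR_mulrn ?powR_ge0// -exprMn lerXn2r// nnegrE mulr_ge0.
have KX k l : (k <= l)%N -> K ^+ k <= K ^+ l by move=> kl; exact: ler_weXn2l.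
have Kn k : 0 <= K ^+ k by exact: exprn_ge0.
split.
  apply: (@le_trans _ _ (K ^+ 3 * e `^ 2^-1)); last by rewrite ler_wpM2r// lerDl.
  apply: (@le_trans _ _ (e * (K * e `^ (- ka)))); first by rewrite ler_wpM2l// ltW.
  rewrite mulrCA {1}pe pD; apply: ler_pM => //; first by rewrite -[leLHS]expr1 KX.
  by apply: pI; rewrite /ka; move: th0 th1; lra.
rewrite mulrDl; apply: lerD.
  apply: (@le_trans _ _ (e ^+ 2 * (K ^+ 3 * e `^ (- ka * 3%:R)))).
    by rewrite ler_wpM2l ?exprn_ge0 ?(ltW e0).
  rewrite mulrCA ler_wpM2l// {1}pe expr2 !pD; apply: pI.
  by rewrite /ka; move: th0 th1; lra.
have h1 : e * tau ^+ 2 <= K ^+ 2 * e `^ (1 - 2 * ka).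
  apply: (@le_trans _ _ (e * (K ^+ 2 * e `^ (- ka * 2%:R)))).
    by rewrite ler_wpM2l ?(ltW e0).
  rewrite mulrCA ler_wpM2l// {1}pe pD; apply: pI; lra.
have et0 : 0 <= e * tau ^+ 2 by rewrite mulr_ge0 ?exprn_ge0// ltW.
have h2 : (e * tau ^+ 2) `^ th <= K ^+ 2 * e `^ ((1 - 2 * ka) * th).
  apply: (@le_trans _ _ ((K ^+ 2 * e `^ (1 - 2 * ka)) `^ th)).
    by apply: ge0_ler_powR => //; rewrite ?(ltW th0)// nnegrE mulr_ge0.
  rewrite powRM// -powRrM ler_wpM2r//.
  rewrite -[leRHS]powRr1//; apply: ler_powR; last exact: ltW.
  by rewrite exprn_ege1.
apply: (@le_trans _ _ (K ^+ 2 * e `^ (1 - 2 * ka) * (K ^+ 2 * e `^ ((1 - 2 * ka) * th)))).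
  by apply: ler_pM => //; exact: powR_ge0.
rewrite mulrACA pD -exprD ler_wpM2l//; apply: pI.
by rewrite /ka; move: th0 th1; nra.
Qed.

(** Local radii around the points of K become uniform by halving them and using compactness. The
    margin lets an orbit drift slightly off the ball of actions and still follow the given field. *)
Lemma compact_margin (R : realType) (V : normedModType R) (K O : set V) :
  compact K -> open O -> K `<=` O ->
  exists2 delta : R, 0 < delta & forall x y, K x -> `|y - x| < delta -> O y.
Proof.
move=> cK oO KO.
have : \forall r \near (0:R)^'+, K `<=` (fun x => forall y, `|y - x| < r -> O y).
  have /compact_near_coveringP := cK; apply => x Kx.
  have /nbhs_ballP[r /= r0 Hr] : nbhs x O by apply: open_nbhs_nbhs; split => //; exact: KO.
  exists (ball x (r / 2), [set s | s < r / 2]).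
    split => /=; first by apply: nbhsx_ballx; rewrite divr_gt0.
    by apply: nbhs_right_lt; rewrite divr_gt0.
  move=> [x' s] /= [xx' sr] y yx'; apply: Hr.
  move: xx'; rewrite -ball_normE /= => xx'.
  have -> : x - y = (x - x') - (y - x') by rewrite opprB addrA subrK.
  apply: le_lt_trans (ler_normB _ _) _; move: xx' yx' sr; set a := `|_|; set b := `|_|; lra.
move=> H.
have [r [/= r0 Hr]] : exists r : R, 0 < r /\ K `<=` (fun x => forall y, `|y - x| < r -> O y).
  apply: (@filter_ex _ (0:R)^'+); apply: filterI; last exact: H.
  exact: nbhs_right_gt.
by exists r => // x y Kx; exact: Hr.
Qed.

Lemma eball_compact (R : realType) d (c : 'rV[R]_d) rad : compact (eball c rad).
Proof.
apply: bounded_closed_compact.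
  exists (`|c| + `|rad|); split; first exact: num_real.
  move=> M HM I HI; apply: le_trans (ltW HM).
  rewrite -[I](subrK c) addrC; apply: le_trans (ler_normD _ _) _.
  rewrite lerD2l; apply: row_norm_le => // j.
  rewrite -(@ler_pXn2r _ 2) ?nnegrE// -!normrX !ger0_norm ?sqr_ge0//.
  apply: le_trans HI; rewrite (bigD1 j)//= !mxE lerDl.
  by apply: sumr_ge0 => i _; exact: sqr_ge0.
have -> : eball c rad = (fun I : 'rV[R]_d => \sum_(j < d) (I 0 j - c 0 j) ^+ 2) @^-1`
    [set x | x <= rad ^+ 2] by [].
have /continuous_closedP : continuous (fun I : 'rV[R]_d => \sum_(j < d) (I 0 j - c 0 j) ^+ 2).
  apply: continuous_big => [|j _ J]; first exact: add_continuous.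
  have cj : {for J, continuous (fun J : 'rV[R]_d => J 0 j - c 0 j)}.
    by apply: continuousB; [exact: coord_continuous | exact: cst_continuous].
  exact: (continuousM cj cj).
by apply; exact: closed_le.
Qed.

(** * The half-line estimate along the extended flow, as eps tends to 0 *)

Section half_line_asymptotics.
Variables (R : realType) (n d : nat).
Variables (X0 : phase R n d -> phase R n d)
  (X1 : phase R n d -> R -> R -> phase R n d)
  (freq : 'rV[R]_d -> 'rV[R]_d) (hess : 'M[R]_d) (I0 : 'rV[R]_d).
Variables (eps0 delta M nu sigma : R).
Variables (Y : R -> ephase R n d -> ephase R n d)
  (Psi : R -> R -> ephase R n d -> ephase R n d)
  (D O : set 'rV[R]_d) (z zq : R -> ephase R n d) (x0 y0 : R -> ephase R n d).
Local Notation L := (2 * M + 1).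
Local Notation th := (nu / (L + nu)).

Hypotheses (M1 : 1 <= M) (delta0 : 0 < delta) (delta1 : delta <= 1) (nu0 : 0 < nu)
  (eps00 : 0 < eps0) (sigma1 : `|sigma| = 1).
Hypotheses (HX0 : tame_field X0 freq M) (HX1 : tame_perturbation X1 eps0 M)
  (Hfreq : tame_frequency freq hess I0 delta M).
Hypothesis Hflow : forall eps, `|eps| < eps0 -> is_flow (Y eps) (Psi eps).
Hypothesis HO : forall I J, D I -> `|J - I| < delta -> O J.
Hypothesis HY : forall eps w, `|eps| < eps0 -> O (act w.1) ->
  Y eps w = ext_field X0 X1 eps w.
Hypothesis DI0 : D I0.
Hypothesis Hz : forall eps, `|eps| < eps0 -> close (M * `|eps|) (z eps) (x0 0).
Hypothesis Hq_act : forall eps, 0 < `|eps| < eps0 ->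
  exists2 I, D I & `|act (zq eps).1 - I| <= M * `|eps|.
Hypothesis Hq_mom : forall eps, 0 < `|eps| < eps0 -> `|mom (zq eps).1| <= M * `|eps|.
Hypothesis Hq_pos : forall eps, 0 < `|eps| < eps0 ->
  exists2 k, lattice k & `|pos (zq eps).1 - k| <= M * `|eps|.
Hypothesis Hdecay : forall eps s, `|eps| < eps0 -> 0 <= s ->
  close (M * expR (- (nu * s))) (Psi eps (sigma * s) (zq eps)) (Psi eps (sigma * s) (z eps)).
Hypothesis Hx0 : forall s : R, 0 <= s ->
  is_derive s (1 : R) x0 (sigma *: ext_field X0 X1 0 (x0 s)).
Hypothesis Hy0 : forall s : R, 0 <= s ->
  is_derive s (1 : R) y0 (sigma *: ext_field X0 X1 0 (y0 s)).
Hypothesis Ix0 : forall s : R, 0 <= s -> act (x0 s).1 = I0.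
Hypothesis Iy0 : forall s : R, 0 <= s -> act (y0 s).1 = I0.
Hypothesis Hxy0 : forall s : R, 0 <= s -> close (M * expR (- (nu * s))) (y0 s) (x0 s).
Hypothesis Hy00 : [/\ mom (y0 0).1 = 0, lattice (pos (y0 0).1),
  lattice (ang (x0 0).1 - ang (y0 0).1) & (y0 0).2 = (x0 0).2].

Let M0 : 0 <= M. Proof. exact: le_trans M1. Qed.

Lemma is_derive_time_change eps w s : `|eps| < eps0 ->
  is_derive s (1 : R) (fun s => Psi eps (sigma * s) w)
    (sigma *: Y eps (Psi eps (sigma * s) w)).
Proof.
move=> he; have [_ H] := Hflow he w.
have := @is_derive_affine _ _ (fun s => Psi eps s w) sigma 0 s _ (H _).
by rewrite add0r; under eq_fun do rewrite add0r.
Qed.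

(* The actions drift at speed O(eps), so up to times T with eps T small the
   orbit stays in the region where the extended system is the given one. *)
Lemma solves_given_system eps w I (T : R) : 0 < `|eps| < eps0 -> `|eps| <= 1 ->
  D I -> `|act w.1 - I| <= M * `|eps| -> 5 * M * `|eps| * (1 + T) < delta -> 0 <= T ->
  forall s : R, 0 <= s <= T -> is_derive s (1 : R) (fun s => Psi eps (sigma * s) w)
    (sigma *: ext_field X0 X1 eps (Psi eps (sigma * s) w)).
Proof.
move=> /andP[e0 he] e1 DI wI small T0 s sT.
pose g t := act (Psi eps (sigma * t) w).1.
have g0 : g 0 = act w.1 by rewrite /g mulr0; have [-> _] := Hflow he w.
have Me0 : 0 < `|eps| * M by rewrite mulr_gt0// (lt_le_trans ltr01).
have MeT : 0 <= `|eps| * M * T by rewrite mulr_ge0// ltW.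
have near_O t : `|g t - g 0| < delta - `|eps| * M -> O (g t).
  move=> h; apply: (HO DI).
  have := norm_triangle (esym (subrKA _ _ _)) (lexx `|g t - g 0|) (lexx `|g 0 - I|).
  move=> /le_lt_trans; apply; rewrite g0 in h *.
  by move: h wI; rewrite [`|eps| * M]mulrC; lra.
have Dg t : is_derive t (1 : R) g (act (sigma *: Y eps (Psi eps (sigma * t) w)).1).
  exact/is_derive_act/is_derive_time_change.
have drift t : 0 <= t <= T -> `|g t - g 0| <= `|eps| * M * 2 * t.
  apply: (@bounded_drift _ _ T (`|eps| * M) (delta - `|eps| * M) g) => // [|u _ hu].
    by move: small MeT Me0; rewrite [5 * M * _]mulrAC -mulrA; lra.
  rewrite HY//; last exact: near_O.
  rewrite fst_scale ext_field_fst !phaseE.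
  have [[-> _] _ _ _] := HX0; rewrite add0r !normrZ sigma1 mul1r ler_wpM2l//.
  by apply: le_trans (norm_act _) _; have [_ + _] := HX1; apply.
rewrite -HY//; first exact: is_derive_time_change.
apply: near_O; apply: le_lt_trans (drift s sT) _.
have : `|eps| * M * 2 * s <= `|eps| * M * 2 * T.
  by rewrite ler_wpM2l ?mulr_ge0// ?(ltW Me0)//; case/andP: sT.
by move: small MeT Me0; rewrite [5 * M * _]mulrAC -mulrA; lra.
Qed.

(** Chooses the horizon as a function of eps: long enough for the decay to reach eps^2, short enough
    for [eps * T] to remain small, so that the drifting actions stay where the extended system is
    the given one. *)
Lemma half_line_asymptotics (Q : R -> 'rV[R]_d) :
  (forall s : R, 0 <= s -> is_derive s (1 : R) Q
     (ang (X1 (y0 s).1 (y0 s).2 0 - X1 (x0 s).1 (x0 s).2 0) - (sigma * s) *: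
       (act (X1 (y0 s).1 (y0 s).2 0 - X1 (x0 s).1 (x0 s).2 0) *m hess))) ->
  exists C eps1 : R, [/\ 0 <= C, 0 < eps1 & forall eps, 0 < `|eps| < eps1 ->
    exists2 k : 'rV[R]_d, lattice k &
    `|ang (zq eps).1 - ang (z eps).1 - k +
       (sigma * eps) *: (Q (8 / nu * - ln `|eps|) - Q 0)| <= C * `|eps| `^ (1 + th / 2)].
Proof.
move=> HQ.
have L0 : 0 < L by rewrite ltr_wpDl// mulr_ge0.
have th01 : 0 < th < 1.
  have Ln : 0 < L + nu by rewrite addr_gt0.
  apply/andP; split; first exact: divr_gt0.
  by rewrite ltr_pdivrMr// mul1r ltrDr.
have [C C0 HC] := log_horizon_bound nu0 th01.
(* For |eps| < eta^2 the quantity 5 M |eps| (1 + T) is at most 5 M C |eps|^(1/2), which is below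
   delta. *)
pose eta := delta / (5 * M * C + 1).
have den0 : 0 < 5 * M * C + 1 by rewrite ltr_wpDl// !mulr_ge0.
have eta0 : 0 < eta by rewrite divr_gt0.
exists (22 * M ^+ 4 * C), (Num.min 1 (Num.min eps0 (eta ^+ 2))); split.
- by rewrite !mulr_ge0// exprn_ge0.
- by rewrite !lt_min ltr01 eps00 exprn_gt0.
move=> eps /andP[e0]; rewrite !lt_min => /and3P[/ltW e1 he eeta].
have e01 : 0 < `|eps| <= 1 by rewrite e0.
have [small bound] := HC `|eps| e01.
pose T := 8 / nu * - ln `|eps|; rewrite -/T in small bound *.
have T0 : 0 <= T.
  by rewrite mulr_ge0 ?divr_ge0 ?(ltW nu0)// oppr_ge0 ln_le0.
have {}small : 5 * M * `|eps| * (1 + T) < delta.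
  have h : `|eps| `^ 2^-1 < eta.
    rewrite -(@ltr_pXn2r _ 2) ?nnegrE ?powR_ge0 ?(ltW eta0)//.
    by rewrite -powR_mulrn ?powR_ge0// -powRrM mulVf ?pnatr_eq0// powRr1.
  have -> : 5 * M * `|eps| * (1 + T) = 5 * M * (`|eps| * (1 + T)) by ring.
  have M5 : 0 <= 5 * M by rewrite mulr_ge0.
  apply: le_lt_trans (ler_wpM2l M5 small) _; rewrite mulrA.
  have Ed : delta = 5 * M * C * eta + eta.
    by rewrite -[X in _ + X]mul1r -mulrDl mulrC divfK// gt_eqF.
  rewrite Ed; apply: (@le_lt_trans _ _ (5 * M * C * eta)).
    by rewrite ler_wpM2l ?(ltW h)// mulr_ge0.
  by rewrite ltrDl.
(* The left side is |eps|^8. The factor 8 in T is dictated by the tails of the integrals, which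
   decay only at rate nu / 4. *)
have expT : expR (- (nu * T)) <= `|eps| ^+ 2.
  have -> : - (nu * T) = 8%:R * ln `|eps|.
    by rewrite /T mulrA mulrCA divff ?gt_eqF// mulr1 mulrN opprK.
  rewrite mulrC expRM_natr lnK ?posrE//.
  by rewrite (_ : 8 = 2 + 6)%N// exprD ler_piMr ?exprn_ge0// exprn_ile1.
have e0lt : 0 < `|eps| < eps0 by rewrite e0.
have z0E : Psi eps (sigma * 0) (z eps) = z eps by rewrite mulr0; have [-> _] := Hflow he (z eps).
have zq0E : Psi eps (sigma * 0) (zq eps) = zq eps.
  by rewrite mulr0; have [-> _] := Hflow he (zq eps).
have Iz : `|act (z eps).1 - I0| <= M * `|eps|.
  have [m [_ _ am _ _] Em] := Hz he; rewrite -(Ix0 (lexx 0)); apply: le_trans Em.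
  apply: le_trans (fst_norm _); apply: le_trans (norm_act _).
  by rewrite !pairE !phaseE am subr0.
have [Iq DIq Hq] := Hq_act e0lt.
have init_z : close (M * `|eps|) (Psi eps (sigma * 0) (z eps)) (x0 0).
  by rewrite z0E; exact: Hz.
have init_mom : `|mom (Psi eps (sigma * 0) (zq eps)).1| <= M * `|eps|.
  by rewrite zq0E; exact: Hq_mom.
have init_pos : exists2 k, lattice k & `|pos (Psi eps (sigma * 0) (zq eps)).1 - k| <= M * `|eps|.
  by rewrite zq0E; exact: Hq_pos.
have [k Hk Ek] := @half_line_angle R n d X0 X1 freq hess I0 eps0 delta M nu M1 delta1 nu0
  eps00 HX0 HX1 Hfreq sigma eps T
  (fun s => Psi eps (sigma * s) (z eps)) (fun s => Psi eps (sigma * s) (zq eps)) x0 y0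
  sigma1 e0 he e1 T0
  (solves_given_system e0lt e1 DI0 Iz small T0)
  (solves_given_system e0lt e1 DIq Hq small T0)
  (fun s sT => Hx0 (proj1 (andP sT))) (fun s sT => Hy0 (proj1 (andP sT)))
  (fun s sT => Ix0 (proj1 (andP sT))) (fun s sT => Iy0 (proj1 (andP sT)))
  (fun s sT => Hdecay he (proj1 (andP sT))) (fun s sT => Hxy0 (proj1 (andP sT)))
  expT init_z init_mom init_pos Hy00 small Q
  (fun s sT => HQ s (proj1 (andP sT))).
exists k => //; rewrite z0E zq0E in Ek.
apply: le_trans Ek _; rewrite -[leRHS]mulrA; apply: ler_wpM2l => //.
by rewrite mulr_ge0// exprn_ge0.
Qed.

End half_line_asymptotics.

(** * The extended flow *)

Lemma row_norm_sub_le (R : realType) k (u v : 'rV[R]_k) (b : R) : 0 <= b ->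
  (forall j, `|u 0 j - v 0 j| <= b) -> `|u - v| <= b.
Proof. by move=> b0 H; apply: row_norm_le => // j; rewrite !mxE; exact: H. Qed.

(** The constant is given as a threshold, here and in the next two conditions, so that all of them
    can share a single M. *)
Lemma rotator_pendulum_tame (R : realType) n d (h0 : 'rV[R]_d -> R)
    (sg : 'I_n -> bool) (V : 'I_n -> R -> R) :
  Ck 3 setT h0 -> (forall i, Ck 2 setT (V i)) ->
  (forall i x, V i (x + 1) = V i x) ->
  exists M1 : R, forall M, M1 <= M ->
    tame_field (ham_field (rotator_pendulum h0 sg V)) (frequency h0) M.
Proof.
move=> [dh _] CV per.
have dV i x : derivable (V i) x 1.
  by have [H _] := CV i; apply: diff_derivable; exact: H.
have E z : ham_field (rotator_pendulum h0 sg V) z =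
  (\row_i - ((-1) ^+ sg i * derive1 (V i) (pos z 0 i)),
   \row_i ((-1) ^+ sg i * mom z 0 i), 0, frequency h0 (act z)).
  by apply: ham_field_rotator_pendulum => // I; exact: dh.
have /choice[L HL] : forall i, exists L : R, 0 <= L /\
    forall x y, `|derive1 (V i) y - derive1 (V i) x| <= L * `|y - x|.
  by move=> i; have [L L0 HL] := periodic_derive_lipschitz (CV i) (per i); exists L.
have pV i x k : k \is a Num.int -> derive1 (V i) (x + k) = derive1 (V i) x.
  move=> kI; rewrite !derive1E; exact: (periodic_int (derive_periodic (per i))).
have sgn (b : bool) : `|(-1) ^+ b : R| = 1 by rewrite normrX normrN1 expr1n.
exists (1 + \sum_i L i) => M HM.
have L0 : 0 <= \sum_i L i by apply: sumr_ge0 => i _; case: (HL i).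
have M1 : 1 <= M by apply: le_trans HM; rewrite lerDl.
have M0 : 0 <= M by exact: le_trans M1.
have LM i : L i <= M.
  apply: le_trans HM; rewrite (bigD1 i)//= addrCA lerDl addr_ge0// sumr_ge0// => j _.
  by case: (HL j).
split.
- by split => z; rewrite E.
- move=> z w [h1 h2 h3 h4]; rewrite !E h1 h3; congr (_, _, _, _).
  apply/rowP => i; rewrite !mxE; congr (- (_ * _)).
  have -> : pos z 0 i = pos w 0 i + (pos z - pos w) 0 i by rewrite !mxE subrKC.
  exact: pV.
- move=> z w; rewrite !E {1 2}/mom /=; apply: row_norm_sub_le => [|i].
    by rewrite mulr_ge0.
  rewrite !mxE -opprD normrN -mulrN -mulrDr normrM sgn mul1r.
  have [Li0 HLi] := HL i; apply: le_trans (HLi _ _) _.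
  apply: ler_pM => //; apply: le_trans (norm_pos (z - w)); rewrite pos_sub.
  by have := row_norm_ge (pos z - pos w) i; rewrite !mxE.
- move=> z w; rewrite !E {1 2}/pos /=; apply: row_norm_sub_le => [|i].
    by rewrite mulr_ge0.
  rewrite !mxE -mulrBr normrM sgn mul1r.
  apply: (@le_trans _ _ `|z - w|); last by rewrite ler_peMl.
  apply: le_trans (norm_mom (z - w)); rewrite mom_sub.
  by have := row_norm_ge (mom z - mom w) i; rewrite !mxE.
Qed.

Lemma perturbation_tame (R : realType) n d r (eps0 : R)
    (X1 : phase R n d -> R -> R -> phase R n d) : (1 <= r)%N ->
  perturbation r eps0 X1 ->
  exists M1 : R, forall M, M1 <= M -> tame_perturbation X1 eps0 M.
Proof.
move=> r1 [per /(Ck_bounded_weaken r1) HC].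
have co : coordinatized (ephase R n d * R)%type.
  by apply: coordinatized_pair; [exact: coordinatized_ephase | exact: coordinatized_scalar].
have [M1 [M10 HB HL]] := Ck_bounded_lipschitz co (@convex_slab _ _ eps0) HC.
exists M1 => M MM; split => //.
  by move=> z t eps he; apply: le_trans MM; exact: (HB ((z, t), eps)).
move=> w w' eps eps' he he'.
apply: le_trans (HL (w, eps) (w', eps') he he') _.
apply: ler_pM => //; apply: pair_norm_le; rewrite /= ?lerDl ?lerDr//.
Qed.

Lemma mulmx_bound (R : realType) d (A : 'M[R]_d) (v : 'rV[R]_d) :
  `|v *m A| <= (\sum_i \sum_j `|A i j|) * `|v|.
Proof.
apply: row_norm_le => [|j].
  by rewrite mulr_ge0// sumr_ge0// => i _; exact: sumr_ge0.
rewrite mxE mulr_suml; apply: le_trans (ler_norm_sum _ _ _) _.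
apply: ler_sum => i _; rewrite normrM mulrC; apply: ler_pM => //.
  by rewrite (bigD1 j)//= lerDl sumr_ge0.
exact: row_norm_ge.
Qed.

Lemma frequency_tame (R : realType) d (h0 : 'rV[R]_d -> R) I0 : Ck 3 setT h0 ->
  exists M1 delta1 : R, 0 < delta1 /\ forall M delta, M1 <= M -> delta <= delta1 ->
    tame_frequency (frequency h0) (hessian h0 I0) I0 delta M.
Proof.
move=> Hh; have [C [delta1 [C0 d10 H]]] := frequency_expansion I0 Hh.
pose S := \sum_i \sum_j `|hessian h0 I0 i j|.
have S0 : 0 <= S by apply: sumr_ge0 => i _; exact: sumr_ge0.
exists (C + S), delta1; split => // M delta MM dd; split.
  move=> r I1 I2 rd h1 h2; apply: le_trans (H r I1 I2 (lt_le_trans rd dd) h1 h2) _.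
  have r0 : 0 <= r by apply: le_trans h1.
  by rewrite -!mulrA ler_wpM2r ?mulr_ge0// (le_trans _ MM)// lerDl.
move=> v; apply: le_trans (mulmx_bound _ _) _.
by rewrite ler_wpM2r// (le_trans _ MM)// lerDr.
Qed.

Lemma decay_to_zero (R : realType) (nu C a : R) : 0 < nu ->
  (forall s : R, 0 <= s -> a <= C * expR (- (nu * s))) -> a <= 0.
Proof.
move=> nu0 H; rewrite leNgt; apply/negP => a0.
have Ca : a <= C by have := H 0 (lexx 0); rewrite mulr0 oppr0 expR0 mulr1.
have C0 : 0 < C by exact: lt_le_trans Ca.
(* At this time exp (nu s) >= 1 + C / a, so the bound would give a + C <= C. *)
have s0 : 0 <= C / (a * nu) by rewrite divr_ge0 ?mulr_ge0// ltW.
have := H _ s0; rewrite expRN ler_pdivlMr ?expR_gt0//.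
have := expR_ge1Dx (nu * (C / (a * nu))).
have -> : nu * (C / (a * nu)) = C / a by field; rewrite !gt_eqF.
set E := expR _ => h1 h2.
have : a * (1 + C / a) <= a * E by rewrite ler_wpM2l// ltW.
have -> : a * (1 + C / a) = a + C by field; rewrite gt_eqF.
by move: h2 a0; lra.
Qed.

(** The derivative is known to vanish only near the starting value. Allowing it an arbitrarily small
    speed [eta], [bounded_drift] keeps the curve in that neighbourhood and within any prescribed A
    of its start. *)
Lemma constant_of_local (R : realType) (W : normedModType R) (r : R) (f df : R -> W) :
  0 < r -> (forall s, is_derive s (1 : R) f (df s)) ->
  (forall s, `|f s - f 0| < r -> df s = 0) -> forall s, 0 <= s -> f s = f 0.
Proof.
move=> r0 Hf H0 s s0; apply/eqP; rewrite -subr_eq0; apply/eqP.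
apply: (@eq0_of_small _ _ _ 1) => A A0; rewrite mulr1.
have s1 : 0 < 2 * (s + 1) by rewrite mulr_gt0// ltr_wpDl.
pose m := Num.min A r; have m0 : 0 < m by rewrite lt_min A0.
pose eta := m / (2 * (s + 1)); have eta0 : 0 < eta by rewrite divr_gt0.
have etam : eta * 2 * s < m.
  have Em : m = eta * 2 * (s + 1) by rewrite -mulrA divfK// gt_eqF.
  have p : 0 < eta * 2 by rewrite mulr_gt0.
  by rewrite [ltRHS]Em (ltr_pM2l p) ltrDl.
have etar : eta * 2 * s < r by apply: lt_le_trans etam _; rewrite ge_min lexx orbT.
apply: le_trans (bounded_drift eta0 etar (fun t _ => Hf t) _ (s := s) _) _.
- by move=> t _ /H0 ->; rewrite normr0 ltW.
- by rewrite s0 lexx.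
- by apply: le_trans (ltW etam) _; rewrite ge_min lexx.
Qed.

Lemma is_derive_row (R : realType) k (f df : 'I_k -> R -> R) (s : R) :
  (forall j, is_derive s (1 : R) (f j) (df j s)) ->
  is_derive s (1 : R) (fun x => \row_j f j x : 'rV[R]_k) (\row_j df j s).
Proof.
move=> H.
have -> : (fun x => \row_j f j x) = \sum_(j < k) (fun x => f j x *: delta_mx 0 j : 'rV[R]_k).
  apply/funext => x; rewrite fct_sumE [LHS]row_sum_delta.
  by apply: eq_bigr => j _; rewrite mxE.
have -> : \row_j df j s = \sum_(j < k) df j s *: delta_mx 0 j :> 'rV[R]_k.
  by rewrite [LHS]row_sum_delta; apply: eq_bigr => j _; rewrite mxE.
apply: is_derive_sum => j.
apply: (@is_derive_linear R R _ (fun r : R => r *: delta_mx 0 j)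
  `|delta_mx 0 j : 'rV[R]_k| (f j) (df j s)) => //.
  by move=> a u v; rewrite scalerDl scalerA.
by move=> v; rewrite normrZ mulrC.
Qed.

Lemma row_decaying_integral (R : realType) d (f : R -> 'rV[R]_d) (C nu : R) :
  0 < nu -> 0 <= C -> (forall j, continuous (fun s => f s 0 j)) ->
  (forall s, `|f s| <= C * expR (- (nu * `|s|))) ->
  vintegrable f /\ exists (F : R -> 'rV[R]_d) (C' : R), [/\ 0 <= C',
    forall s, is_derive s (1 : R) F (f s) &
    forall T, 0 <= T ->
      `|vintegral f - (F T - F (- T))| <= C' * expR (- (nu / 2 * T))].
Proof.
move=> nu0 C0 cf Hf.
have H j := decaying_integral nu0 C0 (cf j)
  (fun s => le_trans (row_norm_ge (f s) j) (Hf s)).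
split; first by move=> j; have [] := H j.
have /choice[F HF] : forall j, exists F : R -> R, exists C' : R, [/\ 0 <= C',
    forall s, is_derive s (1 : R) F (f s 0 j) &
    forall T, 0 <= T ->
      `|Rintegral lebesgue_measure setT (fun s => f s 0 j) - (F T - F (- T))|
        <= C' * expR (- (nu / 2 * T))].
  by move=> j; have [_] := H j.
have /choice[C' HC'] := HF.
have S0 : 0 <= \sum_j C' j by apply: sumr_ge0 => j _; case: (HC' j).
exists (fun s => \row_j F j s), (\sum_j C' j); split => //.
  move=> s; have -> : f s = \row_j f s 0 j by apply/rowP => j; rewrite mxE.
  by apply: (@is_derive_row _ _ F (fun j s => f s 0 j)) => j; case: (HC' j).
move=> T T0; apply: row_norm_le => [|j]; first by rewrite mulr_ge0 ?expR_ge0.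
rewrite !mxE; have [_ _ /(_ T T0)] := HC' j.
move/le_trans; apply; rewrite ler_wpM2r ?expR_ge0// (bigD1 j)//= lerDl.
by apply: sumr_ge0 => i _; case: (HC' i).
Qed.

Lemma lipschitz_slice (R : realType) (V P W : normedModType R) (f : V * P -> W) x p :
  (exists L delta : R, [/\ 0 <= L, 0 < delta & forall y y',
    `|y - (x, p)| < delta -> `|y' - (x, p)| < delta -> `|f y' - f y| <= L * `|y' - y|]) ->
  exists L delta : R, [/\ 0 <= L, 0 < delta & forall y y',
    `|y - x| < delta -> `|y' - x| < delta -> `|f (y', p) - f (y, p)| <= L * `|y' - y|].
Proof.
have E (u v : V) : `|((u, p) : V * P) - (v, p)| = `|u - v|.
  have -> : ((u, p) : V * P) - (v, p) = (u - v, p - p) by [].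
  by rewrite subrr pair_norm normr0; apply/max_idPl.
move=> [L [delta [L0 delta0 H]]]; exists L, delta; split => // y y' hy hy'.
by rewrite -(E y' y); apply: H; rewrite E.
Qed.

Section extended_flow.
Variables (R : realType) (n d : nat) (eps0 : R) (D : set 'rV[R]_d).
Variables (F Y : R -> ephase R n d -> ephase R n d)
  (Psi : R -> R -> ephase R n d -> ephase R n d).
Hypothesis HY : extended_system eps0 D F Y.
Hypothesis Hflow : forall eps, `|eps| < eps0 -> is_flow (Y eps) (Psi eps).

Lemma extended_system_lipschitz eps : `|eps| < eps0 -> locally_lipschitz (Y eps).
Proof.
move=> he; have [_ _ CY _] := HY.
have co : coordinatized (ephase R n d * R)%type.
  by apply: coordinatized_pair; [exact: coordinatized_ephase | exact: coordinatized_scalar].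
have oS : open (@slab R (ephase R n d) eps0).
  have -> : @slab R (ephase R n d) eps0 =
      (fun x : ephase R n d * R => `|x.2|) @^-1` [set t | t < eps0] by [].
  apply: open_comp; last exact: open_lt.
  move=> x _; apply: continuous_comp; first exact: cvg_snd.
  exact: norm_continuous.
move=> x; have H := Ck_locally_lipschitz co oS CY (he : slab eps0 (x, eps)).
exact: (lipschitz_slice H).
Qed.

(** The flow lives on the cover; that it descends to the torus follows from periodicity of the field
    and uniqueness of orbits. *)
Lemma flow_teq eps s w w' : `|eps| < eps0 -> teq w w' ->
  teq (Psi eps s w) (Psi eps s w').
Proof.
move=> he ww'; have [per _ _ _] := HY.
have [E D'] : (forall v, Psi eps 0 v = v) /\ forall v s,
    is_derive s (1 : R) (fun s' => Psi eps s' v) (Y eps (Psi eps s v)).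
  by split => v; have [] := Hflow he v.
have := curve_unique (per eps) (extended_system_lipschitz he) (D' w) (D' w').
rewrite !E => /(_ (teq_sym ww') s) ->.
by apply: teq_addr; apply/teq_shift/teq_sym.
Qed.

(** Foot points are chosen on lifts; uniqueness of the base point modulo the lattice makes the
    choice compatible with [teq]. *)
Lemma footpoint_teq (Lam : set (ephase R n d))
    (W : ephase R n d -> set (ephase R n d)) Om w w' :
  (forall z v v', teq v v' -> W z v -> W z v') ->
  footpoint_map Lam W Om -> teq w w' -> fibered Lam W w ->
  teq (Om w) (Om w').
Proof.
move=> HW HOm ww' fw; have [L1 W1 _] := HOm w fw.
have W2 := HW _ _ _ ww' W1.
have fw' : fibered Lam W w' by exists (Om w).
by have [_ _] := HOm w' fw'; apply.
Qed.

Lemma stable_fiber_teq lam eps z v v' : `|eps| < eps0 -> teq v v' ->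
  stable_fiber lam (Psi eps) z v -> stable_fiber lam (Psi eps) z v'.
Proof.
move=> he vv' [C HC]; exists C => s s0; rewrite -(tdist_teq (flow_teq s he vv') (teq_refl _)).
exact: HC.
Qed.

Lemma unstable_fiber_teq mu eps z v v' : `|eps| < eps0 -> teq v v' ->
  unstable_fiber mu (Psi eps) z v -> unstable_fiber mu (Psi eps) z v'.
Proof.
move=> he vv' [C HC]; exists C => s s0; rewrite -(tdist_teq (flow_teq s he vv') (teq_refl _)).
exact: HC.
Qed.

End extended_flow.

(** * Unperturbed orbits and the scattering map *)

Section torus_distance.
Variables (R : realType) (n d : nat).
Implicit Types z w : ephase R n d.

Let dvec z w : ephase R n d :=
  (mom z.1 - mom w.1, tdiff (pos z.1) (pos w.1), act z.1 - act w.1,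
   tdiff (ang z.1) (ang w.1), z.2 - w.2).

Lemma tdist_act z w : `|act z.1 - act w.1| <= tdist z w.
Proof. exact: le_trans (norm_act (dvec z w).1) (fst_norm (dvec z w)). Qed.

Lemma tdist_ang z w : `|tdiff (ang z.1) (ang w.1)| <= tdist z w.
Proof. exact: le_trans (norm_ang (dvec z w).1) (fst_norm (dvec z w)). Qed.

Lemma tdist_snd z w : `|z.2 - w.2| <= tdist z w.
Proof. exact: (snd_norm (dvec z w)). Qed.

Lemma close_teq (b : R) z z' w : teq z z' -> close b z w -> close b z' w.
Proof.
move=> /teq_sym/teq_shift Hz [m Hm Em]; exists (z' - z + m).
  exact: lattice_shift_add.
by rewrite opprD !addrA opprB [_ + (z - z')]addrC addrA subrK.
Qed.

End torus_distance.

Section unperturbed_orbits.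
Variables (R : realType) (n d : nat).
Variables (X0 : phase R n d -> phase R n d)
  (X1 : phase R n d -> R -> R -> phase R n d) (freq : 'rV[R]_d -> 'rV[R]_d).
Variables (Y : ephase R n d -> ephase R n d) (Phi Psi : R -> ephase R n d -> ephase R n d).
Variables (D O : set 'rV[R]_d) (delta : R).
Local Notation F := (ext_field X0 X1 0).
Hypothesis act0 : forall z, act (X0 z) = 0.
Hypothesis ang0 : forall z, ang (X0 z) = freq (act z).
Hypotheses (HPhi : is_flow F Phi) (HPsi : is_flow Y Psi).
Hypothesis HY : forall w, O (act w.1) -> Y w = F w.
Hypothesis delta0 : 0 < delta.
Hypothesis HO : forall I J, D I -> `|J - I| < delta -> O J.

Let actF w : act (F w).1 = 0.
Proof. by rewrite ext_field_fst scale0r addr0. Qed.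

Let angF w : ang (F w).1 = freq (act w.1).
Proof. by rewrite ext_field_fst scale0r addr0. Qed.

(** The extended field is known to conserve actions only over [O]. It is enough that the action lies
    well inside [O] at one time [s0]: being constant near that value, it never leaves. The two time
    directions correspond to a = 1 and a = -1. *)
Lemma action_constant (g : R -> ephase R n d) (s0 r : R) :
  0 < r -> (forall s, is_derive s (1 : R) g (Y (g s))) ->
  (forall J, `|J - act (g s0).1| < r -> O J) ->
  forall s, act (g s).1 = act (g s0).1.
Proof.
move=> r0 Hg Hr s.
have H (a : R) : forall t, 0 <= t -> act (g (s0 + a * t)).1 = act (g (s0 + a * 0)).1.
  apply: (@constant_of_local _ _ r (fun t => act (g (s0 + a * t)).1)
    (fun t => act (a *: Y (g (s0 + a * t))).1)) => // [t|t].
    by apply: is_derive_act; apply: is_derive_affine.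
  by rewrite mulr0 addr0 => /Hr/HY ->; rewrite fst_scale phaseE actF scaler0.
have [s0s|ss0] := leP s0 s.
  have := H 1 (s - s0); rewrite mulr0 addr0 mul1r subrKC subr_ge0.
  by apply.
have := H (-1) (s0 - s); rewrite mulr0 addr0 mulN1r opprB subrKC subr_ge0.
by apply; exact: ltW.
Qed.

Lemma flow_action w : D (act w.1) -> forall s, act (Psi s w).1 = act w.1.
Proof.
move=> Dw s; have [E H] := HPsi w.
have := @action_constant (fun s => Psi s w) 0 delta delta0 H.
by rewrite /= E => ->// J; exact: HO.
Qed.

(** The unperturbed field conserves actions everywhere, so an orbit of [Phi] starting over D stays
    there and also solves the extended system. *)
Lemma flows_agree w : (forall w w', teq w w' -> Y w = Y w') -> locally_lipschitz Y ->
  D (act w.1) -> forall s, Phi s w = Psi s w.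
Proof.
move=> per lip Dw s.
have [E H] := HPhi w; have [E' H'] := HPsi w.
have aPhi t : act (Phi t w).1 = act w.1.
  have C (a : R) : forall t, 0 <= t -> act (Phi (0 + a * t) w).1 = act (Phi (0 + a * 0) w).1.
    apply: (@constant_of_local _ _ 1 (fun t => act (Phi (0 + a * t) w).1)
      (fun t => act (a *: F (Phi (0 + a * t) w)).1)) => // [u|u _].
      by apply: is_derive_act; apply: (@is_derive_affine _ _ (fun s => Phi s w)).
    by rewrite fst_scale phaseE actF scaler0.
  have [t0|t0] := leP 0 t.
    by have := C 1 t t0; rewrite !add0r mulr0 mul1r E.
  have := C (-1) (- t); rewrite !add0r mulr0 mulN1r opprK E; apply.
  by rewrite oppr_ge0 ltW.
have HPhiY t : is_derive t (1 : R) (fun s => Phi s w) (Y (Phi t w)).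
  by rewrite HY// aPhi; apply: (HO Dw); rewrite subrr normr0.
have := @curve_unique _ _ _ Y (fun s => Psi s w) (fun s => Phi s w) per lip H' HPhiY.
by rewrite /= E E' subrr => /(_ (teq_refl _) s) ->; rewrite addr0.
Qed.

(* Exponential asymptotics to the orbit of [p] forces equal actions, hence equal
   frequencies, hence a constant and therefore vanishing phase difference. *)
Lemma asymptotic_phase (sigma nu C : R) w p : 0 < nu -> `|sigma| = 1 -> D (act p.1) ->
  (forall s : R, 0 <= s ->
     tdist (Psi (sigma * s) w) (Psi (sigma * s) p) <= C * expR (- (nu * s))) ->
  [/\ act w.1 = act p.1, lattice (ang w.1 - ang p.1) & w.2 = p.2].
Proof.
move=> nu0 sigma1 Dp Hd.
have [Ew Hw] := HPsi w; have [Ep Hp] := HPsi p.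
have ap := flow_action Dp.
(* The field along the orbit of w is unknown until its action comes within delta of that of p; if
   this never happened, the decay would force delta <= 0. *)
have [s0 [s00 hs0]] : exists s0 : R, 0 <= s0 /\ `|act (Psi (sigma * s0) w).1 - act p.1| < delta.
  apply: contrapT => H.
  suff : delta <= 0 by rewrite leNgt delta0.
  apply: (decay_to_zero nu0 (C := C)) => s s0; rewrite leNgt; apply/negP => hs.
  apply: H; exists s; split => //; apply: le_lt_trans hs; apply: le_trans (Hd s s0).
  by rewrite -(ap (sigma * s)) tdist_act.
have aw s : act (Psi s w).1 = act (Psi (sigma * s0) w).1.
  apply: (@action_constant (fun s => Psi s w) (sigma * s0)
    (delta - `|act (Psi (sigma * s0) w).1 - act p.1|)) => //; first by rewrite subr_gt0.
  move=> J hJ; apply: (HO Dp).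
  have := norm_triangle (esym (subrKA (act (Psi (sigma * s0) w).1) J (- act p.1)))
    (lexx _) (lexx _).
  by move=> /le_lt_trans; apply; move: hJ; lra.
have awp : act w.1 = act p.1.
  apply/eqP; rewrite -subr_eq0 -normr_le0.
  apply: (decay_to_zero nu0 (C := C)) => t t0; apply: le_trans (Hd t t0).
  apply: le_trans (tdist_act _ _); rewrite ap aw.
  by have := aw 0; rewrite Ew => ->.
have {}aw s : act (Psi s w).1 = act p.1 by rewrite aw -awp -[in RHS]Ew aw.
have Dw : D (act w.1) by rewrite awp.
have solves v : is_flow Y Psi -> (forall s, act (Psi s v).1 = act p.1) -> forall s,
    is_derive s (1 : R) (fun s => Psi (0 + sigma * s) v) (sigma *: F (Psi (0 + sigma * s) v)).
  move=> _ av s; apply: (@is_derive_affine _ _ (fun s => Psi s v)).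
  rewrite -HY; first by have [_] := HPsi v.
  by rewrite av; apply: (HO Dp); rewrite subrr normr0.
have Sw := solves w HPsi aw; have Sp := solves p HPsi ap.
have angC s : 0 <= s -> ang (Psi (0 + sigma * s) w).1 - ang (Psi (0 + sigma * s) p).1 =
    ang w.1 - ang p.1.
  move=> t0.
  have := @constant_of_local _ _ 1 (fun s => ang (Psi (0 + sigma * s) w).1 -
    ang (Psi (0 + sigma * s) p).1 - 0) (fun=> 0) ltr01 _ (fun _ _ => erefl) s t0.
  rewrite /= !subr0 mulr0 addr0 Ew Ep; apply => t.
  have := is_derive_subC 0 (is_derive_ang (Sw t)) (is_derive_ang (Sp t)).
  by rewrite !fst_scale !ang_scale !angF aw ap subrr.
have sndC s : 0 <= s -> (Psi (0 + sigma * s) w).2 - (Psi (0 + sigma * s) p).2 = w.2 - p.2.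
  move=> t0.
  have := @constant_of_local _ _ 1 (fun s => (Psi (0 + sigma * s) w).2 -
    (Psi (0 + sigma * s) p).2 - 0) (fun=> 0) ltr01 _ (fun _ _ => erefl) s t0.
  rewrite /= !subr0 mulr0 addr0 Ew Ep; apply => t.
  have := is_derive_subC 0 (is_derive_snd (Sw t)) (is_derive_snd (Sp t)).
  by rewrite !snd_scale !ext_field_snd subrr.
split => //.
- have E s : 0 <= s -> tdiff (ang (Psi (sigma * s) w).1) (ang (Psi (sigma * s) p).1) =
      tdiff (ang w.1) (ang p.1).
    move=> t0; apply/rowP => j; rewrite !mxE.
    by have /rowP/(_ j) := angC s t0; rewrite add0r !mxE => ->.
  have : tdiff (ang w.1) (ang p.1) = 0.
    apply/eqP; rewrite -normr_le0; apply: (decay_to_zero nu0 (C := C)) => s t0.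
    by apply: le_trans (Hd s t0); rewrite -(E s t0) tdist_ang.
  by have := @tdiff_lattice R _ (ang w.1) (ang p.1); move=> + E0; rewrite E0 subr0.
- apply/eqP; rewrite -subr_eq0 -normr_le0; apply: (decay_to_zero nu0 (C := C)) => s t0.
  by apply: le_trans (Hd s t0); rewrite -(sndC s t0) add0r tdist_snd.
Qed.

End unperturbed_orbits.

Lemma lipschitz_along_curve (R : realType) (V : normedModType R) (f : V -> R) (C : R)
    (g dg : R -> V) : (forall u v, `|f u - f v| <= C * `|u - v|) ->
  (forall s, is_derive s (1 : R) g (dg s)) -> continuous (fun s => f (g s)).
Proof.
move=> Hf Hg s; apply/cvgrPdist_le => eta eta0.
have C0 : 0 < `|C| + 1 by rewrite ltr_wpDl.
have [e e0 He] := is_derive_continuous (Hg s) (divr_gt0 eta0 C0).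
exists e => //= t; rewrite /ball /= => st.
have := He (t - s); rewrite distrC subrKC => /(_ st); rewrite ler_pdivlMr// => H.
rewrite distrC; apply: le_trans (Hf _ _) _; apply: le_trans H.
by rewrite mulrC ler_wpM2l// (le_trans (ler_norm _))// lerDl.
Qed.

(** The inverse of the unstable projection is a choice by [xget]. Injectivity on the channel
    identifies the chosen point with w modulo the lattice, and the stable projection respects
    this. *)
Lemma scattering_teq (R : realType) n d (D : set 'rV[R]_d) (k : base R d -> ephase R n d)
    (U : set (base R d)) (G : base R d -> ephase R n d)
    (Lam : set (ephase R n d)) (Ws Wu : ephase R n d -> set (ephase R n d))
    (Op Om : ephase R n d -> ephase R n d) (w : ephase R n d) :
  (forall z v v', teq v v' -> Ws z v -> Ws z v') ->
  (forall z v v', teq v v' -> Wu z v -> Wu z v') ->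
  footpoint_map Lam Ws Op -> footpoint_map Lam Wu Om ->
  channel_set U G `<=` fibered Lam Ws `&` fibered Lam Wu ->
  channel_diffeo D k U G Om -> channel_set U G w ->
  teq (scattering_map (channel_set U G) Op Om (Om w)) (Op w).
Proof.
move=> HWs HWu HOp HOm sub [inj _] Gw.
rewrite /scattering_map; set P := [set z | _].
have [Gz Omz] : P (xget (Om w) P).
  by apply: xgetPex; exists w; split => //; exact: teq_refl.
set z := xget _ _ in Gz Omz *.
have [y Uy wy] := Gw; have [y' Uy' zy'] := Gz.
have GG x : U x -> fibered Lam Wu (G x).
  by move=> Ux; have [] := sub (G x); first by exists x => //; exact: teq_refl.
have zw : teq z w.
  apply: (teq_trans zy'); apply: teq_trans (teq_sym wy).
  apply: inj => //.
  apply: teq_trans (footpoint_teq HWu HOm (teq_sym zy') (GG y' Uy')) _.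
  apply: (teq_trans Omz).
  exact: teq_sym (footpoint_teq HWu HOm (teq_sym wy) (GG y Uy)).
apply: (footpoint_teq HWs HOp zw).
by have [] := sub z Gz.
Qed.

(** * The angle formula *)

(** A single primitive Q of the combined integrand serves both half-lines. The weight s costs half
    of the decay rate and the tail half of the rest, which leaves nu / 4. *)
Lemma melnikov_primitive (R : realType) n d (X : ephase R n d -> phase R n d)
    (hess : 'M[R]_d) (g1 g2 dg1 dg2 : R -> ephase R n d) (M K nu : R) :
  0 < nu -> 0 <= K ->
  (forall u v, `|X u - X v| <= M * `|u - v|) ->
  (forall s, is_derive s (1 : R) g1 (dg1 s)) ->
  (forall s, is_derive s (1 : R) g2 (dg2 s)) ->
  (forall s, `|X (g1 s) - X (g2 s)| <= K * expR (- (nu * `|s|))) ->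
  let a s := ang (X (g1 s) - X (g2 s)) in
  let b s := s *: act (X (g1 s) - X (g2 s)) in
  [/\ vintegrable a, vintegrable b & exists (Q : R -> 'rV[R]_d) (C : R), [/\ 0 <= C,
    forall s, is_derive s (1 : R) Q
      (a s - s *: (act (X (g1 s) - X (g2 s)) *m hess)) &
    forall T, 0 <= T -> `|vintegral a - vintegral b *m hess - (Q T - Q (- T))|
      <= C * expR (- (nu / 4 * T))]].
Proof.
move=> nu0 K0 XL D1 D2 HK a b.
have cont (l : phase R n d -> R) : (forall u v, l u - l v = l (u - v)) ->
    (forall u, `|l u| <= `|u|) -> continuous (fun s => l (X (g1 s) - X (g2 s))).
  move=> lB lN s.
  have lX u v : `|l (X u) - l (X v)| <= M * `|u - v|.
    by rewrite lB (le_trans (lN _)).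
  under eq_fun do rewrite -lB.
  apply: continuousB; first exact: (lipschitz_along_curve lX D1).
  exact: (lipschitz_along_curve lX D2).
have ca j : continuous (fun s => a s 0 j).
  apply: (cont (fun u => ang u 0 j)) => [u v|u]; first by rewrite ang_sub !mxE.
  exact: le_trans (row_norm_ge _ _) (norm_ang _).
have cb j : continuous (fun s => b s 0 j).
  have -> : (fun s => b s 0 j) = (fun s => s * act (X (g1 s) - X (g2 s)) 0 j).
    by apply/funext => s; rewrite mxE.
  move=> s; apply: (@continuousM _ _ id); first exact: cvg_id.
  apply: (cont (fun u => act u 0 j)) => [u v|u]; first by rewrite act_sub !mxE.
  exact: le_trans (row_norm_ge _ _) (norm_act _).
have Ha s : `|a s| <= K * expR (- (nu * `|s|)) by exact: le_trans (norm_ang _) (HK s).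
have nu20 : 0 < nu / 2 by rewrite divr_gt0.
have K20 : 0 <= 2 / nu * K by rewrite !mulr_ge0 ?invr_ge0 ?(ltW nu0).
(* From x exp (- x) <= 1 at x = nu |s| / 2. *)
have Hb s : `|b s| <= 2 / nu * K * expR (- (nu / 2 * `|s|)).
  rewrite normrZ.
  apply: (@le_trans _ _ (`|s| * (K * expR (- (nu * `|s|))))).
    by rewrite ler_wpM2l// (le_trans (norm_act _)).
  have -> : expR (- (nu * `|s|)) = expR (- (nu / 2 * `|s|)) * expR (- (nu / 2 * `|s|)).
    by rewrite -expRD; congr expR; field.
  have h : `|s| * expR (- (nu / 2 * `|s|)) <= 2 / nu.
    rewrite expRN ler_pdivrMr ?expR_gt0//.
    have := expR_ge1Dx (nu / 2 * `|s|); set E := expR _ => hE.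
    have -> : `|s| = 2 / nu * (nu / 2 * `|s|) by field; rewrite gt_eqF.
    by rewrite ler_wpM2l ?divr_ge0 ?(ltW nu0)//; move: hE; lra.
  have E0 : 0 <= K * expR (- (nu / 2 * `|s|)) by rewrite mulr_ge0// expR_ge0.
  move: (ler_wpM2r E0 h); set E := expR _ => {}h.
  have -> : `|s| * (K * (E * E)) = `|s| * E * (K * E) by ring.
  by rewrite -[2 / nu * K * E]mulrA.
have [Ia [Qa [Ca [Ca0 Da Ta]]]] := row_decaying_integral nu0 K0 ca Ha.
have [Ib [Qb [Cb [Cb0 Db Tb]]]] := row_decaying_integral nu20 K20 cb Hb.
split => //.
pose S := \sum_i \sum_j `|hess i j|.
have S0 : 0 <= S by apply: sumr_ge0 => i _; exact: sumr_ge0.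
exists (fun s => Qa s - Qb s *m hess), (Ca + S * Cb); split.
- by rewrite addr_ge0// mulr_ge0.
- move=> s; have -> : s *: (act (X (g1 s) - X (g2 s)) *m hess) = b s *m hess.
    by rewrite /b scalemxAl.
  have Hh : is_derive s (1 : R) (fun s => Qb s *m hess) (b s *m hess).
    apply: (@is_derive_linear _ _ _ (fun v : 'rV[R]_d => v *m hess) S) => //.
      by move=> c u v; rewrite mulmxDl scalemxAl.
    exact: mulmx_bound.
  exact: is_deriveB.
move=> T T0.
have -> : vintegral a - vintegral b *m hess - (Qa T - Qb T *m hess - (Qa (- T) - Qb (- T) *m hess)) =
    (vintegral a - (Qa T - Qa (- T))) - (vintegral b - (Qb T - Qb (- T))) *m hess.
  rewrite !mulmxBl; set x := _ *m hess; set y := _ *m hess; set z := _ *m hess.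
  by apply/rowP => j; rewrite !mxE; ring.
apply: le_trans (ler_normB _ _) _; rewrite mulrDl; apply: lerD.
  apply: le_trans (Ta T T0) _; rewrite ler_wpM2l// ler_expR lerN2 ler_wpM2r//.
  by move: nu0; lra.
apply: le_trans (mulmx_bound _ _) _; rewrite -/S -[S * Cb * _]mulrA; apply: ler_wpM2l => //.
apply: le_trans (Tb T T0) _; rewrite ler_wpM2l// ler_expR lerN2 ler_wpM2r//.
by move: nu0; lra.
Qed.

(** In the difference of the two estimates the angle [th0] of the homoclinic point and the value Q 0
    cancel, leaving [Q T - Q (- T)], which is the full integral up to tails. *)
Lemma combine_half_lines (R : realType) d (thp thm th0 : R -> 'rV[R]_d)
    (Q : R -> 'rV[R]_d) (v : 'rV[R]_d) (nu rho C' : R) : 0 < nu -> 0 < rho < 1 -> 0 <= C' ->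
  (exists C eps1 : R, [/\ 0 <= C, 0 < eps1 & forall eps, 0 < `|eps| < eps1 ->
    exists2 k : 'rV[R]_d, lattice k & `|thp eps - th0 eps - k +
      (1 * eps) *: (Q (8 / nu * - ln `|eps|) - Q 0)| <= C * `|eps| `^ (1 + rho)]) ->
  (exists C eps1 : R, [/\ 0 <= C, 0 < eps1 & forall eps, 0 < `|eps| < eps1 ->
    exists2 k : 'rV[R]_d, lattice k & `|thm eps - th0 eps - k +
      (-1 * eps) *: (- Q (- (8 / nu * - ln `|eps|)) - - Q (- 0))| <= C * `|eps| `^ (1 + rho)]) ->
  (forall T, 0 <= T -> `|v - (Q T - Q (- T))| <= C' * expR (- (nu / 4 * T))) ->
  exists C delta : R, 0 < delta /\ forall eps, 0 < `|eps| < delta ->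
    `|tdiff (thp eps) (thm eps) + eps *: v| <= C * `|eps| `^ (1 + rho).
Proof.
move=> nu0 /andP[rho0 rho1] C'0 [C1 [e1 [C10 e10 H1]]] [C2 [e2 [C20 e20 H2]]] HQ.
pose C := C1 + C2 + C'.
have C0 : 0 <= C by rewrite !addr_ge0.
(* For |eps| below the inverse of this number the lifted difference is less than 1/2, hence equal to
   [tdiff]. *)
have K0 : 0 < 2 * (`|v| + C + 1) by rewrite mulr_gt0// ltr_wpDl// addr_ge0.
exists C, (Num.min 1 (Num.min (2 * (`|v| + C + 1))^-1 (Num.min e1 e2))); split.
  by rewrite !lt_min ltr01 invr_gt0 K0 e10.
move=> eps /andP[e0]; rewrite !lt_min => /and4P[/ltW le1 eK he1 he2].
have [k1 Hk1 E1] := H1 eps (ltac:(by rewrite e0)).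
have [k2 Hk2 E2] := H2 eps (ltac:(by rewrite e0)).
pose T := 8 / nu * - ln `|eps|; rewrite -/T in E1 E2.
have T0 : 0 <= T.
  by rewrite mulr_ge0 ?divr_ge0 ?(ltW nu0)// oppr_ge0 ln_le0.
(* At T = (8 / nu) ln (1 / |eps|) the tail rate nu / 4 gives exactly eps^2. *)
have ET : expR (- (nu / 4 * T)) = `|eps| ^+ 2.
  have -> : - (nu / 4 * T) = ln `|eps| * 2%:R by rewrite /T; field; rewrite gt_eqF.
  by rewrite expRM_natr lnK.
set p := `|eps| `^ (1 + rho) in E1 E2 *.
have p0 : 0 <= p by exact: powR_ge0.
have p1 : `|eps| ^+ 3 <= p.
  rewrite -powR_mulrn// /p ger_powR ?e0//; move: rho1; lra.
have pe : p <= `|eps|.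
  rewrite -[leRHS]powRr1// /p ger_powR ?e0//; move: rho0; lra.
pose D := thp eps - thm eps - (k1 - k2).
have HD : `|D + eps *: v| <= C * p.
  have -> : D + eps *: v = (thp eps - th0 eps - k1 + (1 * eps) *: (Q T - Q 0)) -
      (thm eps - th0 eps - k2 + (-1 * eps) *: (- Q (- T) - - Q (- 0))) +
      eps *: (v - (Q T - Q (- T))).
    by rewrite oppr0; apply/rowP => j; rewrite !mxE; ring.
  apply: le_trans (ler_normD _ _) _.
  have h3 : `|eps *: (v - (Q T - Q (- T)))| <= C' * p.
    rewrite normrZ; apply: (@le_trans _ _ (`|eps| * (C' * `|eps| ^+ 2))).
      by rewrite ler_wpM2l// -ET HQ.
    by rewrite mulrCA ler_wpM2l// -exprS.
  have h12 := le_trans (ler_normB _ _) (lerD E1 E2).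
  by apply: le_trans (lerD h12 h3) _; rewrite /C !mulrDl.
have Dsmall : `|D| < 2^-1.
  have -> : D = (D + eps *: v) - eps *: v by rewrite addrK.
  apply: le_lt_trans (ler_normB _ _) _; rewrite normrZ.
  have h : C * p <= C * `|eps| by rewrite ler_wpM2l.
  have h' : `|eps| * (2 * (`|v| + C + 1)) < 1.
    by rewrite -ltr_pdivlMr// mul1r.
  by move: HD h h' e0; lra.
by rewrite (tdiff_small (lattice_sub Hk1 Hk2)).
Qed.

Lemma common_bound (R : realType) (a1 a2 a3 b1 b2 b3 : R) : exists M : R,
  [/\ 1 <= M, a1 <= M, a2 <= M & a3 <= M] /\ [/\ b1 <= M, b2 <= M & b3 <= M].
Proof.
exists (Num.max 1 (Num.max a1 (Num.max a2 (Num.max a3 (Num.max b1 (Num.max b2 b3)))))).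
by split; split; rewrite !le_max !lexx ?orbT.
Qed.

Lemma angle_formula_ext (R : realType) n d (rho : R)
    (Phi0 : R -> ephase R n d -> ephase R n d) (A A' B B' : ephase R n d -> 'rV[R]_d)
    (hess : 'M[R]_d) (zp zm : R -> ephase R n d) (zpm z0 : ephase R n d) :
  (forall w, A' w = A w) -> (forall w, B' w = B w) ->
  angle_formula rho Phi0 A B hess zp zm zpm z0 ->
  angle_formula rho Phi0 A' B' hess zp zm zpm z0.
Proof. by move=> /funext -> /funext ->. Qed.

Theorem theorem5p5 (R : realType) (n d : nat) (hn : (0 < n)%N) (hd : (0 < d)%N) :
  exists r0 : nat, forall r : nat, (r0 <= r)%N ->
  forall
    (* the system and its perturbation *)
    (h0 : 'rV[R]_d -> R) (sg : 'I_n -> bool) (V : 'I_n -> R -> R)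
    (X1 : phase R n d -> R -> R -> phase R n d) (eps0 : R),
  let X0 := ham_field (rotator_pendulum h0 sg V) in
  Ck r.+1 setT h0 ->
  (forall i, Ck r.+1 setT (V i) /\ pendulum_potential (V i)) ->
  0 < eps0 ->
  perturbation r eps0 X1 ->
  forall Phi : R -> R -> ephase R n d -> ephase R n d,
  (forall eps, `|eps| < eps0 -> is_flow (ext_field X0 X1 eps) (Phi eps)) ->
  forall
    (* the extended system and the normally hyperbolic manifolds *)
    (c : 'rV[R]_d) (rad : R) (B : set 'rV[R]_d)
    (Y : R -> ephase R n d -> ephase R n d)
    (Psi : R -> R -> ephase R n d -> ephase R n d)
    (lam mu : R) (k : R -> base R d -> ephase R n d),
  let D := eball c rad in
  0 < rad ->
  extended_system eps0 D (ext_field X0 X1) Y ->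
  (forall eps, `|eps| < eps0 -> is_flow (Y eps) (Psi eps)) ->
  lam < 0 -> 0 < mu ->
  nhim_family eps0 D B lam mu Psi k ->
  forall
    (* stable and unstable fibers, foot points *)
    (Ks Ku : R -> base R d -> 'rV[R]_n -> ephase R n d)
    (Op Om : R -> ephase R n d -> ephase R n d),
  let Lam eps := manifold (k eps) D in
  let Ws eps := stable_fiber lam (Psi eps) in
  let Wu eps := unstable_fiber mu (Psi eps) in
  fibers_smooth eps0 D k Ws Ks ->
  fibers_smooth eps0 D k Wu Ku ->
  (forall eps, `|eps| < eps0 -> footpoint_map (Lam eps) (Ws eps) (Op eps)) ->
  (forall eps, `|eps| < eps0 -> footpoint_map (Lam eps) (Wu eps) (Om eps)) ->
  forall
    (* homoclinic channels *)
    (U : set (R * base R d)%type) (G : R -> base R d -> ephase R n d),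
  let Ueps eps := [set y | U (eps, y)] in
  let Gam eps := channel_set (Ueps eps) (G eps) in
  open U ->
  Ck 1 U (fun e : (R * base R d)%type => G e.1 e.2) ->
  (forall eps, 0 < `|eps| < eps0 ->
     homoclinic_channel D (k eps) (fibered (Lam eps) (Ws eps))
       (fibered (Lam eps) (Wu eps)) (Ks eps) (Ku eps) (Op eps) (Om eps)
       (Ueps eps) (G eps)) ->
  forall
    (* homoclinic points *)
    (z : R -> ephase R n d),
  (forall eps, 0 < `|eps| < eps0 -> Gam eps (z eps)) ->
  fibered (Lam 0) (Ws 0) (z 0) ->
  fibered (Lam 0) (Wu 0) (z 0) ->
  (exists C delta : R, 0 < delta /\
     forall eps, `|eps| < delta -> tdist (z eps) (z 0) <= C * `|eps|) ->
  (exists C : R, forall eps, `|eps| < eps0 ->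
     (forall s, 0 <= s ->
        tdist (Psi eps s (z eps)) (Psi eps s (Op eps (z eps)))
        <= C * expR (s * lam)) /\
     (forall s, s <= 0 ->
        tdist (Psi eps s (z eps)) (Psi eps s (Om eps (z eps)))
        <= C * expR (s * mu))) ->
  let zp eps := Op eps (z eps) in
  let zm eps := Om eps (z eps) in
  let zpm := zp 0 in
  let hess := hessian h0 (act zpm.1) in
  [/\ teq (zp 0) (zm 0),
      forall eps, 0 < `|eps| < eps0 ->
        teq (scattering_map (Gam eps) (Op eps) (Om eps) (zm eps)) (zp eps)
    & exists rho : R, [/\ 0 < rho < 1,
        angle_formula rho (Phi 0)
          (fun w => vf_act (fun z' => X1 z' w.2 0) ang w.1)
          (fun w => vf_act (fun z' => X1 z' w.2 0) act w.1)
          hess zp zm zpm (z 0)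
      & forall H1 : phase R n d -> R -> R -> R,
          ham_perturbation r eps0 X1 H1 ->
          angle_formula rho (Phi 0)
            (fun w => pbracket ang (fun z' => H1 z' w.2 0) w.1)
            (fun w => pbracket act (fun z' => H1 z' w.2 0) w.1)
            hess zp zm zpm (z 0)]].
Proof.
(* [r0 = 2] makes h0 of class C^3, as the expansion of the frequency requires; the potentials are
   used as C^2 and the perturbation as C^1. *)
exists 2%N => r r2 h0 sg V X1 eps0 X0 Ch0 CV eps00 HX1 Phi HPhi c rad B Y Psi lam mu k D
  rad0 HY HPsi lam0 mu0 Hnhim Ks Ku Op Om Lam Ws Wu HKs HKu HOp HOm U G Ueps Gam oU CG
  Hchan z Hz z0s z0u [Cz [dz [dz0 Hzz]]] [Cd Hdec] zp zm zpm hess.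
have he0 : `|0 : R| < eps0 by rewrite normr0.
have [perY Yt _ [ O [oO DO HYF]]] := HY.
have [_ _ _ [k0E [Cfoot Hk]] _] := Hnhim.
(* Channels are given for nonzero eps; at eps = 0 the foot points exist by the hypotheses on
   [z 0]. *)
have zpL eps : `|eps| < eps0 -> Lam eps (zp eps).
  move=> he; have [e0|e0] := eqVneq eps 0.
    by rewrite /zp e0; have [] := HOp 0 he0 _ z0s.
  have he' : 0 < `|eps| < eps0 by rewrite normr_gt0 e0.
  have [sub _ _ _] := Hchan eps he'; have [fs _] := sub _ (Hz eps he').
  by have [] := HOp eps he _ fs.
have zmL eps : `|eps| < eps0 -> Lam eps (zm eps).
  move=> he; have [e0|e0] := eqVneq eps 0.
    by rewrite /zm e0; have [] := HOm 0 he0 _ z0u.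
  have he' : 0 < `|eps| < eps0 by rewrite normr_gt0 e0.
  have [sub _ _ _] := Hchan eps he'; have [_ fu] := sub _ (Hz eps he').
  by have [] := HOm eps he _ fu.
have foot0 w : Lam 0 w -> [/\ mom w.1 = 0, lattice (pos w.1) & D (act w.1)].
  move=> [x Dx [[h1 h2 h3 h4] h5]]; rewrite k0E// in h1 h2 h3.
  by split; [exact: h1 | move: h2; rewrite {2}/pos /= subr0 | rewrite h3].
have foot eps w : `|eps| < eps0 -> Lam eps w ->
    [/\ `|mom w.1| <= Cfoot * `|eps|, exists2 l, lattice l & `|pos w.1 - l| <= Cfoot * `|eps|
      & exists2 I, D I & `|act w.1 - I| <= Cfoot * `|eps|].
  move=> he [x Dx [[h1 h2 h3 h4] h5]].
  have := Hk eps x he Dx; set kx := k eps x in h1 h2 h3 *; set k0 := k 0 x => Ek.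
  have k0x : k0 = (0, 0, x.1.1, x.1.2, x.2) by exact: k0E.
  have E1 : `|(kx - k0).1| <= Cfoot * `|eps| by exact: le_trans (fst_norm _) Ek.
  split.
  - rewrite h1; apply: le_trans E1; apply: le_trans (norm_mom _).
    by rewrite fst_sub mom_sub k0x {3}/mom /= subr0.
  - exists (pos w.1 - pos kx.1) => //; rewrite opprB subrKC.
    apply: le_trans E1; apply: le_trans (norm_pos _).
    by rewrite fst_sub pos_sub k0x {3}/pos /= subr0.
  - exists x.1.1; first exact: Dx.
    rewrite h3; apply: le_trans E1; apply: le_trans (norm_act _).
    by rewrite fst_sub act_sub k0x {3}/act /=.
have Ch3 : Ck 3 setT h0 by apply: Ck_weaken Ch0; rewrite ltnS.
have CV2 i : Ck 2 setT (V i) by apply: Ck_weaken (CV i).1; rewrite (leq_trans r2).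
have perV i x : V i (x + 1) = V i x by have [_ [+ _ _ _]] := CV i; apply.
have [Ma HMa] := rotator_pendulum_tame sg Ch3 CV2 perV.
have [Mb HMb] := perturbation_tame (leq_trans (leqnSn 1) r2) HX1.
pose I0 := act zpm.1.
have [Mc [dc [dc0 HMc]]] := frequency_tame I0 Ch3.
have [dm dm0 Hdm] := compact_margin (eball_compact (c := c) (rad := rad)) oO DO.
(* One radius with three roles: at most 1 for the constants, within the range of the frequency
   expansion, and within the margin of [O] around D. *)
pose delta := Num.min 1 (Num.min dc dm).
have delta0 : 0 < delta by rewrite !lt_min ltr01 dc0.
have delta1 : delta <= 1 by rewrite ge_min lexx.
have deltac : delta <= dc by rewrite !ge_min lexx orbT.
have HO I J : D I -> `|J - I| < delta -> O J.
  move=> DI h; apply: (Hdm I J DI); apply: lt_le_trans h _.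
  by rewrite !ge_min lexx !orbT.
(* One rate for both time directions. *)
pose nu := Num.min (- lam) mu.
have nu0 : 0 < nu by rewrite lt_min oppr_gt0 lam0.
have [M [[M1 MMa MMb MMc] [MCz MCd MCk]]] := common_bound Ma Mb Mc Cz Cd Cfoot.
have M0 : 0 <= M by exact: le_trans M1.
have TX0 := HMa M MMa; have TX1 := HMb M MMb; have Tfreq := HMc M delta MMc deltac.
have [[act0 ang0] _ _ _] := TX0.
have decp eps s : `|eps| < eps0 -> 0 <= s ->
    tdist (Psi eps (1 * s) (z eps)) (Psi eps (1 * s) (zp eps)) <= M * expR (- (nu * s)).
  move=> he s0; rewrite mul1r; apply: le_trans ((Hdec eps he).1 s s0) _.
  apply: (@le_trans _ _ (M * expR (s * lam))); first by rewrite ler_wpM2r ?expR_ge0.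
  rewrite ler_wpM2l// ler_expR -(opprK lam) mulrN lerN2 mulrC ler_wpM2l//.
  by rewrite /nu ge_min lexx.
have decm eps s : `|eps| < eps0 -> 0 <= s ->
    tdist (Psi eps (-1 * s) (z eps)) (Psi eps (-1 * s) (zm eps)) <= M * expR (- (nu * s)).
  move=> he s0; rewrite mulN1r.
  have s0' : - s <= 0 by rewrite oppr_le0.
  apply: le_trans ((Hdec eps he).2 _ s0') _.
  apply: (@le_trans _ _ (M * expR (- s * mu))); first by rewrite ler_wpM2r ?expR_ge0.
  rewrite ler_wpM2l// ler_expR mulNr lerN2 mulrC ler_wpM2l//.
  by rewrite /nu ge_min lexx orbT.
have HY0 w : O (act w.1) -> Y 0 w = ext_field X0 X1 0 w by exact: HYF.
have [pm0 pp0 Dp] := foot0 _ (zpL 0 he0).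
have [mm0 mp0 Dm] := foot0 _ (zmL 0 he0).
have N1 : `|-1 : R| = 1 by rewrite normrN1.
(* Each unperturbed foot point inherits action, angle modulo 1 and time from [z 0], forwards and
   backwards; as p = q = 0 on the unperturbed manifold, the two foot points coincide. *)
have [ap anp tp] := asymptotic_phase act0 ang0 (HPsi 0 he0) HY0 delta0 HO nu0 (normr1 R) Dp
  (fun s s0 => decp 0 s he0 s0).
have [am anm tm] := asymptotic_phase act0 ang0 (HPsi 0 he0) HY0 delta0 HO nu0 N1 Dm
  (fun s s0 => decm 0 s he0 s0).
have zpzm : teq (zp 0) (zm 0).
  split; last by rewrite -tp -tm.
  split; first by rewrite pm0 mm0.
  - exact: lattice_sub.
  - by rewrite -ap -am.
  - have -> : ang (zp 0).1 - ang (zm 0).1 = (ang (z 0).1 - ang (zm 0).1) - (ang (z 0).1 - ang (zp 0).1).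
      by rewrite opprB [RHS]addrC addrA subrK.
    exact: lattice_sub.
split => //.
  move=> eps he; have [e0 he'] := andP he.
  have [sub _ _ chm] := Hchan eps he.
  apply: (scattering_teq _ _ (HOp eps he') (HOm eps he') sub chm (Hz eps he)).
  - by move=> v u u'; exact: (stable_fiber_teq HY HPsi he').
  - by move=> v u u'; exact: (unstable_fiber_teq HY HPsi he').
pose th := nu / (2 * M + 1 + nu).
have L0 : 0 < 2 * M + 1 + nu by rewrite addr_gt0// ltr_wpDl// mulr_ge0.
have th0 : 0 < th by rewrite divr_gt0.
have th1 : th < 1 by rewrite ltr_pdivrMr// mul1r ltrDr ltr_wpDl// mulr_ge0.
have rho01 : 0 < th / 2 < 1.
  by rewrite divr_gt0//= ltr_pdivrMr// mul1r (lt_trans th1)// ltr1n.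
have Dz : D (act (z 0).1) by rewrite ap.
(* The integrals are taken along [Phi 0], whereas fibers and foot points are defined by [Psi 0]. *)
have agree w : D (act w.1) -> forall s, Phi 0 s w = Psi 0 s w.
  move=> Dw s; apply: (flows_agree act0 (HPhi 0 he0) (HPsi 0 he0) HY0 delta0 HO) => //.
    exact: perY.
  exact: (extended_system_lipschitz HY he0).
pose g1 s := Phi 0 s zpm; pose g2 s := Phi 0 s (z 0).
have D1 s : is_derive s (1 : R) g1 (ext_field X0 X1 0 (g1 s)) by have [_] := HPhi 0 he0 zpm.
have D2 s : is_derive s (1 : R) g2 (ext_field X0 X1 0 (g2 s)) by have [_] := HPhi 0 he0 (z 0).
have ag1 s : act (g1 s).1 = I0.
  by rewrite /g1 agree// (flow_action act0 (HPsi 0 he0) HY0 delta0 HO).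
have ag2 s : act (g2 s).1 = I0.
  by rewrite /g2 agree// (flow_action act0 (HPsi 0 he0) HY0 delta0 HO).
have clp eps s : `|eps| < eps0 -> 0 <= s ->
    close (M * expR (- (nu * s))) (Psi eps (1 * s) (zp eps)) (Psi eps (1 * s) (z eps)).
  by move=> he s0; apply/close_sym/tdist_close; exact: decp.
have clm eps s : `|eps| < eps0 -> 0 <= s ->
    close (M * expR (- (nu * s))) (Psi eps (-1 * s) (zm eps)) (Psi eps (-1 * s) (z eps)).
  by move=> he s0; apply/close_sym/tdist_close; exact: decm.
have cl1 s : 0 <= s -> close (M * expR (- (nu * s))) (g1 (0 + 1 * s)) (g2 (0 + 1 * s)).
  by move=> s0; rewrite add0r /g1 /g2 !agree//; exact: clp.
(* Backwards the orbit of [z 0] approaches that of [zm 0]; this differs from the orbit of [zpm] by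
   lattice vectors only. *)
have cl2 s : 0 <= s -> close (M * expR (- (nu * s))) (g1 (0 + -1 * s)) (g2 (0 + -1 * s)).
  move=> s0; rewrite add0r /g1 /g2 !agree//; apply: close_teq (clm 0 s he0 s0).
  exact: (flow_teq HY HPsi _ he0 (teq_sym zpzm)).
pose X w := X1 w.1 w.2 0.
have XL u v : `|X u - X v| <= M * `|u - v|.
  have := perturbation_difference TX1 v u he0 he0 (lattice_shift0 R n d).
  by rewrite subr0 subrr normr0 addr0.
have XK s : `|X (g1 s) - X (g2 s)| <= M * M * expR (- (nu * `|s|)).
  have key t : 0 <= t -> close (M * expR (- (nu * t))) (g1 s) (g2 s) ->
      `|X (g1 s) - X (g2 s)| <= M * M * expR (- (nu * t)).
    move=> t0 [m Hm Em]; have := perturbation_difference TX1 (g2 s) (g1 s) he0 he0 Hm.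
    rewrite subrr normr0 addr0 => /le_trans; apply.
    by rewrite -mulrA ler_wpM2l.
  have [s0|s0] := leP 0 s.
    by rewrite ger0_norm//; apply: key => //; have := cl1 s s0; rewrite add0r mul1r.
  have s0' : 0 <= - s by rewrite oppr_ge0 ltW.
  rewrite ltr0_norm//; apply: key => //.
  by have := cl2 _ s0'; rewrite add0r mulN1r opprK.
have [Ia Ib [Q [CQ [CQ0 DQ TQ]]]] := melnikov_primitive hess nu0 (mulr_ge0 M0 M0) XL D1 D2 XK.
(* The O(eps)-closeness of [z eps] to [z 0] is available only below [dz]. *)
pose eps1 := Num.min eps0 dz.
have eps10 : 0 < eps1 by rewrite lt_min eps00.
have eps1P eps : `|eps| < eps1 -> `|eps| < eps0 /\ `|eps| < dz by rewrite lt_min => /andP.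
have TX1' : tame_perturbation X1 eps1 M.
  have [x1 x2 x3] := TX1; split => //.
    by move=> ? ? ? /eps1P[? _]; exact: x2.
  by move=> ? ? ? ? /eps1P[? _] /eps1P[? _]; exact: x3.
have flow1 eps : `|eps| < eps1 -> is_flow (Y eps) (Psi eps) by move=> /eps1P[/HPsi].
have HY1 eps w : `|eps| < eps1 -> O (act w.1) -> Y eps w = ext_field X0 X1 eps w.
  by move=> /eps1P[? _]; exact: HYF.
have g20 : g2 0 = z 0 by rewrite /g2; have [-> _] := HPhi 0 he0 (z 0).
have g10 : g1 0 = zpm by rewrite /g1; have [-> _] := HPhi 0 he0 zpm.
have Hz1 eps : `|eps| < eps1 -> close (M * `|eps|) (z eps) (g2 0).
  move=> /eps1P[_ /Hzz h]; apply: tdist_close; rewrite g20; apply: le_trans h _.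
  by rewrite ler_wpM2r.
have Ckeps (eps : R) : Cfoot * `|eps| <= M * `|eps| by rewrite ler_wpM2r.
(* Times are written [0 + sigma * s] to match [is_derive_affine]. *)
have side (sigma : R) (zq : R -> ephase R n d) (Q' : R -> 'rV[R]_d) : `|sigma| = 1 ->
    (forall eps, `|eps| < eps0 -> Lam eps (zq eps)) ->
    (forall eps s, `|eps| < eps0 -> 0 <= s -> close (M * expR (- (nu * s)))
      (Psi eps (sigma * s) (zq eps)) (Psi eps (sigma * s) (z eps))) ->
    (forall s, 0 <= s -> close (M * expR (- (nu * s)))
      (g1 (0 + sigma * s)) (g2 (0 + sigma * s))) ->
    (forall s : R, 0 <= s -> is_derive s (1 : R) Q'
      (ang (X (g1 (0 + sigma * s)) - X (g2 (0 + sigma * s))) - (sigma * s) *: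
         (act (X (g1 (0 + sigma * s)) - X (g2 (0 + sigma * s))) *m hess))) ->
    exists C e1 : R, [/\ 0 <= C, 0 < e1 & forall eps, 0 < `|eps| < e1 ->
      exists2 l : 'rV[R]_d, lattice l & `|ang (zq eps).1 - ang (z eps).1 - l +
       (sigma * eps) *: (Q' (8 / nu * - ln `|eps|) - Q' 0)| <= C * `|eps| `^ (1 + th / 2)].
  move=> sg1 zqL clq clg DQ'.
  apply: (@half_line_asymptotics R n d X0 X1 (frequency h0) hess I0 eps1 delta M nu sigma
    Y Psi D O z zq (fun s => g2 (0 + sigma * s)) (fun s => g1 (0 + sigma * s))
    M1 delta0 delta1 nu0 eps10 sg1 TX0 TX1' Tfreq flow1 HO HY1 Dp _ _ _ _ _ _ _ _ _ _ _ Q' DQ').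
  - by rewrite mulr0 addr0; exact: Hz1.
  - move=> eps /andP[_ /eps1P[he _]]; have [_ _ [I DI h]] := foot eps _ he (zqL eps he).
    by exists I => //; apply: le_trans h _.
  - move=> eps /andP[_ /eps1P[he _]]; have [h _ _] := foot eps _ he (zqL eps he).
    exact: le_trans h _.
  - move=> eps /andP[_ /eps1P[he _]]; have [_ [l Hl h] _] := foot eps _ he (zqL eps he).
    by exists l => //; apply: le_trans h _.
  - by move=> eps s /eps1P[he _]; exact: clq.
  - by move=> s _; exact: (is_derive_affine (D2 _)).
  - by move=> s _; exact: (is_derive_affine (D1 _)).
  - by move=> s _; exact: ag2.
  - by move=> s _; exact: ag1.
  - exact: clg.
  - by rewrite mulr0 addr0 g10 g20; split => //; rewrite -tp.
have S1 := side 1 zp Q (normr1 R) zpL clp cl1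
  (fun s _ => ltac:(by rewrite add0r !mul1r; exact: DQ)).
(* Under time reversal the primitive becomes - Q (- s), whose derivative is the integrand at - s. *)
have S2 := side (-1) zm (fun s => - Q (- s)) N1 zmL clm cl2 _.
have AF : angle_formula (th / 2) (Phi 0) (fun w => ang (X w)) (fun w => act (X w)) hess
    zp zm zpm (z 0).
  have Ea : (fun s => ang (X (Phi 0 s zpm)) - ang (X (Phi 0 s (z 0)))) =
      (fun s => ang (X (g1 s) - X (g2 s))) by apply/funext => s; rewrite ang_sub.
  have Eb : (fun s => s *: (act (X (Phi 0 s zpm)) - act (X (Phi 0 s (z 0))))) =
      (fun s => s *: act (X (g1 s) - X (g2 s))) by apply/funext => s; rewrite act_sub.
  rewrite /angle_formula Ea Eb; split => //.
  have [|C [dl [dl0 HC]]] := combine_half_lines (thp := fun eps => ang (zp eps).1)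
    (thm := fun eps => ang (zm eps).1) nu0 rho01 CQ0 S1 _ TQ.
    apply: S2 => s s0.
    have H := is_derive_affine (a := -1) (b := 0) (DQ (0 + -1 * s)).
    have := is_deriveN H; rewrite scaleN1r opprK add0r mulN1r.
    by congr (is_derive _ _ _ _); apply/funext => t; rewrite -[LHS]/(- Q (0 + -1 * t)) add0r mulN1r.
  exists C, dl; split; first exact: dl0.
  move=> eps he; apply: le_trans (HC eps he).
  by rewrite scalerBr scaleNr opprD opprK.
exists (th / 2); split; first exact: rho01.
  by apply: angle_formula_ext AF => w; rewrite ?vf_act_ang ?vf_act_act.
(* At eps = 0 the field is J grad H1, so the brackets with H1 are the components of [X] already
   treated. *)
move=> H1 [_ _ HH]; apply: angle_formula_ext AF => w.
  by rewrite pbracket_vf_act vf_act_ang /X HH.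
by rewrite pbracket_vf_act vf_act_act /X HH.
Qed.
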